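(* Suppose that $H=\frac23$, $d=1$ and $k=1$, and let $t>0$. Then, as $\varepsilon\to0$, $$\Big(\log\frac1\varepsilon\Big)^{-1}\widehat{\alpha}'_{t,\varepsilon}(0)\ \overset{law}{\longrightarrow}\ N(0,\sigma^2),\qquad \sigma^2=\frac{t^{4/3}}{8\pi}\,B\Big(2,\frac13\Big),$$ where $B(\cdot,\cdot)$ is the Beta function.
   Context: $B^H=\{B^H_t,t\ge0\}$ is a one-dimensional fractional Brownian motion with Hurst parameter $H$: a centered Gaussian process with covariance $\mathbb{E}[B^H_tB^H_s]=\frac12\left[t^{2H}+s^{2H}-|t-s|^{2H}\right]$. For $\varepsilon>0$ let $f_\varepsilon(x)=(2\pi\varepsilon)^{-1/2}e^{-x^2/(2\varepsilon)}$, $x\in\mathbb{R}$, with derivative $f'_\varepsilon$, and $$\widehat{\alpha}'_{t,\varepsilon}(0)=-\int_{D}f'_\varepsilon(B^H_s-B^H_r)\,dr\,ds,\qquad D=\{(r,s):0<r<s<t\}.$$ $N(0,\sigma^2)$ is the centered Gaussian law with variance $\sigma^2$, and $\overset{law}{\to}$ denotes convergence in distribution. *)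

(* Defs.v *)
From HB Require Import structures.
From mathcomp Require Import all_boot all_order all_algebra.
From mathcomp Require Import all_classical all_reals all_analysis.

Set Implicit Arguments.
Unset Strict Implicit.
Unset Printing Implicit Defensive.

Import Order.TTheory GRing.Theory Num.Theory.
Import numFieldNormedType.Exports.

Local Open Scope classical_set_scope.
Local Open Scope ring_scope.

(* [N(m, v)], where [v] is the variance. The case [v = 0] is set apart because
   [normal_prob m 0] is the uniform law on [0, 1] and not the Dirac mass. *)
Definition gaussian_law {R : realType} (m v : R) :
    probability (measurableTypeR R) R :=
  if v == 0 then (@dirac _ (measurableTypeR R) m R : probability _ R)
  else (normal_prob m (Num.sqrt v) : probability (measurableTypeR R) R).

(* Laws are compared on measurable sets only: a library measure takes
   unspecified values on the other sets. *)
Definition gaussian {R : realType} {d : measure_display}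
    {T : measurableType d} (P : probability T R) (X : T -> R) : Prop :=
  exists m v : R, 0 <= v /\
    forall A : set R, measurable A -> P (X @^-1` A) = gaussian_law m v A.

Definition gaussian_process {R : realType} {d : measure_display}
    {T : measurableType d} (P : probability T R)
    (X : R -> {RV P >-> R}) : Prop :=
  forall (n : nat) (a s : 'I_n -> R), (forall i, 0 <= s i) ->
    gaussian P (fun w => \sum_(i < n) a i * X (s i) w).

(* Fractional Brownian motion; only the values at times [t >= 0] matter. The
   joint measurability of [(w, t) |-> X t w], which continuity of the paths
   implies, makes the time integrals of functionals of the path meaningful. *)
Record fractional_brownian_motion {R : realType} {d : measure_display}
    {T : measurableType d} (P : probability T R) (H : R)
    (X : R -> {RV P >-> R}) : Prop := FractionalBrownianMotion {
  fbm_gaussian : gaussian_process X ;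
  fbm_centered : forall t : R, 0 <= t -> ('E_P[X t] = 0)%E ;
  fbm_covariance : forall t s : R, 0 <= t -> 0 <= s ->
    'E_P[fun w => (X t w * X s w)%R]%E =
      (2^-1 * (t `^ (2 * H) + s `^ (2 * H) - `|t - s| `^ (2 * H)))%:E ;
  fbm_measurable : measurable_fun [set p : T * measurableTypeR R | 0 <= p.2]
    (fun p => X p.2 p.1) }.

Definition heat_kernel {R : realType} (eps x : R) : R :=
  (2 * pi * eps) `^ (- 2^-1) * expR (- x ^+ 2 / (2 * eps)).

(* [p = (r, s)] *)
Definition simplex2 {R : realType} (t : R) : set (R * R) :=
  [set p | 0 < p.1 /\ p.1 < p.2 /\ p.2 < t].

Definition alpha_hat' {R : realType} {T : Type} (X : R -> T -> R)
    (t eps : R) (w : T) : R :=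
  - \int[(lebesgue_measure \x lebesgue_measure)%E]_(p in simplex2 t)
      derive1 (heat_kernel eps) (X p.2 w - X p.1 w).

Definition euler_beta {R : realType} (a b : R) : R :=
  \int[lebesgue_measure]_(x in `]0, 1[) (x `^ (a - 1) * (1 - x) `^ (b - 1)).

(* Measurability of the [X i] is part of the notion, since they are given as
   plain functions. *)
Definition cvg_in_law {R : realType} {d : measure_display}
    {T : measurableType d} (P : probability T R) {I : Type}
    (X : I -> T -> R) (F : set_system I)
    (mu : probability (measurableTypeR R) R) : Prop :=
  (\forall i \near F, measurable_fun [set: T] (X i)) /\
  forall g : R -> R, continuous g -> bounded_fun g ->
    'E_P[g \o X i]%E @[i --> F] --> (\int[mu]_x (g x)%:E)%E.

(* Main.v *)
Require Import Defs.
From HB Require Import structures.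
From mathcomp Require Import all_boot all_order all_algebra.
From mathcomp Require Import all_classical all_reals all_analysis.
From mathcomp Require Import measurable_realfun.
From mathcomp Require Import ring lra.

Set Implicit Arguments.
Unset Strict Implicit.
Unset Printing Implicit Defensive.

Import Order.TTheory GRing.Theory Num.Theory.
Import numFieldNormedType.Exports.

Local Open Scope classical_set_scope.
Local Open Scope ring_scope.


(** Write B for the process, alpha' for the functional with parameter eps,
    L for log(1/eps), V(u) = |u|^(4/3) for the variance
    of an increment over a time u, and w(u) = (eps + V(u))^(-3/2). The index
    2/3 is critical: after division by L the functional converges not only in
    law but in mean square, to the multiple c B_t of the endpoint of the path
    with c = (3/4) (2 pi)^(-1/2). Since c B_t is Gaussian with variance
    c^2 t^(4/3) = (9/4) t^(4/3) / (8 pi) and B(2, 1/3) = 9/4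
    ([euler_beta_two_third]), the theorem follows from
    [mean_square_cvg_in_law] and from the estimate
    E (alpha' / L - c B_t)^2 <= K / L of [mean_square_error]. Expanding the
    square, three moments have to be known: E alpha'^2, E [alpha' B_t] and
    E B_t^2 = t^(4/3).

    The Fourier representation of f'_eps reduces the expectations to the
    characteristic function of a Gaussian pair (X, Y) with variances lam and
    rho and covariance m ([expectation_heat_kernel_pair]):
      E [f'_eps(X) f'_del(Y)]
        = m / (2 pi) ((eps + lam) (del + rho) - m^2)^(-3/2),
    and, letting del tend to infinity ([expectation_kernel_linear]),
      - E [f'_eps(X) Y] = (2 pi)^(-1/2) m (eps + lam)^(-3/2).
    By Fubini's theorem the moments of alpha' become integrals over the simplex
    0 < r < s < t, once or twice ([inner_alpha_end], [inner_alpha_alpha]).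

    For the mixed moment, the covariance of B_s - B_r with B_t is G(s) - G(r)
    with G(y) = Cov(B_y, B_t), a nondecreasing function with G(0) = 0 and
    G(t) = V(t). With u = s - r fixed, the integral over r telescopes, to the
    integral of G over [t - u, t] minus its integral over [0, u], which is
    u V(t) + O(u^2). Hence (2 pi)^(1/2) E [alpha' B_t] >= V(t) l - O(1),
    where l is the integral of u w(u) over [0, t] ([first_chaos_lower]). The
    weight w(u) lies between (eta + u)^(-2) and (eta^2 + u^2)^(-1) with
    eta = eps^(3/4), so that l = (3/4) L + O(1) ([integral_weight_log]); this
    is where the constant 3/4 comes from.

    For the second moment, split off from m det^(-3/2) the part
    m (eps + lam)^(-3/2) (eps + rho)^(-3/2), which is the contribution of the
    first Wiener chaos. The telescoping argument, used in both pairs of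
    variables, bounds its integral by V(t) l^2. The remainder is of order
    1 + L only: [kernel_bound] bounds it pointwise by products of negative
    powers of the distances between the four times, and [integral_majorant]
    integrates them one variable after the other, at the price of one
    logarithm at most. Altogether E alpha'^2 <= (2 pi)^(-1) V(t) l^2 + O(L)
    ([second_moment_le]), and in the expanded square the terms of order one
    cancel.

    The pointwise bound depends on the relative position of the intervals
    [r, s] and [r', s']: disjoint, overlapping or nested. In terms of the
    three gaps between the four ordered times, everything follows from lower
    bounds on 2 x 2 Gram determinants. Lengths are written as cubes, so that
    the power 4/3 becomes a fourth power and these bounds are polynomial. *)

Local Notation plane R := (measurableTypeR R * measurableTypeR R)%type.

(** * Lebesgue integrals on the line *)

Section lebesgue_tools.
Context {R : realType}.
Notation mu := (@lebesgue_measure R).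
Local Open Scope ereal_scope.

Lemma measurable_shift (a : R) :
  measurable_fun [set: measurableTypeR R]
    (fun x : measurableTypeR R => (x + a)%R : measurableTypeR R).
Proof. exact: measurable_funD. Qed.

Lemma lebesgue_measure_shift (a : R) (A : set R) : measurable A ->
  pushforward mu
    (fun x : measurableTypeR R => (x + a)%R : measurableTypeR R) A = mu A.
Proof.
move=> mA; apply/esym/lebesgue_measure_unique => //=.
  exact: measurable_shift.
move=> ? _ [[x y]] _ <-.
rewrite /pushforward.
rewrite (_ : _ @^-1` _ = `](x - a)%R, (y - a)%R]%classic).
  rewrite !lebesgue_measure_itv/= !lte_fin ltrD2r.
  by case: ifP => // _; rewrite -!EFinB; congr EFin; lra.
by apply/seteqP; split=> z /=; rewrite !in_itv/= ltrBlDr lerBrDr.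
Qed.

Lemma ge0_integral_shift (a : R) (f : R -> \bar R) :
  measurable_fun [set: R] f -> (forall x, 0 <= f x) ->
  \int[mu]_x f (x + a)%R = \int[mu]_x f x.
Proof.
move=> mf f0; pose s := fun x : measurableTypeR R => (x + a)%R : measurableTypeR R.
transitivity (\int[pushforward mu s]_x f x).
  by rewrite ge0_integral_pushforward//; exact: measurable_shift.
apply: eq_measure_integral => //=; first exact: measurable_shift.
by move=> _ A mA _; exact: lebesgue_measure_shift.
Qed.

Lemma ge0_integral_opp (f : R -> \bar R) :
  measurable_fun [set: R] f -> (forall x, 0 <= f x) ->
  \int[mu]_x f (- x)%R = \int[mu]_x f x.
Proof.
move=> mf f0.
transitivity (\int[pushforward mu (-%R : _ -> measurableTypeR R)]_x f x).
  by rewrite ge0_integral_pushforward.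
apply: eq_measure_integral => //= A mA _.
exact: lebesgue_measureN.
Qed.

(** A point of ]0, t[ sees at most two copies of ]0, t[, one on each side. *)
Lemma ge0_integral_dist_le (t y : R) (h : R -> R) :
  (0 < y < t)%R -> measurable_fun [set: R] h -> (forall x, 0 <= h x)%R ->
  \int[mu]_(x in `]0%R, t[) (h `|x - y|)%:E <=
  2%:E * \int[mu]_(x in `]0%R, t[) (h x)%:E.
Proof.
move=> /andP[y0 yt] mh h0.
have t0 : (0 < t)%R by lra.
pose k x := (h x * \1_(`[0%R, t[) x)%R.
have mk : measurable_fun [set: R] k.
  by apply: measurable_funM => //; exact: measurable_indic.
have k0 x : (0 <= k x)%R by rewrite mulr_ge0.
have mkE : measurable_fun [set: R] (fun x => (k x)%:E) by exact/measurable_EFinP.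
have kE : \int[mu]_x (k x)%:E = \int[mu]_(x in `]0%R, t[) (h x)%:E.
  rewrite integral_itv_obnd_cbnd; last first.
    by apply/measurable_EFinP; exact: measurable_funTS.
  rewrite [RHS]integral_mkcond; apply: eq_integral => x _.
  by rewrite patchE /k indicE; case: ifPn => /=; rewrite ?mulr1 ?mulr0.
rewrite -kE.
have mky : measurable_fun [set: R] (fun x => (k (x - y))%:E).
  by apply/measurable_EFinP/measurableT_comp => //; exact: measurable_funB.
have mkNy : measurable_fun [set: R] (fun x => (k (- (x - y)))%:E).
  apply/measurable_EFinP; apply: (@measurableT_comp _ _ _ _ _ _ k) => //.
  by apply: measurable_funN; exact: measurable_funB.
apply: (@le_trans _ _ (\int[mu]_x ((k (x - y))%:E + (k (- (x - y)))%:E))).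
  rewrite integral_mkcond.
  apply: ge0_le_integral => //=.
  - by move=> x _; rewrite patchE; case: ifPn => //= _; rewrite lee_fin.
  - apply/(measurable_restrictT _ _).1 => //.
    apply/measurable_EFinP; apply: (@measurableT_comp _ _ _ _ _ _ h) => //.
    apply: measurable_funTS; apply: measurableT_comp => //.
    exact: measurable_funB.
  - by apply: emeasurable_funD.
  - move=> x _; rewrite patchE; case: ifPn => [|_]; last first.
      by rewrite -EFinD lee_fin addr_ge0.
    rewrite inE/= in_itv/= => /andP[x0 xt].
    rewrite -EFinD lee_fin /k !indicE.
    have [xy|xy] := leP y x.
      rewrite (_ : (x - y)%R \in `[0%R, t[%classic = true) ?mulr1 ?lerDl ?mulr_ge0//.
        by rewrite ger0_norm ?subr_ge0// lerDl mulr_ge0.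
      by apply/mem_set; rewrite /= in_itv/=; apply/andP; split; lra.
    rewrite (_ : (- (x - y))%R \in `[0%R, t[%classic = true) ?mulr1.
      by rewrite ltr0_norm ?subr_lt0// lerDr mulr_ge0.
    by apply/mem_set; rewrite /= in_itv/=; apply/andP; split; lra.
rewrite ge0_integralD//; last 2 first.
- by move=> x _; rewrite lee_fin.
- by move=> x _; rewrite lee_fin.
have kE0 x : 0 <= (k x)%:E by rewrite lee_fin.
rewrite (@ge0_integral_shift (- y)%R (fun x => (k x)%:E))//.
rewrite (@ge0_integral_shift (- y)%R (fun x => (k (- x))%:E))//; last first.
  by apply/measurable_EFinP; exact: (@measurableT_comp _ _ _ _ _ _ k).
rewrite (@ge0_integral_opp (fun x => (k x)%:E))//.
by rewrite (_ : 2%:E = 1%:E + 1%:E)%E ?ge0_muleDl ?mul1e// -EFinD.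
Qed.

(** The integrand may blow up at the ends of the interval, as negative powers do:
    the classical formula holds on compact subintervals, and monotone
    convergence passes to the limit. *)
Lemma ge0_FTC_oo (f F : R -> R) (a b : R) : (a < b)%R ->
  (forall x, (a < x < b)%R -> 0 <= f x)%R ->
  (forall x, (a < x < b)%R -> {for x, continuous f}) ->
  (forall x, (a < x < b)%R -> is_derive x (1%R : R) F (f x)) ->
  F x @[x --> a^'+] --> F a -> F x @[x --> b^'-] --> F b ->
  \int[mu]_(x in `]a, b[) (f x)%:E = (F b - F a)%:E.
Proof.
move=> ab f0 cf dF Fa Fb.
pose d n := ((b - a) / (n.+3)%:R)%R.
pose l n := (a + d n)%R; pose r n := (b - d n)%R.
have d_gt0 n : (0 < d n)%R by rewrite divr_gt0 ?ltr0n// subr_gt0.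
have mono n m : (n <= m)%N -> (d m <= d n)%R.
  move=> nm; apply: ler_wpM2l; first by rewrite subr_ge0 ltW.
  by rewrite lef_pV2 ?posrE ?ltr0n// ler_nat !ltnS.
have d_le n : (d n <= (b - a) / 3)%R by have := mono 0%N n isT.
have lr n : (a < l n /\ l n < r n /\ r n < b)%R.
  have := d_gt0 n; have := d_le n; rewrite /l /r.
  by move: (d n) => k k1 k0; split; [lra|split; lra].
have h0 : d @ \oo --> (0 : R)%R.
  rewrite -[X in _ --> X](mulr0 (b - a)%R); apply: cvgMr.
  have H := @cvg_harmonic R; rewrite -(cvg_shiftn 2) in H.
  rewrite (_ : (fun n : nat => _) = (fun n => harmonic (n + 2)%N))//.
  by apply/funext => n; rewrite /= addn2.
have la : l @ \oo --> a.
  by rewrite -[X in _ --> X](addr0 a); apply: cvgD => //; exact: cvg_cst.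
have rb : r @ \oo --> b.
  by rewrite -[X in _ --> X](subr0 b); apply: cvgB => //; exact: cvg_cst.
have cupE : `]a, b[%classic = \bigcup_n `[l n, r n]%classic.
  apply/seteqP; split=> [x /=|x [n _] /=].
    rewrite in_itv/= => /andP[ax xb].
    have H : \forall n \near \oo, (l n <= x)%R /\ (x <= r n)%R.
      near=> n; split; apply: ltW.
      - by near: n; exact: (cvgr_lt a).
      - by near: n; exact: (cvgr_gt b).
    have [n [ln nr]] := filter_ex H.
    by exists n => //=; rewrite in_itv/= ln nr.
  have [an [ln nb]] := lr n.
  rewrite !in_itv/= => /andP[lx xr]; apply/andP; split; lra.
have ln_in n x : (l n <= x <= r n)%R -> (a < x < b)%R.
  have [an [_ nb]] := lr n; move=> /andP[lx xr]; apply/andP; split; lra.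
have intE n : \int[mu]_(x in `[l n, r n]) (f x)%:E = (F (r n) - F (l n))%:E.
  have [_ [lrn _]] := lr n.
  have Fc x : (l n <= x <= r n)%R -> {for x, continuous F}.
    move=> /ln_in /dF Fx.
    by apply: differentiable_continuous; apply/derivable1_diffP; exact: ex_derive.
  rewrite (@continuous_FTC2 _ f F)//.
  - apply: continuous_in_subspaceT => x /set_mem /=; rewrite in_itv/= => /ln_in.
    exact: cf.
  - split.
    + move=> x; rewrite in_itv/= => /andP[lx xr].
      suff /dF H : (a < x < b)%R by exact: ex_derive.
      by apply: (ln_in n); rewrite !ltW.
    + apply: cvg_at_right_filter; apply: Fc; rewrite lexx/=; exact: ltW.
    + apply: cvg_at_left_filter; apply: Fc; rewrite lexx andbT; exact: ltW.
  - move=> x; rewrite in_itv/= => /andP[lx xr].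
    suff /dF H : (a < x < b)%R by rewrite derive1E derive_val.
    by apply: (ln_in n); rewrite !ltW.
have mf n : measurable_fun `[l n, r n] (fun x => (f x)%:E).
  apply/measurable_EFinP; apply: subspace_continuous_measurable_fun => //.
  apply: continuous_in_subspaceT => x /set_mem /=; rewrite in_itv/= => /ln_in.
  exact: cf.
have H : \int[mu]_(x in `[l i, r i]) (f x)%:E @[i --> \oo] -->
    \int[mu]_(x in \bigcup_i `[l i, r i]%classic) (f x)%:E.
  apply: ge0_nondecreasing_set_cvg_integral => //.
  - move=> n m nm; apply/subsetPset => x /=; rewrite !in_itv/= => /andP[lx xr].
    have := mono _ _ nm; rewrite /l /r in lx xr *.
    by move: (d n) (d m) lx xr => ? ? ? ? ?; apply/andP; split; lra.
  - by move=> n x /=; rewrite in_itv/= => /ln_in; rewrite lee_fin; exact: f0.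
rewrite cupE; apply/esym; apply: cvg_unique H => //.
rewrite (_ : (fun i => _) = (fun i => (F (r i) - F (l i))%:E)); last first.
  by apply/funext => n; exact: intE.
apply: cvg_EFin; first exact: nearW.
apply: cvgB.
- by move/cvg_at_leftP : Fb; apply; split => // n; have [_ []] := lr n.
- by move/cvg_at_rightP : Fa; apply; split => // n; have [] := lr n.
Unshelve. all: by end_near. Qed.

Lemma continuous_powR (p x : R) : (0 < x)%R -> {for x, continuous (fun y : R => y `^ p)%R}.
Proof.
move=> x0; have H := @is_derive1_powR _ p _ x0.
by apply: differentiable_continuous; apply/derivable1_diffP; exact: ex_derive.
Qed.

Lemma ge0_integral_powRN (t q : R) : (0 < t)%R -> (0 < q < 1)%R ->
  \int[mu]_(x in `]0%R, t[) (x `^ (- q))%:E = (t `^ (1 - q) / (1 - q))%:E.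
Proof.
move=> t0 /andP[q0 q1]; have q1' : (1 - q != 0)%R by lra.
pose F (x : R) := (x `^ (1 - q) / (1 - q))%R.
have -> : (t `^ (1 - q) / (1 - q) = F t - F 0)%R.
  by rewrite /F powR0 ?mul0r ?subr0//; lra.
apply: (@ge0_FTC_oo (fun x => x `^ (- q))%R F) => //.
- by move=> x _; exact: powR_ge0.
- by move=> x /andP[x0 _]; exact: continuous_powR.
- move=> x /andP[x0 _]; have H := @is_derive1_powR _ (1 - q)%R _ x0.
  rewrite (_ : _ `^ _ = (1 - q)^-1 *: ((1 - q) * x `^ (1 - q - 1)))%R; last first.
    by rewrite /GRing.scale/= mulKf//; congr (_ `^ _)%R; ring.
  rewrite (_ : F = (1 - q)^-1 \*: (fun y : R => y `^ (1 - q)))%R.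
    exact: is_deriveZ.
  by apply/funext => y /=; rewrite /GRing.scale/= mulrC.
- rewrite /F powR0 ?mul0r//. rewrite -[X in _ --> X](mul0r (1 - q)^-1)%R; apply: cvgMl.
  by apply: powR_cvg0; lra.
- apply: cvg_at_left_filter; apply: cvgMl; exact: continuous_powR.
Qed.
End lebesgue_tools.

(** * Integrals against a Gaussian weight *)

Section gauss.
Context {R : realType}.
Notation mu := (@lebesgue_measure R).
Implicit Types A c C a s x : R.

Definition gauss_weight A x : R := expR (- (A * x ^+ 2 / 2)).

Lemma continuous_gauss_weight A : continuous (gauss_weight A).
Proof.
move=> x; apply: (@continuous_comp _ _ _ (fun x : R => - (A * x ^+ 2 / 2)) expR); last exact: continuous_expR.
apply: (@cvgN _ R^o); apply: cvgMl; apply: cvgMr; exact: sqr_continuous.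
Qed.

Lemma measurable_gauss_weight A : measurable_fun [set: R] (gauss_weight A).
Proof. by apply: continuous_measurable_fun; exact: continuous_gauss_weight. Qed.

Lemma gauss_weight_gt0 A x : 0 < gauss_weight A x. Proof. exact: expR_gt0. Qed.

Lemma is_derive_gauss_weight A x : is_derive x (1 : R) (gauss_weight A) (- (A * x) * gauss_weight A x).
Proof.
rewrite /gauss_weight.
apply: is_derive_eq.
by rewrite /GRing.scale/=; field.
Qed.

Lemma integral_gw_center A (m : R) : 0 < A ->
  (\int[mu]_x (gauss_weight A (x - m))%:E = (Num.sqrt (2 * pi / A))%:E)%E.
Proof.
move=> A0; pose s := Num.sqrt A^-1.
have s0 : 0 < s by rewrite sqrtr_gt0 invr_gt0.
have s2 : s ^+ 2 = A^-1 by rewrite sqr_sqrtr// invr_ge0 ltW.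
have K : normal_peak s = (Num.sqrt (2 * pi / A))^-1.
  by rewrite /normal_peak s2; congr (Num.sqrt _)^-1; rewrite -mulr_natr; ring.
have k0 : 0 < Num.sqrt (2 * pi / A).
  by rewrite sqrtr_gt0 divr_gt0// mulr_gt0// pi_gt0.
have := @integral_normal_pdf R m s.
rewrite normal_pdfE ?gt_eqF//.
have E x : normal_peak s * normal_fun m s x = normal_peak s * gauss_weight A (x - m).
  rewrite /normal_fun /gauss_weight s2; congr (_ * expR _).
  by rewrite -mulr_natr invfM invrK; ring.
under eq_integral do rewrite E EFinM.
rewrite ge0_integralZl_EFin//; first last.
- by rewrite K invr_ge0 ltW.
- apply/measurable_EFinP; apply: measurableT_comp; first exact: measurable_gauss_weight.
  exact: measurable_funB.
- by move=> x _; rewrite lee_fin ltW// gauss_weight_gt0.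
rewrite K; set I := (\int[mu]_x _)%E.
have I0 : (0 <= I)%E by apply: integral_ge0 => x _; rewrite lee_fin ltW// gauss_weight_gt0.
case: I I0 => [r| |] // _.
  move=> [H]; congr EFin; apply: (mulfI (invr_neq0 (lt0r_neq0 k0))).
  by rewrite H mulVf// gt_eqF.
by rewrite gt0_muley// lte_fin invr_gt0.
Qed.

Lemma gw_expR_complete A s x : 0 < A ->
  expR (s * x) * gauss_weight A x = expR (s ^+ 2 / (2 * A)) * gauss_weight A (x - s / A).
Proof. by move=> A0; rewrite /gauss_weight -!expRD; congr expR; field; rewrite gt_eqF. Qed.

Lemma integral_expR_gw A s : 0 < A ->
  (\int[mu]_x (expR (s * x) * gauss_weight A x)%:E =
   (expR (s ^+ 2 / (2 * A)) * Num.sqrt (2 * pi / A))%:E)%E.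
Proof.
move=> A0.
under eq_integral do rewrite gw_expR_complete// EFinM.
rewrite ge0_integralZl_EFin ?expR_ge0//.
- by rewrite integral_gw_center.
- by move=> x _; rewrite lee_fin ltW// gauss_weight_gt0.
- apply/measurable_EFinP; apply: measurableT_comp; first exact: measurable_gauss_weight.
  exact: measurable_funB.
Qed.

Lemma Rintegral_expR_gw A s : 0 < A ->
  \int[mu]_x (expR (s * x) * gauss_weight A x) =
  expR (s ^+ 2 / (2 * A)) * Num.sqrt (2 * pi / A).
Proof. by move=> A0; rewrite /Rintegral integral_expR_gw. Qed.

Lemma integrable_expR_gw A s : 0 < A ->
  mu.-integrable [set: R] (fun x => (expR (s * x) * gauss_weight A x)%:E).
Proof.
move=> A0; apply/integrableP; split.
  apply/measurable_EFinP; apply: measurable_funM; last exact: measurable_gauss_weight.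
  by apply: measurableT_comp => //; exact: measurable_funM.
under eq_integral do rewrite gee0_abs ?lee_fin ?mulr_ge0 ?expR_ge0//.
by rewrite integral_expR_gw// ltry.
Qed.

(** Exponential growth is dominated by the two one-sided exponentials, whose
    integrals are known by completing the square. *)
Lemma integrable_gauss_weight A c C (f : R -> R) : 0 < A -> measurable_fun [set: R] f ->
  (forall x, `|f x| <= C * expR (c * `|x|)) ->
  mu.-integrable [set: R] (fun x => (f x * gauss_weight A x)%:E).
Proof.
move=> A0 mf fC.
have C0 : 0 <= C.
  by have := fC 0; rewrite normr0 mulr0 expR0 mulr1; exact: le_trans.
apply: (@le_integrable _ _ _ mu _ _ _
   (fun x => C%:E * ((expR (c * x) * gauss_weight A x)%:E + (expR (- c * x) * gauss_weight A x)%:E))%E) => //.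
- apply/measurable_EFinP; apply: measurable_funM => //; exact: measurable_gauss_weight.
- move=> x _; rewrite -EFinD -EFinM abse_EFin abse_EFin lee_fin.
  rewrite [X in _ <= X]ger0_norm; last first.
    by rewrite mulr_ge0// addr_ge0// mulr_ge0// expR_ge0.
  rewrite normrM (ger0_norm (ltW (gauss_weight_gt0 A x))) -mulrDl mulrA.
  rewrite ler_pM2r ?gauss_weight_gt0//; apply: (le_trans (fC x)).
  rewrite ler_wpM2l//.
  have [x0|x0] := leP 0 x; first by rewrite ger0_norm// lerDl expR_ge0.
  by rewrite ltr0_norm// mulrN mulNr lerDr expR_ge0.
- by apply: integrableZl => //; apply: integrableD => //; exact: integrable_expR_gw.
Qed.

(** By dominated convergence along the symmetric intervals with integer
    endpoints, so that the boundary terms are only needed along integers. *)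
Lemma Rintegral_derivative0 (H h : R -> R) :
  (forall x, is_derive x (1 : R) H (h x)) -> continuous h ->
  mu.-integrable [set: R] (EFin \o h) ->
  H n%:R @[n --> \oo] --> (0 : R) -> H (- n%:R) @[n --> \oo] --> (0 : R) ->
  \int[mu]_x h x = 0.
Proof.
move=> dH ch ih Hp Hn.
have cH : continuous H.
  move=> x; apply: differentiable_continuous; apply/derivable1_diffP.
  by have := dH x => ?; exact: ex_derive.
have E (n : nat) : (0 < n)%N -> (\int[mu]_(x in `[(- n%:R)%R, n%:R%R]) (h x)%:E = (H n%:R - H (- n%:R))%:E)%E.
  move=> n0; have n0' : 0 < n%:R :> R by rewrite ltr0n.
  rewrite (@continuous_FTC2 _ h H)//.
  - by rewrite (lt_trans _ n0')// oppr_lt0.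
  - exact: continuous_subspaceT.
  - split.
    + by move=> x _; have := dH x => ?; exact: ex_derive.
    + by apply: cvg_at_right_filter; exact: cH.
    + by apply: cvg_at_left_filter; exact: cH.
  - by move=> x _; have := dH x => ?; rewrite derive1E derive_val.
have mh : measurable_fun [set: R] h by exact: continuous_measurable_fun.
have L : (\int[mu]_x (h x * \1_(`[(- n%:R)%R, n%:R%R]%classic) x)%:E)%E @[n --> \oo] -->
   (\int[mu]_x (h x)%:E)%E.
  apply: (@dominated_cvg _ _ _ mu _ measurableT _ _ (EFin \o (Num.norm \o h))) => //.
  - move=> n; apply/measurable_EFinP; by apply: measurable_funM => //.
  - move=> x _; apply: cvg_EFin; first exact: nearW.
    apply: cvg_near_cst; near=> n.
    rewrite /= indicE (_ : x \in _ = true) ?mulr1//.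
    apply/mem_set; rewrite /= in_itv/= -ler_norml.
    by near: n; exact: nbhs_infty_ger.
  - exact: integrable_norm.
  - move=> n x _; rewrite lee_fin normrM ler_piMr// indicE.
    by case: (_ \in _); rewrite ?normr1 ?normr0 ?ler01.
have L0 : (\int[mu]_x (h x * \1_(`[(- n%:R)%R, n%:R%R]%classic) x)%:E)%E @[n --> \oo] --> 0%:E.
  apply: (@cvg_trans _ ((H n%:R - H (- n%:R))%:E @[n --> \oo])).
    apply: near_eq_cvg; near=> n.
    rewrite -E; last by near: n; exact: nbhs_infty_gt.
    rewrite integral_mkcond; apply: eq_integral => x _.
    by rewrite patchE indicE; case: ifPn => /=; rewrite ?mulr1 ?mulr0.
  apply: cvg_EFin; first exact: nearW.
  by rewrite -[X in _ --> X](subr0 0); exact: cvgB.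
by rewrite /Rintegral (cvg_unique _ L L0).
Unshelve. all: by end_near. Qed.

(** Integration by parts, as the derivative of the weight is - A x times the
    weight; the growth conditions make the boundary terms vanish. *)
Lemma gauss_ibp A c C (f f' : R -> R) : 0 < A ->
  (forall x, is_derive x (1 : R) f (f' x)) -> continuous f' ->
  (forall x, `|f x| <= C * expR (c * `|x|)) ->
  (forall x, `|f' x| <= C * expR (c * `|x|)) ->
  \int[mu]_x (x * f x * gauss_weight A x) = A^-1 * \int[mu]_x (f' x * gauss_weight A x).
Proof.
move=> A0 df cf' fC f'C.
have C0 : 0 <= C.
  by have := fC 0; rewrite normr0 mulr0 expR0 mulr1; exact: le_trans.
have cf : continuous f.
  move=> x; apply: differentiable_continuous; apply/derivable1_diffP.
  by have := df x => ?; exact: ex_derive.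
have mf : measurable_fun [set: R] f by exact: continuous_measurable_fun.
have mf' : measurable_fun [set: R] f' by exact: continuous_measurable_fun.
have i1 := integrable_gauss_weight A0 mf' f'C.
have i2 : mu.-integrable [set: R] (fun x => (x * f x * gauss_weight A x)%:E).
  apply: (@integrable_gauss_weight A (c + 1) C) => //; first exact: measurable_funM.
  move=> x; rewrite normrM mulrDl mul1r expRD mulrCA [leRHS]mulrA mulrC.
  rewrite -[leRHS]mulrA mulrC mulrA [leRHS]mulrC.
  apply: ler_pM => //; first by rewrite (le_trans _ (expR_ge1Dx _))// lerDr.
  by rewrite mulrC.
have bd (y : nat -> R) : (forall n, `|y n| = n%:R) ->
    f (y n) * gauss_weight A (y n) @[n --> \oo] --> (0 : R).
  move=> yn; apply: norm_cvg0.
  apply: (@squeeze_cvgr _ _ _ _ (cst 0) (fun n => C * expR (- n%:R))).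
  - near=> n; rewrite normr_ge0/= normrM (ger0_norm (ltW (gauss_weight_gt0 A _))).
    apply: (le_trans (ler_wpM2r (ltW (gauss_weight_gt0 A _)) (fC _))).
    rewrite -mulrA ler_wpM2l// /gauss_weight -expRD ler_expR -[y n ^+ 2]real_normK ?num_real// yn.
    have n0 : 0 <= n%:R :> R by [].
    have nc : 2 * (c + 1) / A <= n%:R by near: n; exact: nbhs_infty_ger.
    have {}nc : 2 * (c + 1) <= n%:R * A by rewrite -ler_pdivrMr.
    by nra.
  - exact: cvg_cst.
  - by rewrite -[X in _ --> X](mulr0 C); apply: cvgMr; exact: cvgn_expR.
pose h x := f' x * gauss_weight A x - A * (x * f x * gauss_weight A x).
have : \int[mu]_x h x = 0.
  apply: (@Rintegral_derivative0 (fun x => f x * gauss_weight A x)).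
  - move=> x; have := df x => ?; have := is_derive_gauss_weight A x => ?.
    apply: is_derive_eq; rewrite /h /GRing.scale/=; ring.
  - move=> x; apply: cvgB.
      by apply: cvgM; [exact: cf'|exact: continuous_gauss_weight].
    apply: cvgMr; apply: cvgM; last exact: continuous_gauss_weight.
    by apply: cvgM; [exact: cvg_id|exact: cf].
  - rewrite (_ : _ \o _ = (fun x => (f' x * gauss_weight A x)%:E - A%:E * (x * f x * gauss_weight A x)%:E)%E).
      by apply: integrableB => //; exact: integrableZl.
    by apply/funext => x; rewrite /h /= EFinB EFinM.
  - by apply: bd => n; rewrite ger0_norm.
  - by apply: bd => n; rewrite normrN ger0_norm.
rewrite /h RintegralB//.
  rewrite RintegralZl// => /eqP; rewrite subr_eq0 => /eqP ->.
  by rewrite mulKf// gt_eqF.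
rewrite (_ : _ \o _ = (fun x => A%:E * (x * f x * gauss_weight A x)%:E)%E).
  exact: integrableZl.
by apply/funext => x; rewrite /= EFinM.
Unshelve. all: by end_near. Qed.

Lemma norm_sin_le1 x : `|sin x| <= 1.
Proof. by rewrite ler_norml sin_geN1 sin_le1. Qed.

Lemma norm_cos_le1 x : `|cos x| <= 1.
Proof. by rewrite ler_norml cos_geN1 cos_le1. Qed.

Lemma Rintegral_gw A : 0 < A -> \int[mu]_x gauss_weight A x = Num.sqrt (2 * pi / A).
Proof.
move=> A0; have := integral_gw_center 0 A0.
by under eq_integral do rewrite subr0; rewrite /Rintegral => ->.
Qed.

Lemma gauss_sin A a : 0 < A ->
  \int[mu]_x (x * sin (a * x) * gauss_weight A x) = a / A * \int[mu]_x (cos (a * x) * gauss_weight A x).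
Proof.
move=> A0.
have df x : is_derive x (1 : R) (fun x => sin (a * x)) (a * cos (a * x)).
  by apply: is_derive_eq; rewrite /GRing.scale/=; ring.
rewrite (@gauss_ibp A 0 (1 + `|a|) _ (fun x => a * cos (a * x)) A0 df).
- under eq_Rintegral do rewrite -mulrA.
  rewrite RintegralZl//; first by rewrite mulrA (mulrC a).
  apply: (@integrable_gauss_weight A 0 1) => //.
    apply: measurableT_comp; last exact: measurable_funM.
    by apply: continuous_measurable_fun; exact: continuous_cos.
  by move=> x; rewrite mul0r expR0 mulr1 norm_cos_le1.
- move=> x; apply: cvgMr; apply: continuous_comp; last exact: continuous_cos.
  by apply: cvgMr; exact: cvg_id.
- move=> x; rewrite mul0r expR0 mulr1 (le_trans (norm_sin_le1 _))//.
  by rewrite lerDl normr_ge0.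
- move=> x; rewrite mul0r expR0 mulr1 normrM.
  rewrite (@le_trans _ _ `|a|)//; last by rewrite lerDr.
  by rewrite ler_piMr// norm_cos_le1.
Qed.

Lemma gauss_exp A s : 0 < A ->
  \int[mu]_x (x * expR (s * x) * gauss_weight A x) =
  s / A * (expR (s ^+ 2 / (2 * A)) * Num.sqrt (2 * pi / A)).
Proof.
move=> A0.
have bd x : expR (s * x) <= expR (`|s| * `|x|).
  by rewrite ler_expR (le_trans (ler_norm _))// normrM.
have df x : is_derive x (1 : R) (fun x => expR (s * x)) (s * expR (s * x)).
  by apply: is_derive_eq; rewrite /GRing.scale/=; ring.
rewrite (@gauss_ibp A `|s| (1 + `|s|) _ (fun x => s * expR (s * x)) A0 df).
- under eq_Rintegral do rewrite -mulrA.
  rewrite RintegralZl//; last exact: integrable_expR_gw.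
  by rewrite Rintegral_expR_gw// [LHS]mulrA [A^-1 * s]mulrC.
- move=> x; apply: cvgMr; apply: continuous_comp; last exact: continuous_expR.
  by apply: cvgMr; exact: cvg_id.
- move=> x; rewrite ger0_norm ?expR_ge0// (le_trans (bd x))//.
  by rewrite ler_peMl ?expR_ge0// lerDl.
- move=> x; rewrite normrM (ger0_norm (expR_ge0 _)) ler_pM// ?expR_ge0//.
  by rewrite lerDr.
Qed.

Lemma gauss_sqr A : 0 < A ->
  \int[mu]_x (x ^+ 2 * gauss_weight A x) = A^-1 * Num.sqrt (2 * pi / A).
Proof.
move=> A0; under eq_Rintegral do rewrite expr2.
rewrite (@gauss_ibp A 1 1 id (fun=> 1))//.
- by under eq_Rintegral do rewrite mul1r; rewrite Rintegral_gw.
- by move=> x; exact: cvg_cst.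
- by move=> x; rewrite !mul1r (le_trans _ (expR_ge1Dx _))// lerDr.
- by move=> x; rewrite !mul1r normr1 -expR0 ler_expR.
Qed.

(** As a function of a, the integral solves y' = - a y / A: differentiate under
    the integral and use [gauss_sin]. *)
Lemma gauss_cos A a : 0 < A ->
  \int[mu]_x (cos (a * x) * gauss_weight A x) =
  expR (- (a ^+ 2 / (2 * A))) * Num.sqrt (2 * pi / A).
Proof.
move=> A0; pose phi b := \int[mu]_x (cos (b * x) * gauss_weight A x).
have icos b : mu.-integrable [set: R] (EFin \o (fun x => cos (b * x) * gauss_weight A x)).
  apply: (@integrable_gauss_weight A 0 1) => //.
    apply: measurableT_comp; last exact: measurable_funM.
    by apply: continuous_measurable_fun; exact: continuous_cos.
  by move=> x; rewrite mul0r expR0 mulr1 norm_cos_le1.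
have dcos b x : is_derive b (1 : R) (fun y => cos (y * x) * gauss_weight A x) (- (x * sin (b * x) * gauss_weight A x)).
  apply: is_derive_eq; rewrite /GRing.scale/=; ring.
have dphi b : is_derive b (1 : R) phi (- (b / A) * phi b).
  have ib : `]b - 1, b + 1[%classic b by rewrite /= in_itv/=; apply/andP; split; lra.
  have iG : mu.-integrable [set: R] (EFin \o (fun x => `|x| * gauss_weight A x)).
    apply: (@integrable_gauss_weight A 1 1) => //.
    by move=> x; rewrite !mul1r normr_id (le_trans _ (expR_ge1Dx _))// lerDr.
  have P1 c x : partial1of2 (fun b x => cos (b * x) * gauss_weight A x) c x = - (x * sin (c * x) * gauss_weight A x).
    by have := dcos c x => ?; rewrite partial1of2E derive_val.
  pose f (b : R) (x : R) := cos (b * x) * gauss_weight A x.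
  pose G x := `|x| * gauss_weight A x.
  have fi c : `]b - 1, b + 1[%classic c -> mu.-integrable [set: R] (EFin \o f c).
    by move=> _; exact: icos.
  have fd c x : `]b - 1, b + 1[%classic c -> [set: R] x -> derivable (f ^~ x) c 1.
    by move=> _ _; have := dcos c x => ?; exact: ex_derive.
  have G0 x : 0 <= G x by rewrite mulr_ge0// ltW// gauss_weight_gt0.
  have fG c x : `]b - 1, b + 1[%classic c -> [set: R] x -> `|partial1of2 f c x| <= G x.
    move=> _ _; rewrite P1 normrN !normrM (ger0_norm (ltW (gauss_weight_gt0 A x))).
    by rewrite ler_wpM2r ?(ltW (gauss_weight_gt0 A x))// ler_piMr// norm_sin_le1.
  apply: DeriveDef.
    exact: (@derivable_under_integral _ _ _ mu f _ measurableT b _ _ ib fi fd G G0 iG fG).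
  rewrite -derive1E.
  have := (@differentiation_under_integral _ _ _ mu f _ measurableT b _ _ ib fi fd G G0 iG fG).
  rewrite -/phi => ->.
  have -> : \int[mu]_y partial1of2 f b y = \int[mu]_x ((-1) * (x * sin (b * x) * gauss_weight A x)).
    by apply: eq_Rintegral => x _; rewrite [LHS]P1 mulN1r.
  rewrite RintegralZl//; first by rewrite gauss_sin// mulN1r mulNr.
  apply: (@integrable_gauss_weight A 1 1) => //.
    apply: measurable_funM => //.
    apply: measurableT_comp; last exact: measurable_funM.
    by apply: continuous_measurable_fun; exact: continuous_sin.
  move=> x; rewrite !mul1r normrM.
  apply: (@le_trans _ _ `|x|); first by rewrite ler_piMr// norm_sin_le1.
  by rewrite (le_trans _ (expR_ge1Dx _))// lerDr.
have : (fun b => phi b * expR (b ^+ 2 / (2 * A))) a = (fun b => phi b * expR (b ^+ 2 / (2 * A))) 0.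
  apply: (@is_derive_0_is_cst _ (fun b => phi b * expR (b ^+ 2 / (2 * A)))) => b; have := dphi b => ?.
  by apply: is_derive_eq; rewrite /GRing.scale/=; field; rewrite gt_eqF.
have -> : phi 0 = Num.sqrt (2 * pi / A).
  rewrite -Rintegral_gw// /phi; apply: eq_Rintegral => x _.
  by rewrite mul0r cos0 mul1r.
rewrite expr0n/= mul0r expR0 mulr1 => H.
by rewrite -[LHS]/(phi a) -H mulrCA -expRD addNr expR0 mulr1.
Qed.
End gauss.

(** * Gaussian laws *)

Section density.
Context d (T : measurableType d) (R : realType).
Variables (mu nu : {measure set T -> \bar R}) (p : T -> R).
Hypotheses (mp : measurable_fun [set: T] p) (p0 : forall x, 0 <= p x).
Hypothesis nuE : forall A, measurable A -> nu A = (\int[mu]_(x in A) (p x)%:E)%E.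

Import HBNNSimple.
Local Open Scope ereal_scope.

Let mpE : measurable_fun [set: T] (EFin \o p).
Proof. exact/measurable_EFinP. Qed.

Let nnsfun_density (g : {nnsfun T >-> R}) :
  \int[nu]_x (g x)%:E = \int[mu]_x ((g x)%:E * (p x)%:E).
Proof.
under eq_integral do rewrite fimfunE -fsumEFin//.
rewrite ge0_integral_fsum//; last 2 first.
- by move=> r; exact/measurable_EFinP/measurableT_comp.
- by move=> r x _; rewrite EFinM nnfun_muleindic_ge0.
under [RHS]eq_integral => x _.
  rewrite fimfunE -fsumEFin// ge0_mule_fsuml; last first.
    by move=> r; rewrite EFinM nnfun_muleindic_ge0.
  over.
rewrite [RHS]ge0_integral_fsum//; last 2 first.
- move=> r; apply: emeasurable_funM => //.
  exact/measurable_EFinP/measurableT_comp.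
- by move=> r x _; rewrite mule_ge0 ?lee_fin//; exact: nnfun_muleindic_ge0.
apply: eq_fsbigr => r; rewrite inE => -[z _ rz].
have r0 : (0 <= r)%R by rewrite -rz.
under eq_integral do rewrite EFinM.
under [RHS]eq_integral do rewrite EFinM -muleA.
rewrite integralZl_indic_nnsfun// ge0_integralZl//; last 2 first.
- apply: emeasurable_funM => //; exact/measurable_EFinP.
- by move=> x _; rewrite mule_ge0 ?lee_fin.
rewrite integral_indic// setIT nuE//; congr (_ * _).
rewrite integral_mkcond; apply: eq_integral => x _.
by rewrite patchE indicE; case: ifPn; rewrite ?mul1e ?mul0e.
Qed.

Lemma ge0_integral_density (f : T -> \bar R) : measurable_fun [set: T] f ->
  (forall x, 0 <= f x) -> \int[nu]_x f x = \int[mu]_x (f x * (p x)%:E).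
Proof.
move=> mf f0; pose h := nnsfun_approx measurableT mf.
have fE x : f x = limn (fun n => (h n x)%:E).
  by apply/esym/cvg_lim => //; apply: cvg_nnsfun_approx.
transitivity (limn (fun n => \int[nu]_x (h n x)%:E)).
  rewrite -monotone_convergence//.
  - by apply: eq_integral => x _; exact: fE.
  - by move=> n; exact/measurable_EFinP.
  - by move=> n x _; rewrite lee_fin.
  - by move=> x _ m n mn; rewrite lee_fin; exact/lefP/nd_nnsfun_approx.
transitivity (limn (fun n => \int[mu]_x ((h n x)%:E * (p x)%:E))).
  by congr (limn _); apply/funext => n; exact: nnsfun_density.
rewrite -monotone_convergence//.
- apply: eq_integral => x _; apply/cvg_lim => //.
  apply: cvgeZr => //; exact: cvg_nnsfun_approx.
- by move=> n; apply: emeasurable_funM => //; exact/measurable_EFinP.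
- by move=> n x _; rewrite mule_ge0// lee_fin.
- move=> x _ m n mn; rewrite lee_wpmul2r ?lee_fin//.
  exact/lefP/nd_nnsfun_approx.
Qed.

Lemma integral_density (f : T -> R) : measurable_fun [set: T] f ->
  \int[nu]_x (f x)%:E = \int[mu]_x (f x * p x)%:E.
Proof.
move=> mf; have mfE : measurable_fun [set: T] (EFin \o f) by exact/measurable_EFinP.
rewrite integralE [RHS]integralE !ge0_integral_density//; last 2 first.
- exact: measurable_funeneg.
- exact: measurable_funepos.
congr (_ - _); apply: eq_integral => x _.
- rewrite !funeposE/= -!EFin_max -EFinM -[in RHS](mul0r (p x)).
  by rewrite maxr_pMl.
- rewrite !funenegE/= -!EFin_max -EFinM -mulNr -[in RHS](mul0r (p x)).
  by rewrite maxr_pMl.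
Qed.
End density.

Lemma integral_EFin_Rintegral d (T : measurableType d) (R : realType)
    (mu : {measure set T -> \bar R}) (D : set T) (f : T -> R) : measurable D ->
  mu.-integrable D (EFin \o f) ->
  (\int[mu]_(x in D) (f x)%:E = (\int[mu]_(x in D) f x)%:E)%E.
Proof. by move=> mD fi; rewrite fineK//; exact: integrable_fin_num. Qed.

Section gaussian_law.
Context {R : realType}.
Notation leb := (@lebesgue_measure R).

Let K (v : R) := Num.sqrt (2 * pi / v^-1).

(** Expanding the square in the density turns every nondegenerate Gaussian law
    into the centered weight, for which the integrals are known. *)
Lemma integral_gaussian_law (m v : R) (f : R -> R) : 0 < v ->
  measurable_fun [set: R] f ->
  (\int[gaussian_law m v]_x (f x)%:E =
   \int[leb]_x ((K v)^-1 * expR (- (m ^+ 2 / (2 * v))) *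
                (f x * expR (m / v * x) * gauss_weight v^-1 x))%:E)%E.
Proof.
move=> v0 mf; rewrite /gaussian_law gt_eqF//.
have s0 : Num.sqrt v != 0 by rewrite gt_eqF// sqrtr_gt0.
rewrite (@integral_density _ _ _ leb _ (normal_pdf m (Num.sqrt v)))//.
- apply: eq_integral => x _; congr EFin.
  rewrite normal_pdfE// /normal_peak /normal_fun sqr_sqrtr; last exact: ltW.
  have -> : (Num.sqrt (v * pi *+ 2))^-1 = (K v)^-1.
    by rewrite /K invrK; congr (Num.sqrt _)^-1; rewrite -mulr_natr; ring.
  rewrite mulrCA -!mulrA; congr (_ * _); rewrite [RHS]mulrCA; congr (_ * _).
  rewrite /gauss_weight -!expRD; congr expR; rewrite -mulr_natr; field.
  by rewrite gt_eqF.
- exact: measurable_normal_pdf.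
- by move=> x; exact: normal_pdf_ge0.
Qed.

Context d (T : measurableType d) (P : probability T R).

Lemma integral_law (Y : T -> R) (nu : probability (measurableTypeR R) R) (f : R -> R) :
  measurable_fun [set: T] Y -> (forall A : set R, measurable A -> P (Y @^-1` A) = nu A) ->
  measurable_fun [set: R] f ->
  (forall x, 0 <= f x) \/ P.-integrable [set: T] (fun w => (f (Y w))%:E) ->
  (\int[P]_w (f (Y w))%:E = \int[nu]_x (f x)%:E)%E.
Proof.
move=> mY law mf H.
transitivity (\int[pushforward P (Y : _ -> measurableTypeR R)]_x (f x)%:E)%E.
  case: H => [f0|fi].
    rewrite ge0_integral_pushforward//; first exact/measurable_EFinP.
    by move=> x _; rewrite lee_fin.
  by rewrite integral_pushforward//; exact/measurable_EFinP.
apply: eq_measure_integral => //= A mA _.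
by rewrite -law.
Qed.

Let lawE (m v c C : R) (f : R -> R) : 0 < v -> measurable_fun [set: R] f ->
  (forall x, `|f x| <= C * expR (c * `|x|)) ->
  (\int[gaussian_law m v]_x (f x)%:E = ((K v)^-1 * expR (- (m ^+ 2 / (2 * v))) *
    \int[leb]_x (f x * expR (m / v * x) * gauss_weight v^-1 x))%:E)%E.
Proof.
move=> v0 mf fC; have A0 : 0 < v^-1 by rewrite invr_gt0.
have i : leb.-integrable [set: R]
    (EFin \o (fun x => f x * expR (m / v * x) * gauss_weight v^-1 x)).
  apply: (@integrable_gauss_weight _ _ (c + `|m / v|) C) => //.
    by apply: measurable_funM => //; apply: measurableT_comp.
  move=> x; rewrite normrM (ger0_norm (expR_ge0 _)) mulrDl expRD mulrA.
  apply: ler_pM => //.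
  by rewrite ler_expR (le_trans (ler_norm _))// normrM.
rewrite integral_gaussian_law//.
under eq_integral do rewrite EFinM.
by rewrite integralZl// integral_EFin_Rintegral.
Qed.

Let dirac_lawE (m : R) (f : R -> R) : measurable_fun [set: R] f ->
  (\int[gaussian_law m 0]_x (f x)%:E = (f m)%:E)%E.
Proof.
move=> mf; rewrite /gaussian_law eqxx integral_dirac//.
  by rewrite diracT mul1e.
exact/measurable_EFinP.
Qed.

Let K_neq0 (v : R) : 0 < v -> K v != 0.
Proof.
by move=> v0; rewrite gt_eqF// sqrtr_gt0 divr_gt0 ?invr_gt0// mulr_gt0// pi_gt0.
Qed.

Let sqC (x : R) : `|x ^+ 2| <= 1 * expR (2 * `|x|).
Proof.
rewrite normrX mul1r expRM_natl ler_pXn2r ?nnegrE ?expR_ge0//.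
by rewrite (le_trans _ (expR_ge1Dx _))// lerDr.
Qed.

(** The parameters of the law are determined by its first two moments, for a
    Dirac mass as well. *)
Lemma gaussian_centered (Y : T -> R) (q : R) :
  measurable_fun [set: T] Y -> gaussian P Y ->
  (\int[P]_w (Y w)%:E = 0)%E -> (\int[P]_w (Y w ^+ 2)%:E = q%:E)%E ->
  0 <= q /\ forall A : set R, measurable A -> P (Y @^-1` A) = gaussian_law 0 q A.
Proof.
move=> mY [m [v [v0 law]]] EY EY2.
have msq : measurable_fun [set: R] (fun x : R => x ^+ 2).
  exact: measurable_funX.
have Y2i : P.-integrable [set: T] (fun w => (Y w ^+ 2)%:E).
  apply/integrableP; split; first exact/measurable_EFinP/measurable_funX.
  by under eq_integral do rewrite gee0_abs ?lee_fin ?sqr_ge0//; rewrite EY2 ltry.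
have Yi : P.-integrable [set: T] (fun w => (Y w)%:E).
  apply: (@le_integrable _ _ _ P _ _ _ (fun w => 1%:E + (Y w ^+ 2)%:E)%E) => //.
  - exact/measurable_EFinP.
  - move=> w _; rewrite -EFinD !abse_EFin lee_fin [leRHS]ger0_norm ?addr_ge0 ?sqr_ge0//.
    by rewrite -[Y w ^+ 2]real_normK ?num_real//; have := normr_ge0 (Y w); nra.
  - by apply: integrableD => //; exact: finite_measure_integrable_cst.
have := integral_law mY law msq (or_intror Y2i).
have := integral_law mY law (@measurable_id _ _ _) (or_intror Yi).
rewrite EY EY2.
have [v00|v1] := eqVneq v 0.
  subst v; rewrite (dirac_lawE m (@measurable_id _ _ _)) (dirac_lawE m msq) => -[m0] [q0].
  by subst m; split => [|A mA]; rewrite q0 expr0n//= law.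
have {}v0 : 0 < v by rewrite lt_neqAle eq_sym v1.
have A0 : 0 < v^-1 by rewrite invr_gt0.
have K0 := K_neq0 v0.
have idC (x : R) : `|x| <= 1 * expR (1 * `|x|).
  by rewrite !mul1r (le_trans _ (expR_ge1Dx _))// lerDr.
rewrite (lawE m v0 (@measurable_id _ _ _) idC).
rewrite (gauss_exp _ A0) => -[mean].
have {mean} m0 : m = 0.
  move: mean; rewrite -/(K v) invrK.
  have -> : m / v * v = m by rewrite divfK.
  have -> : (m / v) ^+ 2 / (2 * v^-1) = m ^+ 2 / (2 * v) by field.
  rewrite expRN [X in _ = X](_ : _ = m) => [->//|].
  by field; rewrite K0 gt_eqF ?expR_gt0.
rewrite m0 in law *; rewrite (lawE 0 v0 msq sqC).
rewrite !mul0r expr0n/= mul0r oppr0 expR0 mulr1.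
have -> : \int[leb]_x (x ^+ 2 * expR (0 * x) * gauss_weight v^-1 x) = v * K v.
  have := gauss_sqr A0; rewrite -/(K v) invrK => <-; apply: eq_Rintegral => x _.
  by rewrite mul0r expR0 mulr1.
rewrite mulrC (mulfK K0) => -[->]; split; [exact: ltW|exact: law].
Qed.

Lemma gaussian_expectation_cos (Y : T -> R) (q : R) :
  measurable_fun [set: T] Y -> gaussian P Y ->
  (\int[P]_w (Y w)%:E = 0)%E -> (\int[P]_w (Y w ^+ 2)%:E = q%:E)%E ->
  (\int[P]_w (cos (Y w))%:E = (expR (- (q / 2)))%:E)%E.
Proof.
move=> mY gY EY EY2; have [q0 law] := gaussian_centered mY gY EY EY2.
have mcos : measurable_fun [set: R] (@cos R).
  by apply: continuous_measurable_fun; exact: continuous_cos.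
have cosi : P.-integrable [set: T] (fun w => (cos (Y w))%:E).
  apply: measurable_bounded_integrable => //.
  - by rewrite ltey_eq fin_num_measure.
  - exact: measurableT_comp.
  - exists 1; split => // M M1 w _ /=; exact: le_trans (norm_cos_le1 _) (ltW M1).
rewrite (integral_law mY law mcos (or_intror cosi)).
have [->|q1] := eqVneq q 0.
  by rewrite dirac_lawE// cos0 mul0r oppr0 expR0.
have {}q0 : 0 < q by rewrite lt_neqAle eq_sym q1.
have A0 : 0 < q^-1 by rewrite invr_gt0.
have cosC (x : R) : `|cos x| <= 1 * expR (0 * `|x|).
  by rewrite mul0r expR0 mulr1 norm_cos_le1.
rewrite (lawE 0 q0 mcos cosC).
rewrite !mul0r expr0n/= mul0r oppr0 expR0 mulr1.
have -> : \int[leb]_x (cos x * expR (0 * x) * gauss_weight q^-1 x) = expR (- (q / 2)) * K q.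
  have := gauss_cos 1 A0; rewrite -/(K q) expr1n invfM invrK.
  rewrite [2^-1 * q]mulrC mul1r => <-; apply: eq_Rintegral => x _.
  by rewrite mul0r expR0 mulr1 mul1r.
by rewrite mulrC mulfK// K_neq0.
Qed.
End gaussian_law.

(** * The heat kernel at a Gaussian pair *)

Section fubini_dominated.
Context d1 d2 (T1 : measurableType d1) (T2 : measurableType d2) (R : realType).
Variables (m1 : {sigma_finite_measure set T1 -> \bar R})
          (m2 : {sigma_finite_measure set T2 -> \bar R}).

(** The form of Fubini's theorem used throughout: a dominating product also gives
    the integrability of both partial integrals. *)
Lemma Rintegral_swap (F : T1 * T2 -> R) (k : T1 -> R) (h : T2 -> R) :
  measurable_fun [set: T1 * T2] F ->
  m1.-integrable [set: T1] (EFin \o k) -> m2.-integrable [set: T2] (EFin \o h) ->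
  (forall x y, `|F (x, y)| <= k x * h y) ->
  [/\ \int[m1]_x \int[m2]_y F (x, y) = \int[m2]_y \int[m1]_x F (x, y),
      m1.-integrable [set: T1] (fun x => (\int[m2]_y F (x, y))%:E) &
      m2.-integrable [set: T2] (fun y => (\int[m1]_x F (x, y))%:E)].
Proof.
move=> mF ik ih Fkh.
have mFE : measurable_fun [set: T1 * T2] (EFin \o F) by exact/measurable_EFinP.
have mk : measurable_fun [set: T1] k by exact/measurable_EFinP/(measurable_int m1).
have mh : measurable_fun [set: T2] h by exact/measurable_EFinP/(measurable_int m2).
have iF : (m1 \x m2)%E.-integrable [set: T1 * T2] (EFin \o F).
  apply/integrable12ltyP => //.
  pose H := (\int[m2]_y `|h y|%:E)%E.
  have Hfin : H \is a fin_num.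
    rewrite ge0_fin_numE; last by apply: integral_ge0 => y _; rewrite lee_fin.
    by have /integrableP[] := ih.
  apply: (@le_lt_trans _ _ (\int[m1]_x (`|k x|%:E * H))%E).
    apply: ge0_le_integral => //.
    - by move=> x _; exact: integral_ge0.
    - apply: (@measurable_fun_fubini_tonelli_F _ _ _ _ _ m2 (abse \o (EFin \o F))).
        exact: measurableT_comp.
      by move=> z; rewrite lee_fin.
    - apply: emeasurable_funM => //; apply/measurable_EFinP.
      exact: measurableT_comp.
    - move=> x _; rewrite -ge0_integralZl//=.
      + apply: ge0_le_integral => //.
        * apply/measurable_EFinP; apply: measurableT_comp => //.
          exact: measurable_fun_pair2.
        * apply/measurable_EFinP; apply: measurable_funM => //.
          exact: measurableT_comp.
        * move=> y _; rewrite lee_fin -normrM.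
          by rewrite (le_trans (Fkh x y))// ler_norm.
      + apply/measurable_EFinP; exact: measurableT_comp.
  rewrite ge0_integralZr//.
  - rewrite lte_mul_pinfty//.
    + by apply: integral_ge0 => x _; rewrite lee_fin.
    + rewrite ge0_fin_numE; last by apply: integral_ge0 => y _; rewrite lee_fin.
      by have /integrableP[] := ik.
    + by rewrite -ge0_fin_numE//; apply: integral_ge0 => y _; rewrite lee_fin.
  - by apply/measurable_EFinP; exact: measurableT_comp.
  - by apply: integral_ge0 => x _; rewrite lee_fin.
have i1 x : m2.-integrable [set: T2] (fun y => (F (x, y))%:E).
  apply: (@le_integrable _ _ _ m2 _ _ _ (fun y => (k x)%:E * (h y)%:E)%E) => //.
  - by apply/measurable_EFinP; exact: measurable_fun_pair2.
  - by move=> y _; rewrite -EFinM !abse_EFin lee_fin (le_trans (Fkh x y))// ler_norm.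
  - exact: integrableZl.
have i2 y : m1.-integrable [set: T1] (fun x => (F (x, y))%:E).
  apply: (@le_integrable _ _ _ m1 _ _ _ (fun x => (h y)%:E * (k x)%:E)%E) => //.
  - by apply/measurable_EFinP; exact: measurable_fun_pair1.
  - move=> x _; rewrite -EFinM !abse_EFin lee_fin (le_trans (Fkh x y))//.
    by rewrite mulrC ler_norm.
  - exact: integrableZl.
have e1 x : (\int[m2]_y F (x, y))%:E = (\int[m2]_y (F (x, y))%:E)%E.
  by rewrite integral_EFin_Rintegral//; exact: i1.
have e2 y : (\int[m1]_x F (x, y))%:E = (\int[m1]_x (F (x, y))%:E)%E.
  by rewrite integral_EFin_Rintegral//; exact: i2.
split.
- rewrite /Rintegral; congr fine.
  under eq_integral do rewrite e1.
  under [RHS]eq_integral do rewrite e2.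
  exact: (Fubini iF).
- under eq_fun do rewrite e1. exact: (integrable_fubini_F iF).
- apply: (@le_integrable _ _ _ m2 _ _ _ (fun y => (\int[m1]_x k x)%:E * (h y)%:E)%E) => //.
  + under eq_fun do rewrite e2.
    exact: (measurable_fubini_G iF).
  + move=> y _; rewrite -EFinM !abse_EFin lee_fin.
    apply: (le_trans (le_normr_Rintegral _ (i2 y))) => //.
    rewrite (le_trans _ (ler_norm _))// -RintegralZr//.
    apply: le_Rintegral => //; first exact: (integrable_norm (i2 y)).
    rewrite (_ : _ \o _ = (fun x => (h y)%:E * (k x)%:E)%E).
      exact: integrableZl.
    by apply/funext => x; rewrite /= mulrC EFinM.
  + exact: integrableZl.
Qed.
End fubini_dominated.

Section heat_kernel.
Context {R : realType}.
Notation leb := (@lebesgue_measure R).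
Implicit Types eps del x y : R.

Lemma heat_kernelE eps x : 0 < eps ->
  heat_kernel eps x = (Num.sqrt (2 * pi * eps))^-1 * gauss_weight eps^-1 x.
Proof.
move=> e0; have pe : 0 <= 2 * pi * eps by rewrite !mulr_ge0 ?pi_ge0// ltW.
rewrite /heat_kernel powRN powR12_sqrt//; congr (_ * _); rewrite /gauss_weight; congr expR.
by field; rewrite gt_eqF.
Qed.

Lemma derive1_heat_kernel eps x : 0 < eps ->
  derive1 (heat_kernel eps) x = - (x / eps * heat_kernel eps x).
Proof.
move=> e0; rewrite (_ : heat_kernel eps = fun x => (Num.sqrt (2 * pi * eps))^-1 * gauss_weight eps^-1 x); last first.
  by apply/funext => y; exact: heat_kernelE.
have := is_derive_gauss_weight eps^-1 x => dg.
rewrite derive1E derive_val /GRing.scale/=; ring.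
Qed.

(** Fourier inversion for the derivative of a Gaussian density. The variable x
    only enters through a sine, whose expectation is explicit when x is replaced
    by a Gaussian variable. *)
Lemma heat_kernel_fourier eps x : 0 < eps ->
  - derive1 (heat_kernel eps) x =
  (2 * pi)^-1 * \int[leb]_xi (xi * sin (x * xi) * gauss_weight eps xi).
Proof.
move=> e0; have p0 : 0 < pi :> R := pi_gt0 R.
rewrite derive1_heat_kernel// opprK heat_kernelE// gauss_sin// gauss_cos//.
have -> : gauss_weight eps^-1 x = expR (- (x ^+ 2 / (2 * eps))).
  by rewrite /gauss_weight; congr expR; field; rewrite gt_eqF.
have -> : (Num.sqrt (2 * pi * eps))^-1 = (2 * pi)^-1 * Num.sqrt (2 * pi / eps).
  have -> : 2 * pi / eps = (2 * pi) ^+ 2 * (2 * pi * eps)^-1.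
    have pn := lt0r_neq0 p0; have en := lt0r_neq0 e0.
    by move: (pi) pn => q qn; field; rewrite en qn.
  rewrite [in RHS]sqrtrM ?sqr_ge0// sqrtr_sqr ger0_norm; last first.
    by rewrite mulr_ge0// ltW.
  rewrite sqrtrV; last by rewrite !mulr_ge0// ltW.
  by rewrite mulKf// mulf_neq0// gt_eqF.
ring.
Qed.

Lemma heat_kernel_derive1_bounded eps : 0 < eps ->
  exists M : R, 0 <= M /\ forall x, `|derive1 (heat_kernel eps) x| <= M.
Proof.
move=> e0; have p0 : 0 < pi :> R := pi_gt0 R.
have i : leb.-integrable [set: R] (EFin \o (fun xi => `|xi| * gauss_weight eps xi)).
  apply: (@integrable_gauss_weight _ _ 1 1) => //.
  by move=> x; rewrite !mul1r normr_id (le_trans _ (expR_ge1Dx _))// lerDr.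
exists ((2 * pi)^-1 * \int[leb]_xi (`|xi| * gauss_weight eps xi)); split.
  apply: mulr_ge0; first by rewrite invr_ge0 mulr_ge0// ltW.
  apply: Rintegral_ge0 => x _.
  by rewrite mulr_ge0// ltW// gauss_weight_gt0.
move=> x; rewrite -normrN heat_kernel_fourier// normrM ger0_norm; last first.
  by rewrite invr_ge0 mulr_ge0// ltW.
rewrite ler_pM2l ?invr_gt0 ?mulr_gt0//.
have bd y : `|y * sin (x * y) * gauss_weight eps y| <= `|y| * gauss_weight eps y.
  rewrite !normrM (ger0_norm (ltW (gauss_weight_gt0 eps y))) ler_pM2r ?gauss_weight_gt0//.
  by rewrite ler_piMr// norm_sin_le1.
have j : leb.-integrable [set: R] (EFin \o (fun y => y * sin (x * y) * gauss_weight eps y)).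
  apply: (le_integrable _ _ _ i) => //.
    apply/measurable_EFinP; apply: measurable_funM; last exact: measurable_gauss_weight.
    apply: measurable_funM => //; apply: measurableT_comp => //.
    by apply: continuous_measurable_fun; exact: continuous_sin.
  move=> y _; rewrite /= lee_fin (le_trans (bd y))//.
  by rewrite ler_norm.
apply: (le_trans (le_normr_Rintegral _ j)) => //.
apply: le_Rintegral => //; exact: (integrable_norm j).
Qed.

Lemma measurable_derive1_heat_kernel eps : 0 < eps ->
  measurable_fun [set: R] (derive1 (heat_kernel eps)).
Proof.
move=> e0; rewrite (_ : derive1 _ = fun x => - (x / eps * heat_kernel eps x)); last first.
  by apply/funext => x; exact: derive1_heat_kernel.
apply: measurable_funN; apply: measurable_funM; first exact: measurable_funM.
rewrite (_ : heat_kernel eps = fun x => (Num.sqrt (2 * pi * eps))^-1 * gauss_weight eps^-1 x); last first.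
  by apply/funext => y; exact: heat_kernelE.
by apply: measurable_funM => //; exact: measurable_gauss_weight.
Qed.

Context d (T : measurableType d) (P : probability T R).

(** The bounded factor G leaves room for a second kernel, to which the same
    representation is applied in turn. *)
Lemma expectation_heat_kernel_fourier eps (X G : T -> R) (M : R) : 0 < eps ->
  measurable_fun [set: T] X -> measurable_fun [set: T] G -> (forall w, `|G w| <= M) ->
  \int[P]_w (- derive1 (heat_kernel eps) (X w) * G w) =
  (2 * pi)^-1 * \int[leb]_xi (xi * gauss_weight eps xi * \int[P]_w (sin (X w * xi) * G w)).
Proof.
move=> e0 mX mG GM.
pose F (p : T * R) := p.2 * sin (X p.1 * p.2) * gauss_weight eps p.2 * G p.1.
have mF : measurable_fun [set: T * measurableTypeR R] F.
  apply: measurable_funM; last exact: measurableT_comp.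
  apply: measurable_funM; last by apply: measurableT_comp => //; exact: measurable_gauss_weight.
  apply: measurable_funM => //; apply: measurableT_comp.
    by apply: continuous_measurable_fun; exact: continuous_sin.
  by apply: measurable_funM => //; exact: measurableT_comp.
have iM : P.-integrable [set: T] (EFin \o (fun=> M)).
  exact: finite_measure_integrable_cst.
have ih : leb.-integrable [set: R] (EFin \o (fun xi => `|xi| * gauss_weight eps xi)).
  apply: (@integrable_gauss_weight _ _ 1 1) => //.
  by move=> x; rewrite !mul1r normr_id (le_trans _ (expR_ge1Dx _))// lerDr.
have bd w xi : `|F (w, xi)| <= M * (`|xi| * gauss_weight eps xi).
  rewrite /F/= !normrM (ger0_norm (ltW (gauss_weight_gt0 eps xi))) mulrC ler_pM//.
    by rewrite !mulr_ge0// ltW// gauss_weight_gt0.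
  by rewrite ler_pM2r ?gauss_weight_gt0// ler_piMr// norm_sin_le1.
have [H iI _] := @Rintegral_swap _ _ _ _ _ P leb F _ _ mF iM ih bd.
transitivity ((2 * pi)^-1 * \int[P]_w \int[leb]_xi F (w, xi)).
  have E w : - derive1 (heat_kernel eps) (X w) * G w = (2 * pi)^-1 * \int[leb]_xi F (w, xi).
    rewrite heat_kernel_fourier// -mulrA; congr (_ * _); rewrite -RintegralZr//.
    apply: (le_integrable _ _ _ ih) => //.
      apply/measurable_EFinP; apply: measurable_funM; last exact: measurable_gauss_weight.
      apply: measurable_funM => //; apply: measurableT_comp => //.
      by apply: continuous_measurable_fun; exact: continuous_sin.
    move=> y _; rewrite /= lee_fin.
    rewrite !normrM (ger0_norm (ltW (gauss_weight_gt0 eps y))) normr_id ler_pM2r ?gauss_weight_gt0//.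
    by rewrite ler_piMr// norm_sin_le1.
  under eq_Rintegral do rewrite E.
  by rewrite RintegralZl.
rewrite H; congr (_ * _); apply: eq_Rintegral => xi _.
rewrite -RintegralZl//.
  by apply: eq_Rintegral => w _; rewrite /F/=; ring.
apply: (le_integrable _ _ _ iM) => //.
  apply/measurable_EFinP; apply: measurable_funM => //; apply: measurableT_comp.
    by apply: continuous_measurable_fun; exact: continuous_sin.
  exact: measurable_funM.
move=> w _; rewrite /= lee_fin normrM (le_trans _ (ler_norm M))//.
by rewrite -[M in leRHS]mul1r ler_pM// norm_sin_le1.
Qed.

(** The expectation of a product of two sines is a difference of two exponentials
    of quadratic forms. Integrating the second frequency completes a square and
    leaves, for the first one, a Gaussian second moment. *)
Lemma expectation_heat_kernel_pair eps del (X Y : T -> R) (lam mu rho : R) :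
  0 < eps -> 0 < del -> 0 <= lam -> 0 <= rho -> mu ^+ 2 <= lam * rho ->
  measurable_fun [set: T] X -> measurable_fun [set: T] Y ->
  (forall a b : R, \int[P]_w cos (a * X w + b * Y w) =
     expR (- ((a ^+ 2 * lam + 2 * a * b * mu + b ^+ 2 * rho) / 2))) ->
  \int[P]_w (derive1 (heat_kernel eps) (X w) * derive1 (heat_kernel del) (Y w)) =
  mu / (2 * pi) * ((eps + lam) * (del + rho) - mu ^+ 2) `^ (- (3 / 2)).
Proof.
move=> e0 d0 l0 r0 mulr mX mY cosE.
have icos a b : P.-integrable [set: T] (fun w => (cos (a * X w + b * Y w))%:E).
  have iM : P.-integrable [set: T] (EFin \o (fun=> 1:R)).
    exact: finite_measure_integrable_cst.
  apply: (le_integrable _ _ _ iM) => //.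
    apply/measurable_EFinP; apply: measurableT_comp.
      by apply: continuous_measurable_fun; exact: continuous_cos.
    by apply: measurable_funD; exact: measurable_funM.
  by move=> w _; rewrite /= lee_fin normr1 norm_cos_le1.
have sinE a b : \int[P]_w (sin (X w * a) * sin (Y w * b)) =
    2^-1 * (expR (- ((a ^+ 2 * lam - 2 * a * b * mu + b ^+ 2 * rho) / 2)) -
            expR (- ((a ^+ 2 * lam + 2 * a * b * mu + b ^+ 2 * rho) / 2))).
  transitivity (\int[P]_w (2^-1 * (cos (a * X w + (- b) * Y w) - cos (a * X w + b * Y w)))).
    apply: eq_Rintegral => w _; rewrite mulNr cosB cosD (mulrC a) (mulrC b).
    by move: (cos _) (cos _) (sin _) (sin _) => *; field.
  rewrite RintegralZl//.
    rewrite RintegralB// ?cosE; [|exact: icos|exact: icos].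
    by congr (_ * (expR _ - _)); rewrite sqrrN; field.
  rewrite (_ : _ \o _ = (fun w => (cos (a * X w + (- b) * Y w))%:E - (cos (a * X w + b * Y w))%:E)%E).
    by apply: integrableB => //; exact: icos.
  by apply/funext => w; rewrite /= EFinB.
have [M [M0 delM]] := heat_kernel_derive1_bounded d0.
pose A := del + rho; have A0 : 0 < A by rewrite ltr_wpDr.
(* the Schur complement of A in the smoothed covariance matrix *)
pose C := eps + lam - mu ^+ 2 / A.
have C0 : 0 < C.
  rewrite subr_gt0 ltr_pdivrMr// /A mulrDl !mulrDr.
  have := mulr_gt0 e0 d0; have := mulr_ge0 (ltW e0) r0; have := mulr_ge0 l0 (ltW d0).
  move: (eps * del) (eps * rho) (lam * del) => *; lra.
have inner xi : \int[P]_w (sin (X w * xi) * - derive1 (heat_kernel del) (Y w)) =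
    (2 * pi)^-1 * (mu * xi / A * expR (- (xi ^+ 2 * lam / 2) + mu ^+ 2 * xi ^+ 2 / (2 * A)) * Num.sqrt (2 * pi / A)).
  under eq_Rintegral do rewrite mulrC.
  rewrite (@expectation_heat_kernel_fourier _ _ _ 1)//; last 2 first.
  - apply: measurableT_comp; last exact: measurable_funM.
    by apply: continuous_measurable_fun; exact: continuous_sin.
  - by move=> w; exact: norm_sin_le1.
  congr (_ * _).
  transitivity (\int[leb]_eta (2^-1 * expR (- (xi ^+ 2 * lam / 2)) *
     (eta * expR (mu * xi * eta) * gauss_weight A eta - eta * expR (- (mu * xi) * eta) * gauss_weight A eta))).
    apply: eq_Rintegral => eta _.
    under eq_Rintegral do rewrite mulrC.
    rewrite sinE; set e1 := expR _; set e2 := expR _.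
    transitivity (2^-1 * eta * (gauss_weight del eta * e1 - gauss_weight del eta * e2)); first by ring.
    have -> : gauss_weight del eta * e1 = expR (- (xi ^+ 2 * lam / 2)) * (expR (mu * xi * eta) * gauss_weight A eta).
      by rewrite /gauss_weight /e1 -!expRD; congr expR; rewrite /A; field.
    have -> : gauss_weight del eta * e2 = expR (- (xi ^+ 2 * lam / 2)) * (expR (- (mu * xi) * eta) * gauss_weight A eta).
      by rewrite /gauss_weight /e2 -!expRD; congr expR; rewrite /A; field.
    ring.
  have iexp s : leb.-integrable [set: R] (EFin \o (fun eta => eta * expR (s * eta) * gauss_weight A eta)).
    apply: (@integrable_gauss_weight _ _ (`|s| + 1) 1) => //.
      by apply: measurable_funM => //; apply: measurableT_comp => //; exact: measurable_funM.
    move=> x; rewrite mul1r normrM (ger0_norm (expR_ge0 _)) mulrDl mul1r expRD mulrC.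
    apply: ler_pM => //.
      by rewrite ler_expR (le_trans (ler_norm _))// normrM.
    by rewrite (le_trans _ (expR_ge1Dx _))// lerDr.
  rewrite RintegralZl//; last first.
    rewrite (_ : _ \o _ = (fun eta => (eta * expR (mu * xi * eta) * gauss_weight A eta)%:E - (eta * expR (- (mu * xi) * eta) * gauss_weight A eta)%:E)%E).
      by apply: integrableB => //; exact: iexp.
    by apply/funext => eta; rewrite /= EFinB.
  rewrite RintegralB//.
  rewrite !gauss_exp// sqrrN expRD.
  have -> : (mu * xi) ^+ 2 / (2 * A) = mu ^+ 2 * xi ^+ 2 / (2 * A) by rewrite exprMn.
  by field; rewrite gt_eqF.
transitivity (\int[P]_w (- derive1 (heat_kernel eps) (X w) * (- derive1 (heat_kernel del) (Y w)))).
  by apply: eq_Rintegral => w _; rewrite mulrNN.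
have mdY : measurable_fun [set: T] (fun w => - derive1 (heat_kernel del) (Y w)).
  by apply: measurable_funN; apply: measurableT_comp => //; exact: measurable_derive1_heat_kernel.
rewrite (@expectation_heat_kernel_fourier _ _ _ M)//; last by move=> w; rewrite normrN.
under eq_Rintegral do rewrite inner.
transitivity ((2 * pi)^-1 * \int[leb]_xi ((2 * pi)^-1 * (mu / A) * Num.sqrt (2 * pi / A) * (xi ^+ 2 * gauss_weight C xi))).
  congr (_ * _); apply: eq_Rintegral => xi _.
  rewrite [gauss_weight C xi](_ : _ = gauss_weight eps xi * expR (- (xi ^+ 2 * lam / 2) + mu ^+ 2 * xi ^+ 2 / (2 * A))).
    by set e := expR _; set g := gauss_weight _ _; set q := Num.sqrt _; move: (2 * pi)^-1 => c; ring.
  by rewrite /gauss_weight -expRD; congr expR; rewrite /C; field; rewrite gt_eqF.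
rewrite RintegralZl//; last first.
  apply: (@integrable_gauss_weight _ _ 2 1) => //.
  move=> x; rewrite normrX mul1r expRM_natl ler_pXn2r ?nnegrE ?expR_ge0//.
  by rewrite (le_trans _ (expR_ge1Dx _))// lerDr.
rewrite gauss_sqr//.
have -> : (eps + lam) * (del + rho) - mu ^+ 2 = A * C.
  by rewrite /C /A mulrBr mulrCA divff ?gt_eqF// mulr1 mulrC.
have tp0 : 0 <= 2 * pi :> R by rewrite mulr_ge0// pi_ge0.
have -> : (A * C) `^ (- (3 / 2)) = (A * C)^-1 * ((Num.sqrt A)^-1 * (Num.sqrt C)^-1).
  have AC0 : 0 < A * C by exact: mulr_gt0.
  rewrite (_ : - (3 / 2) = - 1 - 2^-1); last by field.
  rewrite powRD; last by rewrite (gt_eqF AC0) implybT.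
  rewrite powRN powRr1 ?ltW// powRN powR12_sqrt ?ltW// sqrtrM ?ltW//.
  by congr (_ * _); rewrite invfM.
rewrite [Num.sqrt (2 * pi / A)]sqrtrM// [Num.sqrt (2 * pi / C)]sqrtrM//.
rewrite (sqrtrV (ltW A0)) (sqrtrV (ltW C0)).
have := sqr_sqrtr tp0; have : Num.sqrt (2 * pi) != 0 :> R.
  by rewrite gt_eqF// sqrtr_gt0 mulr_gt0// pi_gt0.
move: (Num.sqrt (2 * pi)) => q q0 <-.
have := lt0r_neq0 A0; have := lt0r_neq0 C0.
have : Num.sqrt A != 0 by rewrite gt_eqF// sqrtr_gt0.
have : Num.sqrt C != 0 by rewrite gt_eqF// sqrtr_gt0.
move: (Num.sqrt A) (Num.sqrt C) (A) (C) => sA sC a c sC0 sA0 c0 a0.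
by field; rewrite q0 sC0 sA0 c0 a0.
Qed.
End heat_kernel.

(** * The power 4/3 through cube roots *)

Section cube_root_inequalities.
Context {R : realType}.
Implicit Types x y z u v w S : R.

(** In terms of cubes the power 4/3 is the fourth power, and 4/3 u is its slope
    at u^3. *)
Lemma slope_lower u v : 0 <= u -> u <= v -> 4 / 3 * u * (v ^+ 3 - u ^+ 3) <= v ^+ 4 - u ^+ 4.
Proof.
move=> u0 uv; rewrite -subr_ge0.
rewrite (_ : _ - _ = (v - u) ^+ 2 * (v ^+ 2 + 2 / 3 * u * v + u ^+ 2 / 3)); last by field.
have v0 := le_trans u0 uv.
by rewrite mulr_ge0 ?sqr_ge0// !addr_ge0 ?sqr_ge0 ?mulr_ge0 ?divr_ge0 ?sqr_ge0.
Qed.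

Lemma slope_upper u v : 0 <= u -> u <= v -> v ^+ 4 - u ^+ 4 <= 4 / 3 * v * (v ^+ 3 - u ^+ 3).
Proof.
move=> u0 uv; rewrite -subr_ge0.
rewrite (_ : _ - _ = (v - u) ^+ 2 * (v ^+ 2 / 3 + 2 / 3 * u * v + u ^+ 2)); last by field.
have v0 := le_trans u0 uv.
by rewrite mulr_ge0 ?sqr_ge0// !addr_ge0 ?sqr_ge0 ?mulr_ge0 ?divr_ge0 ?sqr_ge0.
Qed.

Lemma ler_cube u v : 0 <= v -> u ^+ 3 <= v ^+ 3 -> u <= v.
Proof.
move=> v0 h; rewrite leNgt; apply/negP => vu.
have : v ^+ 3 < u ^+ 3 by rewrite ltr_pXn2r ?nnegrE// (le_trans v0)// ltW.
by rewrite ltNge h.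
Qed.

Lemma superadd4 x y w : 0 <= x -> 0 <= y -> 0 <= w -> w ^+ 3 = x ^+ 3 + y ^+ 3 ->
  x ^+ 4 + y ^+ 4 <= w ^+ 4.
Proof.
move=> x0 y0 w0 h.
have xw : x <= w by apply: ler_cube => //; rewrite h lerDl exprn_ge0.
have yw : y <= w by apply: ler_cube => //; rewrite h lerDr exprn_ge0.
rewrite [w ^+ 4]exprSr h [x ^+ 4]exprSr [y ^+ 4]exprSr mulrDl lerD// ler_wpM2l ?exprn_ge0//.
Qed.

(** The covariance of two adjacent increments is at most 3/8 x^2 y^2. Taking the
    cube removes w and leaves a polynomial inequality. *)
Lemma adjacent_upper x y w : 0 <= x -> 0 <= y -> 0 <= w -> w ^+ 3 = x ^+ 3 + y ^+ 3 ->
  w ^+ 4 <= x ^+ 4 + y ^+ 4 + 3 / 4 * (x ^+ 2 * y ^+ 2).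
Proof.
move=> x0 y0 w0 h.
set Q := _ + _.
have Q0 : 0 <= Q by rewrite !addr_ge0 ?exprn_ge0// mulr_ge0// mulr_ge0 ?exprn_ge0.
apply: ler_cube => //; rewrite -exprM mulnC exprM h -subr_ge0.
(* a sum of squares with positive coefficients *)
rewrite [X in 0 <= X](_ : _ = x ^+ 8 * (y * (3 / 2 * x - 4 / 3 * y)) ^+ 2
   + y ^+ 8 * (x * (3 / 2 * y - 4 / 3 * x)) ^+ 2
   + (75 / 16 - 16 / 9) * (x ^+ 2 * y ^+ 2 * (x ^+ 2 - y ^+ 2)) ^+ 2
   + (2 * (75 / 16 - 16 / 9) - 69 / 64) * (x ^+ 3 * y ^+ 3) ^+ 2); last by rewrite /Q; field.
rewrite !addr_ge0// mulr_ge0 ?sqr_ge0 ?exprn_ge0//; lra.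
Qed.

(** Here o is the covariance of the increments over intervals of lengths x^3 and
    z^3 at distance y^3. It is nonnegative by convexity of the power 4/3. The
    first upper bound improves on Cauchy-Schwarz, the second one expresses that
    the power is smooth at distance y^3. *)
Lemma second_difference x y z u v S : 0 <= x -> 0 <= y -> 0 <= z -> 0 <= u -> 0 <= v -> 0 <= S ->
  u ^+ 3 = x ^+ 3 + y ^+ 3 -> v ^+ 3 = y ^+ 3 + z ^+ 3 -> S ^+ 3 = x ^+ 3 + y ^+ 3 + z ^+ 3 ->
  let o := 2^-1 * (S ^+ 4 + y ^+ 4 - u ^+ 4 - v ^+ 4) in
  [/\ 0 <= o, o <= 21 / 25 * (x ^+ 2 * z ^+ 2) & o * y ^+ 2 <= 4 / 9 * (x ^+ 3 * z ^+ 3)].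
Proof.
wlog xz : x z u v / x <= z.
  move=> H x0 y0 z0 u0 v0 S0 ux vz Sx.
  have [xz|/ltW zx] := leP x z; first exact: H.
  have [] := H z x v u zx z0 y0 x0 v0 u0 S0 _ _ _; [by lra..|].
  move=> /= a b c; split; lra.
move=> x0 y0 z0 u0 v0 S0 ux vz Sx /=.
have x30 : 0 <= x ^+ 3 by exact: exprn_ge0.
have y30 : 0 <= y ^+ 3 by exact: exprn_ge0.
have z30 : 0 <= z ^+ 3 by exact: exprn_ge0.
have xz3 : x ^+ 3 <= z ^+ 3 by rewrite lerXn2r.
have vS : v <= S by apply: ler_cube => //; lra.
have yu : y <= u by apply: ler_cube => //; lra.
have uv : u <= v by apply: ler_cube => //; lra.
have yS : y <= S by apply: ler_cube => //; lra.
have L1 := slope_lower v0 vS; have L2 := slope_upper y0 yu.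
have L3 := slope_upper v0 vS; have L4 := slope_lower y0 yu.
have Sv : S ^+ 3 - v ^+ 3 = x ^+ 3 by lra.
have uy : u ^+ 3 - y ^+ 3 = x ^+ 3 by lra.
rewrite Sv in L1 L3; rewrite uy in L2 L4.
have Sd : S - y <= 63 / 50 * z.
  rewrite lerBlDr; apply: ler_cube; first by rewrite addr_ge0// mulr_ge0.
  have z2y : 0 <= z * z * y by rewrite !mulr_ge0.
  have zy2 : 0 <= z * y * y by rewrite !mulr_ge0.
  rewrite !exprS !expr0 !mulr1 in Sx x30 y30 z30 xz3 *. nra.
have Sd2 : (S - y) * (3 * y ^+ 2) <= 2 * z ^+ 3.
  have : (S - y) * (3 * y ^+ 2) <= (S - y) * (S ^+ 2 + S * y + y ^+ 2).
    rewrite ler_wpM2l ?subr_ge0//.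
    nra.
  have -> : (S - y) * (S ^+ 2 + S * y + y ^+ 2) = S ^+ 3 - y ^+ 3 by ring.
  lra.
have o_le : 2^-1 * (S ^+ 4 + y ^+ 4 - u ^+ 4 - v ^+ 4) <= 2 / 3 * (x ^+ 3 * (S - y)).
  lra.
split.
- have : 0 <= x ^+ 3 * (v - u) by rewrite mulr_ge0// subr_ge0.
  lra.
- apply: (le_trans o_le).
  have : x ^+ 3 * (S - y) <= x ^+ 3 * (63 / 50 * z) by rewrite ler_wpM2l.
  have : x ^+ 3 * z <= x ^+ 2 * z ^+ 2.
    by rewrite exprSr -mulrA ler_wpM2l ?sqr_ge0// expr2 ler_wpM2r.
  lra.
- have y20 : 0 <= y ^+ 2 by exact: sqr_ge0.
  apply: (le_trans (ler_wpM2r y20 o_le)).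
  have : x ^+ 3 * ((S - y) * (3 * y ^+ 2)) <= x ^+ 3 * (2 * z ^+ 3) by rewrite ler_wpM2l.
  lra.
Qed.
End cube_root_inequalities.

(** * Gram determinants and the kernel of the second moment *)

Section gram_determinants.
Context {R : realType}.
Implicit Types x y z p q o al be ga eps : R.

(** Two increments sharing the middle piece; p, q and o are the covariances of the
    pieces. The determinant is the one of the pieces x and y, plus the one of
    x + y and z, plus terms of which the negative ones contain o; these are small
    because the middle piece separates the outer ones. *)
Lemma gram_overlap x y z p q o : 0 <= x -> 0 <= y -> 0 <= z ->
  0 <= p <= 3 / 8 * (x ^+ 2 * y ^+ 2) -> 0 <= q -> 0 <= o ->
  o <= 21 / 25 * (x ^+ 2 * z ^+ 2) -> o * y ^+ 2 <= 4 / 9 * (x ^+ 3 * z ^+ 3) ->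
  (q + o) ^+ 2 <= 9 / 64 * ((x ^+ 4 + y ^+ 4 + 2 * p) * z ^+ 4) ->
  1 / 16 * (x ^+ 4 * y ^+ 4 + y ^+ 4 * z ^+ 4 + z ^+ 4 * x ^+ 4) <=
  (x ^+ 4 + y ^+ 4 + 2 * p) * (y ^+ 4 + z ^+ 4 + 2 * q) - (y ^+ 4 + p + q + o) ^+ 2.
Proof.
move=> x0 y0 z0 /andP[p0 pxy] q0 o0 oxz oy m2.
have X0 : 0 <= x ^+ 2 := sqr_ge0 x; have Y0 : 0 <= y ^+ 2 := sqr_ge0 y.
have Z0 : 0 <= z ^+ 2 := sqr_ge0 z.
have p2 : p ^+ 2 <= 9 / 64 * (x ^+ 4 * y ^+ 4).
  have -> : 9 / 64 * (x ^+ 4 * y ^+ 4) = (3 / 8 * (x ^+ 2 * y ^+ 2)) ^+ 2 by field.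
  by rewrite lerXn2r// nnegrE !mulr_ge0.
have beo : 2 * (y ^+ 4 * o) <= 8 / 9 * (2^-1 * (x ^+ 4 * z ^+ 4) +
    4^-1 * (x ^+ 4 * y ^+ 4) + 4^-1 * (y ^+ 4 * z ^+ 4)).
  have h1 : y ^+ 2 * (o * y ^+ 2) <= y ^+ 2 * (4 / 9 * (x ^+ 3 * z ^+ 3)) by rewrite ler_wpM2l.
  have h2 : 0 <= (x ^+ 2 * z ^+ 2 - x * z * y ^+ 2) ^+ 2 := sqr_ge0 _.
  have h3 : 0 <= (x ^+ 2 * y ^+ 2 - z ^+ 2 * y ^+ 2) ^+ 2 := sqr_ge0 _.
  have e1 : y ^+ 2 * (o * y ^+ 2) = y ^+ 4 * o by ring.
  have e2 : y ^+ 2 * (4 / 9 * (x ^+ 3 * z ^+ 3)) = 4 / 9 * (x ^+ 2 * z ^+ 2 * (x * z * y ^+ 2)) by field.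
  have e3 : (x ^+ 2 * z ^+ 2 - x * z * y ^+ 2) ^+ 2 = x ^+ 4 * z ^+ 4 - 2 * (x ^+ 2 * z ^+ 2 * (x * z * y ^+ 2)) + x ^+ 2 * z ^+ 2 * y ^+ 4 by ring.
  have e4 : (x ^+ 2 * y ^+ 2 - z ^+ 2 * y ^+ 2) ^+ 2 = x ^+ 4 * y ^+ 4 - 2 * (x ^+ 2 * z ^+ 2 * y ^+ 4) + y ^+ 4 * z ^+ 4 by ring.
  lra.
have po : 2 * (p * o) <= 63 / 200 * (x ^+ 4 * y ^+ 4 + z ^+ 4 * x ^+ 4).
  have h1 : p * o <= (3 / 8 * (x ^+ 2 * y ^+ 2)) * (21 / 25 * (x ^+ 2 * z ^+ 2)) by rewrite ler_pM.
  have h2 : 0 <= (x ^+ 2 * y ^+ 2 - x ^+ 2 * z ^+ 2) ^+ 2 := sqr_ge0 _.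
  have e1 : (x ^+ 2 * y ^+ 2 - x ^+ 2 * z ^+ 2) ^+ 2 = x ^+ 4 * y ^+ 4 - 2 * (x ^+ 2 * y ^+ 2 * (x ^+ 2 * z ^+ 2)) + z ^+ 4 * x ^+ 4 by ring.
  lra.
rewrite (_ : _ - (y ^+ 4 + p + q + o) ^+ 2 =
   (x ^+ 4 * y ^+ 4 - p ^+ 2) + ((x ^+ 4 + y ^+ 4 + 2 * p) * z ^+ 4 - (q + o) ^+ 2)
   + 2 * ((x ^+ 4 + p) * q) - 2 * (y ^+ 4 * o) - 2 * (p * o)); last by ring.
have h1 : 0 <= (x ^+ 4 + p) * q by rewrite mulr_ge0// addr_ge0// exprn_ge0.
have h2 : 0 <= p * z ^+ 4 by rewrite mulr_ge0// exprn_ge0.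
have : 0 <= x ^+ 4 * y ^+ 4 by rewrite mulr_ge0// exprn_ge0.
have : 0 <= y ^+ 4 * z ^+ 4 by rewrite mulr_ge0// exprn_ge0.
have : 0 <= z ^+ 4 * x ^+ 4 by rewrite mulr_ge0// exprn_ge0.
have e : (x ^+ 4 + y ^+ 4 + 2 * p) * z ^+ 4 = z ^+ 4 * x ^+ 4 + y ^+ 4 * z ^+ 4 + 2 * (p * z ^+ 4) by ring.
rewrite e in m2 *.
lra.
Qed.

(** The increment over the middle piece against the one over the three pieces: the
    determinant is y^4 (x^4 + z^4 + 2 o) - (p + q)^2. *)
Lemma gram_nested x y z p q o : 0 <= x -> 0 <= y -> 0 <= z ->
  0 <= p <= 3 / 8 * (x ^+ 2 * y ^+ 2) -> 0 <= q <= 3 / 8 * (y ^+ 2 * z ^+ 2) -> 0 <= o ->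
  7 / 10 * (y ^+ 4 * (x ^+ 4 + z ^+ 4)) <=
  (x ^+ 4 + y ^+ 4 + z ^+ 4 + 2 * p + 2 * q + 2 * o) * y ^+ 4 - (y ^+ 4 + p + q) ^+ 2.
Proof.
move=> x0 y0 z0 /andP[p0 pxy] /andP[q0 qyz] o0.
have X0 : 0 <= x ^+ 2 := sqr_ge0 x; have Y0 : 0 <= y ^+ 2 := sqr_ge0 y.
have Z0 : 0 <= z ^+ 2 := sqr_ge0 z.
have p2 : p ^+ 2 <= 9 / 64 * (x ^+ 4 * y ^+ 4).
  have -> : 9 / 64 * (x ^+ 4 * y ^+ 4) = (3 / 8 * (x ^+ 2 * y ^+ 2)) ^+ 2 by field.
  by rewrite lerXn2r// nnegrE !mulr_ge0.
have q2 : q ^+ 2 <= 9 / 64 * (y ^+ 4 * z ^+ 4).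
  have -> : 9 / 64 * (y ^+ 4 * z ^+ 4) = (3 / 8 * (y ^+ 2 * z ^+ 2)) ^+ 2 by field.
  by rewrite lerXn2r// nnegrE !mulr_ge0.
have h := sqr_ge0 (p - q).
have h1 : 0 <= o * y ^+ 4 by rewrite mulr_ge0// exprn_ge0.
have : 0 <= x ^+ 4 * y ^+ 4 by rewrite mulr_ge0// exprn_ge0.
have : 0 <= y ^+ 4 * z ^+ 4 by rewrite mulr_ge0// exprn_ge0.
have e1 : (p - q) ^+ 2 = p ^+ 2 - 2 * (p * q) + q ^+ 2 by ring.
have e2 : (x ^+ 4 + y ^+ 4 + z ^+ 4 + 2 * p + 2 * q + 2 * o) * y ^+ 4 - (y ^+ 4 + p + q) ^+ 2 =
  x ^+ 4 * y ^+ 4 + y ^+ 4 * z ^+ 4 + 2 * (o * y ^+ 4) - p ^+ 2 - q ^+ 2 - 2 * (p * q) by ring.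
have e3 : y ^+ 4 * (x ^+ 4 + z ^+ 4) = x ^+ 4 * y ^+ 4 + y ^+ 4 * z ^+ 4 by ring.
rewrite e2 e3; rewrite e1 in h.
lra.
Qed.

(** Up to the factor 1 / (2 pi), the expectation of the product of the derivatives
    of two heat kernels at a Gaussian pair, as a function of the smoothed variances
    L and Q and of the covariance m. *)
Definition moment_kernel (L Q m : R) : R := m * (L * Q - m ^+ 2) `^ (- (3 / 2)).

(** The first order in the covariance, which is the contribution of the first
    Wiener chaos. *)
Definition first_chaos_kernel (L Q m : R) : R := m * (L `^ (- (3 / 2)) * Q `^ (- (3 / 2))).

Lemma le_of_eq x y : x = y -> x <= y. Proof. by move->. Qed.

Lemma le_powRN (r E D : R) : 0 <= r -> 0 < E -> E <= D -> D `^ (- r) <= E `^ (- r).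
Proof.
move=> r0 E0 ED; have D0 := lt_le_trans E0 ED.
rewrite !powRN lef_pV2 ?posrE ?powR_gt0//.
by apply: ge0_ler_powR => //; rewrite nnegrE ltW.
Qed.

(** The case of a common part of length be^(3/4) that is the longest gap: the
    covariance is of order be, and the determinant still controls the other
    gaps. *)
Lemma ker_le_common (K eps al be ga L Q m : R) : 0 < K -> 0 < eps -> 0 <= al -> 0 < be -> 0 <= ga ->
  0 <= m <= 3 * be -> K * (be * (eps + al + ga)) <= L * Q - m ^+ 2 ->
  moment_kernel L Q m <= 3 * K `^ (- (3 / 2)) * (be `^ (- (1 / 2)) * (eps + al + ga) `^ (- (3 / 2))).
Proof.
move=> K0 e0 a0 b0 g0 /andP[m0 mb] D.
have E0 : 0 < eps + al + ga by rewrite -addrA ltr_wpDr// addr_ge0.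
rewrite /moment_kernel; apply: (@le_trans _ _ (3 * be * (K * (be * (eps + al + ga))) `^ (- (3 / 2)))).
  apply: ler_pM => //; first exact: powR_ge0.
  by apply: le_powRN => //; rewrite !mulr_gt0.
rewrite powRM ?(ltW K0) ?(ltW (mulr_gt0 b0 E0))// powRM ?(ltW b0) ?(ltW E0)//.
rewrite [be `^ (- (1 / 2))](_ : _ = be * be `^ (- (3 / 2))).
  by rewrite le_eqVlt; apply/orP; left; apply/eqP; ring.
rewrite -{2}(powRr1 (ltW b0)) -powRD; last by rewrite (gt_eqF b0) implybT.
by congr (_ `^ _); field.
Qed.

Lemma mul3_le_cube x y z : 0 <= x -> 0 <= y -> 0 <= z -> x * y * z <= (x + y + z) ^+ 3.
Proof.
move=> x0 y0 z0; rewrite exprSr expr2; apply: ler_pM => //; [exact: mulr_ge0| |lra].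
by apply: ler_pM => //; lra.
Qed.

(** The case of a covariance controlled by the products of pairs of gaps: the
    determinant controls these products, hence the product of all gaps. *)
Lemma ker_le_product (K al be ga L Q m : R) : 0 < K -> 0 < al -> 0 < be -> 0 < ga ->
  0 <= m -> m ^+ 2 <= 16 * (al * be + be * ga + ga * al) ->
  K * (al * be + be * ga + ga * al) <= L * Q - m ^+ 2 ->
  moment_kernel L Q m <= 4 * K `^ (- (3 / 2)) * (al * be * ga) `^ (- (2 / 3)).
Proof.
move=> K0 a0 b0 g0 m0 m2 D; pose e := al * be + be * ga + ga * al; rewrite -/e in m2 D.
have e0 : 0 < e by rewrite !addr_gt0// mulr_gt0.
have me : m <= 4 * e `^ (1 / 2).
  rewrite div1r powR12_sqrt ?(ltW e0)//.
  have s0 : 0 <= 4 * Num.sqrt e by rewrite mulr_ge0.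
  rewrite -(ler_pXn2r (n := 2)) ?nnegrE//.
  by rewrite exprMn sqr_sqrtr ?(ltW e0)// (le_trans m2)// -natrX.
rewrite /moment_kernel; apply: (@le_trans _ _ (4 * e `^ (1 / 2) * (K * e) `^ (- (3 / 2)))).
  apply: ler_pM => //; first exact: powR_ge0.
  by apply: le_powRN => //; rewrite mulr_gt0.
rewrite powRM ?(ltW K0) ?(ltW e0)// mulrACA -!mulrA ler_pM2l// ler_pM2l ?powR_gt0//.
rewrite -powRD; last by rewrite (gt_eqF e0) implybT.
have -> : 1 / 2 - 3 / 2 = - 1 :> R by field.
have abg : 0 < al * be * ga by rewrite !mulr_gt0.
have h : (al * be * ga) ^+ 2 <= e ^+ 3.
  rewrite (_ : _ ^+ 2 = (al * be) * (be * ga) * (ga * al)); last by ring.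
  by apply: mul3_le_cube; rewrite ltW// mulr_gt0.
have h' : (al * be * ga) `^ (2 / 3) <= e.
  have e1 : (e ^+ 3) `^ 3^-1 = e.
    by rewrite -powR_mulrn ?(ltW e0)// -powRrM mulfV// powRr1 ?(ltW e0).
  rewrite powRrM powR_mulrn ?(ltW abg)// -[leRHS]e1.
  by apply: ge0_ler_powR => //; rewrite nnegrE ?exprn_ge0 ?(ltW abg) ?(ltW e0).
rewrite [al * (be * ga)]mulrA [leRHS]powRN powRN powRr1 ?(ltW e0)//.
by rewrite lef_pV2 ?posrE// powR_gt0.
Qed.

(** The case of an inner interval of length y^3 in an outer one of length S^3, the
    inner one not being the longest gap: the covariance is at most the inner
    length times the slope of the power 4/3 at the outer one. *)
Lemma ker_le_nested (K eps y S al ga L Q m : R) : 0 < K -> 0 < eps -> 0 < y -> 0 < S ->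
  S ^+ 4 <= 6 * (al + ga) -> 0 <= m <= 3 * (y ^+ 3 * S) ->
  K * ((eps + y ^+ 4) * (al + ga)) <= L * Q - m ^+ 2 ->
  moment_kernel L Q m <= 3 * (K / 6) `^ (- (3 / 2)) *
    (y ^+ 3 * (eps + y ^+ 4) `^ (- (3 / 2)) * S `^ (- 5)).
Proof.
move=> K0 e0 y0 S0 Sag /andP[m0 mS] D.
have E0 : 0 < eps + y ^+ 4 by rewrite addr_gt0// exprn_gt0.
have S40 : 0 < S ^+ 4 by rewrite exprn_gt0.
have K6 : 0 < K / 6 by rewrite divr_gt0.
rewrite /moment_kernel; apply: (@le_trans _ _ (3 * (y ^+ 3 * S) * (K / 6 * ((eps + y ^+ 4) * S ^+ 4)) `^ (- (3 / 2)))).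
  apply: ler_pM => //; first exact: powR_ge0.
  apply: le_powRN => //; first by rewrite !mulr_gt0.
  apply: le_trans D.
  rewrite (_ : K * ((eps + y ^+ 4) * (al + ga)) = K / 6 * ((eps + y ^+ 4) * (6 * (al + ga)))); last by field.
  by rewrite ler_pM2l// ler_pM2l.
move: (K / 6) K6 => k k0.
rewrite powRM ?(ltW k0) ?(ltW (mulr_gt0 E0 S40))// powRM ?(ltW E0) ?(ltW S40)//.
have -> : (S ^+ 4) `^ (- (3 / 2)) = S `^ (- 6).
  by rewrite -powR_mulrn ?(ltW S0)// -powRrM; congr (_ `^ _); field.
have -> : S `^ (- 5) = S * S `^ (- 6).
  rewrite -{2}(powRr1 (ltW S0)) -powRD; last by rewrite (gt_eqF S0) implybT.
  by congr (_ `^ _); ring.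
by apply: le_of_eq; ring.
Qed.

(** The correlation is bounded away from 1, so that the remainder is cubic in the
    covariance. *)
Lemma ker_le_disjoint (eps x y z m : R) : 0 < eps -> 0 < x -> 0 < y -> 0 < z ->
  0 <= m -> m <= 21 / 25 * (x ^+ 2 * z ^+ 2) -> m * y ^+ 2 <= 4 / 9 * (x ^+ 3 * z ^+ 3) ->
  moment_kernel (eps + x ^+ 4) (eps + z ^+ 4) m - first_chaos_kernel (eps + x ^+ 4) (eps + z ^+ 4) m <=
  25 * (x * y * z) `^ (- (8 / 3)).
Proof.
move=> e0 x0 y0 z0 m0 mxz my.
set L := eps + x ^+ 4; set Q := eps + z ^+ 4.
have x4 : 0 < x ^+ 4 by rewrite exprn_gt0.
have z4 : 0 < z ^+ 4 by rewrite exprn_gt0.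
have L0 : 0 < L by rewrite addr_gt0.
have Q0 : 0 < Q by rewrite addr_gt0.
have LQ0 : 0 < L * Q by rewrite mulr_gt0.
have LQge : x ^+ 4 * z ^+ 4 <= L * Q.
  by apply: ler_pM; rewrite ?(ltW x4) ?(ltW z4)// lerDr (ltW e0).
pose q := m ^+ 2 / (L * Q).
have q0 : 0 <= q by rewrite divr_ge0 ?sqr_ge0 ?(ltW LQ0).
have q1 : q <= 3 / 4.
  rewrite ler_pdivrMr//.
  have G0 : 0 <= x ^+ 2 * z ^+ 2 by rewrite mulr_ge0// sqr_ge0.
  have : m ^+ 2 <= (6 / 7 * (x ^+ 2 * z ^+ 2)) ^+ 2.
    by apply: lerXn2r; rewrite ?nnegrE//; [exact: mulr_ge0 | lra].
  rewrite (_ : (6 / 7 * _) ^+ 2 = 36 / 49 * (x ^+ 4 * z ^+ 4)); last by field.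
  have : 0 <= x ^+ 4 * z ^+ 4 by rewrite mulr_ge0// ltW.
  move: LQge; move: (x ^+ 4 * z ^+ 4) (L * Q) (m ^+ 2) => *; lra.
have D : L * Q - m ^+ 2 = L * Q * (1 - q).
  by rewrite mulrBr mulr1 /q mulrCA mulfV ?mulr1// gt_eqF.
have hq : (1 - q) `^ (- (3 / 2)) <= 1 + 25 * q.
  apply: (@le_trans _ _ ((1 - q) `^ (- 2))).
    by apply: ger_powR; [apply/andP; split; lra | lra].
  rewrite powRN powR_mulrn; last lra.
  rewrite -[_^-1]mul1r ler_pdivrMr; last by rewrite exprn_gt0//; lra.
  rewrite -subr_ge0 (_ : _ - 1 = q * (23 - 49 * q + 25 * q ^+ 2)); last by ring.
  rewrite mulr_ge0//; nra.
rewrite /moment_kernel /first_chaos_kernel D powRM ?(ltW LQ0)//; last by lra.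
rewrite -[L `^ _ * _]powRM ?(ltW L0) ?(ltW Q0)// mulrA.
apply: (@le_trans _ _ (25 * (m * (L * Q) `^ (- (3 / 2)) * q))).
  have : m * (L * Q) `^ (- (3 / 2)) * (1 - q) `^ (- (3 / 2)) <= m * (L * Q) `^ (- (3 / 2)) * (1 + 25 * q).
    by rewrite ler_wpM2l// mulr_ge0// powR_ge0.
  lra.
rewrite ler_pM2l//.
have -> : m * (L * Q) `^ (- (3 / 2)) * q = m ^+ 3 * (L * Q) `^ (- (5 / 2)).
  rewrite /q (_ : - (5 / 2) = - (3 / 2) + - 1); last by field.
  rewrite [in RHS]powRD; last by rewrite (gt_eqF LQ0) implybT.
  by rewrite [_ `^ (- 1)]powRN powRr1 ?(ltW LQ0)//; ring.
apply: (@le_trans _ _ (m ^+ 3 * (x ^+ 4 * z ^+ 4) `^ (- (5 / 2)))).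
  by rewrite ler_wpM2l ?exprn_ge0// le_powRN// mulr_gt0.
pose g := x * z; have g0 : 0 < g by rewrite mulr_gt0.
have mg2 : m <= g ^+ 2.
  by apply: (le_trans mxz); rewrite exprMn ler_piMl//; [rewrite mulr_ge0 ?sqr_ge0|lra].
have mg3 : m <= g ^+ 3 * y `^ (- 2).
  rewrite powRN powR_mulrn ?(ltW y0)// ler_pdivlMr ?exprn_gt0//.
  apply: (le_trans my); rewrite exprMn ler_piMl//; last lra.
  by rewrite mulr_ge0 ?exprn_ge0 ?(ltW x0) ?(ltW z0).
(* the exponents are those for which x, y and z get the same power *)
have m3 : m ^+ 3 <= (g ^+ 2) `^ (5 / 3) * (g ^+ 3 * y `^ (- 2)) `^ (4 / 3).
  have [->|mn] := eqVneq m 0; first by rewrite expr0n/= mulr_ge0 ?powR_ge0.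
  have -> : m ^+ 3 = m `^ (5 / 3) * m `^ (4 / 3).
    rewrite -powRD; last by rewrite mn implybT.
    by rewrite (_ : 5 / 3 + 4 / 3 = 3%:R) ?powR_mulrn//; field.
  apply: ler_pM; rewrite ?powR_ge0//; apply: ge0_ler_powR => //; rewrite ?nnegrE ?sqr_ge0//.
  by rewrite mulr_ge0 ?powR_ge0 ?exprn_ge0 ?(ltW g0).
apply: (le_trans (ler_wpM2r (powR_ge0 _ _) m3)).
rewrite -exprMn -/g -!powR_mulrn ?(ltW g0)//.
rewrite powRM ?powR_ge0// -!powRrM [x * y * z](_ : _ = g * y); last by rewrite /g; ring.
rewrite [leRHS]powRM ?(ltW g0) ?(ltW y0)//.
rewrite [X in X <= _](_ : _ = g `^ (2 * (5 / 3)) * g `^ (3 * (4 / 3)) * g `^ (4 * (- (5 / 2))) * y `^ (- 2 * (4 / 3))); last by ring.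
rewrite -!powRD ?(gt_eqF g0) ?implybT//.
apply: le_of_eq; by congr (_ `^ _ * _ `^ _); field.
Qed.
End gram_determinants.

(** * The relative positions of two intervals *)

Section gaps.
Context {R : realType}.
Implicit Types a b c eps al be ga p q o s : R.

(** The determinant bounds below all hold with the constant 1 / 100. *)
Definition det_const : R := (1 / 100) `^ (- (3 / 2)).

(** The largest factor comes from [ker_le_common] and [powR_m32_le]: 3 times 9. *)
Definition kernel_const : R := 27 * det_const.

Lemma det_const_ge1 : 1 <= det_const.
Proof.
have h : (1:R) `^ (- (3 / 2)) = 1 by rewrite powR1.
by rewrite /det_const -[X in X <= _]h; apply: le_powRN; lra.
Qed.

Lemma kernel_const_gt0 : 0 < kernel_const.
Proof. by rewrite /kernel_const mulr_gt0// powR_gt0//; lra. Qed.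

Lemma cube_root a : 0 <= a -> exists x : R,
  [/\ 0 <= x, a = x ^+ 3, a `^ (4 / 3) = x ^+ 4 & (0 < a -> 0 < x)].
Proof.
move=> a0; exists (a `^ 3^-1).
have h0 : 0 <= a `^ 3^-1 by exact: powR_ge0.
have a3 : a = (a `^ 3^-1) ^+ 3.
  by rewrite -powR_mulrn// -powRrM mulVf// powRr1.
split => //; last by move=> a1; exact: powR_gt0.
by rewrite -(powR_mulrn 4 h0) -powRrM; congr (_ `^ _); field.
Qed.

(** Lengths a and c at distance b. Only the first-chaos part fails to be
    integrable uniformly in eps. *)
Lemma gap_disjoint eps a b c : 0 < eps -> 0 < a -> 0 < b -> 0 < c ->
  let o := 2^-1 * ((a + b + c) `^ (4 / 3) + b `^ (4 / 3) - (a + b) `^ (4 / 3) - (b + c) `^ (4 / 3)) in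
  0 <= o /\
  moment_kernel (eps + a `^ (4 / 3)) (eps + c `^ (4 / 3)) o - first_chaos_kernel (eps + a `^ (4 / 3)) (eps + c `^ (4 / 3)) o <=
  kernel_const * (a * b * c) `^ (- (8 / 9)).
Proof.
move=> e0 a0 b0 c0 /=.
have [x [x0 ax -> /(_ a0) {}x0]] := cube_root (ltW a0).
have [y [_ by_ -> /(_ b0) y0]] := cube_root (ltW b0).
have [z [_ cz -> /(_ c0) z0]] := cube_root (ltW c0).
have [u [u0 au -> _]] := cube_root (ltW (addr_gt0 a0 b0)).
have [v [v0 bv -> _]] := cube_root (ltW (addr_gt0 b0 c0)).
have [S [S0 aS -> _]] := cube_root (ltW (addr_gt0 (addr_gt0 a0 b0) c0)).
have [] := @second_difference _ x y z u v S (ltW x0) (ltW y0) (ltW z0) u0 v0 S0; [by rewrite -au ax by_|by rewrite -bv by_ cz|by rewrite -aS ax by_ cz|].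
move=> o0 o1 o2; split => //.
apply: (le_trans (ker_le_disjoint e0 x0 y0 z0 o0 o1 o2)).
have -> : (a * b * c) `^ (- (8 / 9)) = (x * y * z) `^ (- (8 / 3)).
  have xyz : 0 <= x * y * z by rewrite !mulr_ge0 ?(ltW x0) ?(ltW y0) ?(ltW z0).
  by rewrite ax by_ cz -!exprMn -(powR_mulrn 3 xyz) -powRrM; congr (_ `^ _); field.
rewrite ler_wpM2r ?powR_ge0// /kernel_const; move: det_const_ge1; lra.
Qed.

Lemma eta_le eps E a : 0 <= a -> a `^ (4 / 3) <= E -> a <= E `^ (3 / 4).
Proof.
move=> a0 aE.
have -> : a = (a `^ (4 / 3)) `^ (3 / 4).
  by rewrite -powRrM (_ : 4 / 3 * (3 / 4) = 1) ?powRr1//; field.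
have E0 : 0 <= E := le_trans (powR_ge0 _ _) aE.
have h : 0 <= a `^ (4 / 3) by exact: powR_ge0.
by apply: ge0_ler_powR; rewrite ?nnegrE//; lra.
Qed.

Lemma powR_m32_le eps a c : 0 < eps -> 0 <= a -> 0 <= c ->
  (eps + a `^ (4 / 3) + c `^ (4 / 3)) `^ (- (3 / 2)) <= 9 * (eps `^ (3 / 4) + a + c) ^- 2.
Proof.
move=> e0 a0 c0; set E := _ + _.
have pa : 0 <= a `^ (4 / 3) by exact: powR_ge0.
have pc : 0 <= c `^ (4 / 3) by exact: powR_ge0.
have E0 : 0 < E by rewrite /E; lra.
have e1 : 0 < eps `^ (3 / 4) by exact: powR_gt0.
have h1 : eps `^ (3 / 4) <= E `^ (3 / 4).
  by apply: ge0_ler_powR; rewrite ?nnegrE ?(ltW e0) ?(ltW E0)// /E; lra.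
have h2 : a <= E `^ (3 / 4) by apply: eta_le => //; rewrite /E; lra.
have h3 : c <= E `^ (3 / 4) by apply: eta_le => //; rewrite /E; lra.
have -> : E `^ (- (3 / 2)) = (E `^ (3 / 4)) ^- 2.
  by rewrite powRN -(powR_mulrn 2 (powR_ge0 _ _)) -powRrM; congr (_ `^ _)^-1; field.
set s := _ + a + c.
have s0 : 0 < s by rewrite /s; lra.
have q0 : 0 < E `^ (3 / 4) by exact: powR_gt0.
have sE : s <= 3 * E `^ (3 / 4) by rewrite /s; lra.
rewrite -div1r ler_pdivrMr ?exprn_gt0// mulrAC ler_pdivlMr ?exprn_gt0// mul1r.
rewrite (_ : 9 * _ = (3 * E `^ (3 / 4)) ^+ 2); last by ring.
by apply: lerXn2r => //; rewrite nnegrE ?(ltW s0)// mulr_ge0// ltW.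
Qed.

Lemma mul_powR_m32_le eps b : 0 < eps -> 0 < b ->
  b * (eps + b `^ (4 / 3)) `^ (- (3 / 2)) <= 2 * (eps `^ (3 / 4) + b)^-1.
Proof.
move=> e0 b0; set E := _ + _.
have pb : 0 <= b `^ (4 / 3) by exact: powR_ge0.
have E0 : 0 < E by rewrite /E; lra.
have e1 : 0 < eps `^ (3 / 4) by exact: powR_gt0.
have h1 : eps `^ (3 / 4) <= E `^ (3 / 4).
  by apply: ge0_ler_powR; rewrite ?nnegrE ?(ltW e0) ?(ltW E0)// /E; lra.
have h3 : b <= E `^ (3 / 4) by apply: eta_le; rewrite ?(ltW b0)// /E; lra.
have q0 : 0 < E `^ (3 / 4) by exact: powR_gt0.
have -> : E `^ (- (3 / 2)) = (E `^ (3 / 4))^-1 * (E `^ (3 / 4))^-1.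
  rewrite -invfM powRN -powRD ?(gt_eqF E0) ?implybT//.
  by congr (_ `^ _)^-1; field.
set q := E `^ (3 / 4) in h1 h3 q0 *.
apply: (@le_trans _ _ q^-1).
  by rewrite mulrA ler_piMl ?invr_ge0 ?(ltW q0)// ler_pdivrMr// mul1r.
rewrite -div1r ler_pdivrMr// mulrAC ler_pdivlMr; last lra.
lra.
Qed.

Lemma ler_sq (x y : R) : 0 <= x -> 0 <= y -> x ^+ 2 <= y ^+ 2 -> x <= y.
Proof. by move=> x0 y0; rewrite ler_pXn2r ?nnegrE. Qed.

Lemma common_le al be ga p q o : 0 <= al -> 0 <= be -> 0 <= ga ->
  0 <= p -> 0 <= q -> 0 <= o ->
  p ^+ 2 <= al * be -> q ^+ 2 <= be * ga -> o ^+ 2 <= ga * al ->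
  al + ga <= be -> be + p + q + o <= 3 * be.
Proof.
move=> a0 b0 g0 p0 q0 o0 pp qq oo agb.
have h1 : p + q <= 3 / 2 * be.
  apply: ler_sq; [lra|lra|].
  have : be * (al + ga) <= be * be by rewrite ler_wpM2l.
  have := sqr_ge0 (p - q); have := sqr_ge0 be.
  rewrite !expr2 in pp qq *; lra.
have h2 : o <= 1 / 2 * be.
  apply: (@le_trans _ _ (1 / 2 * (al + ga))); last lra.
  apply: ler_sq; [lra|lra|].
  have := sqr_ge0 (al - ga); rewrite !expr2 in oo *; lra.
lra.
Qed.

Lemma overlap_core eps al be ga p q o : 0 < eps -> 0 < al -> 0 < be -> 0 < ga ->
  0 <= p -> 0 <= q -> 0 <= o ->
  p ^+ 2 <= al * be -> q ^+ 2 <= be * ga -> o ^+ 2 <= ga * al ->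
  1 / 16 * (al * be + be * ga + ga * al) <=
    (al + be + 2 * p) * (be + ga + 2 * q) - (be + p + q + o) ^+ 2 ->
  let K := moment_kernel (eps + (al + be + 2 * p)) (eps + (be + ga + 2 * q)) (be + p + q + o) in
  K <= 4 * det_const * (al * be * ga) `^ (- (2 / 3)) \/
  al + ga <= be /\ K <= 3 * det_const * (be `^ (- (1 / 2)) * (eps + al + ga) `^ (- (3 / 2))).
Proof.
move=> e0 a0 b0 g0 p0 q0 o0 pp qq oo det /=.
have m0 : 0 <= be + p + q + o by lra.
have AB : 0 < al * be by exact: mulr_gt0.
have BG : 0 < be * ga by exact: mulr_gt0.
have GA : 0 < ga * al by exact: mulr_gt0.
have EP : 0 <= eps * (p + q) by rewrite mulr_ge0 ?(ltW e0) ?addr_ge0.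
have EA : 0 < eps * al by exact: mulr_gt0.
have EB : 0 < eps * be by exact: mulr_gt0.
have EG : 0 < eps * ga by exact: mulr_gt0.
have deteps : 1 / 16 * (al * be + be * ga + ga * al) + (eps * al + 2 * (eps * be) + eps * ga)
    <= (eps + (al + be + 2 * p)) * (eps + (be + ga + 2 * q)) - (be + p + q + o) ^+ 2.
  rewrite (_ : (eps + _) * _ = eps ^+ 2 + (eps * al + 2 * (eps * be) + eps * ga)
    + 2 * (eps * (p + q)) + (al + be + 2 * p) * (be + ga + 2 * q)); last by ring.
  move: det EP (sqr_ge0 eps); clear; lra.
have [agb|bag] := leP (al + ga) be.
- right; split => //; apply: ker_le_common; rewrite ?(ltW a0) ?(ltW g0)//.
  + by rewrite m0/=; exact: common_le (ltW a0) (ltW b0) (ltW g0) _ _ _ pp qq oo agb.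
  + apply: le_trans deteps; lra.
- left; apply: ker_le_product => //.
  + have h1 : be ^+ 2 <= al * be + be * ga.
      by rewrite expr2 [al * be]mulrC -mulrDr ler_wpM2l ?(ltW b0)// ltW.
    have := sqr_ge0 (be - p); have := sqr_ge0 (be - q); have := sqr_ge0 (be - o).
    have := sqr_ge0 (p - q); have := sqr_ge0 (p - o); have := sqr_ge0 (q - o).
    rewrite !expr2 in h1 pp qq oo *; lra.
  + apply: le_trans deteps; lra.
Qed.

Lemma nested_core eps al be ga p q o : 0 < eps -> 0 <= al -> 0 < be -> 0 <= ga ->
  0 <= p -> 0 <= q -> 0 <= o ->
  p ^+ 2 <= al * be -> q ^+ 2 <= be * ga -> al + ga <= be ->
  7 / 10 * (be * (al + ga)) <=
    (al + be + ga + 2 * p + 2 * q + 2 * o) * be - (be + p + q) ^+ 2 ->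
  moment_kernel (eps + (al + be + ga + 2 * p + 2 * q + 2 * o)) (eps + be) (be + p + q) <=
  3 * det_const * (be `^ (- (1 / 2)) * (eps + al + ga) `^ (- (3 / 2))).
Proof.
move=> e0 a0 b0 g0 p0 q0 o0 pp qq agb det.
have z0 : 0 ^+ 2 <= ga * al by rewrite expr0n/= mulr_ge0.
have := common_le a0 (ltW b0) g0 p0 q0 (lexx 0) pp qq z0 agb.
rewrite addr0 => mb.
have EB : 0 <= eps * (be + al + ga + 2 * p + 2 * q + 2 * o) by rewrite mulr_ge0 ?(ltW e0)//; lra.
have B1 : 0 <= be * (al + ga) by rewrite mulr_ge0 ?(ltW b0)//; lra.
have B2 : 0 <= eps * be by rewrite mulr_ge0 ?(ltW b0) ?(ltW e0).
apply: ker_le_common => //; [by apply/andP; split; lra|].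
rewrite (_ : (eps + _) * _ = eps ^+ 2 + eps * be + eps * (be + al + ga + 2 * p + 2 * q + 2 * o)
    - eps * be + eps * be + (al + be + ga + 2 * p + 2 * q + 2 * o) * be); last by ring.
rewrite (_ : be * (eps + al + ga) = eps * be + be * (al + ga)); last by ring.
move: det EB B1 B2 (sqr_ge0 eps); clear; lra.
Qed.

Lemma sq_le p s : 0 <= p -> p <= s -> p ^+ 2 <= s ^+ 2.
Proof. by move=> p0 ps; apply: lerXn2r; rewrite ?nnegrE// (le_trans p0). Qed.

Lemma kernel_constE : 3 * det_const * 9 = kernel_const. Proof. by rewrite /kernel_const; ring. Qed.

Lemma common_bound eps b a c : 0 < eps -> 0 < a -> 0 < b -> 0 < c ->
  3 * det_const * ((b `^ (4 / 3)) `^ (- (1 / 2)) * (eps + a `^ (4 / 3) + c `^ (4 / 3)) `^ (- (3 / 2))) <=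
  kernel_const * (b `^ (- (2 / 3)) * (eps `^ (3 / 4) + a + c) ^- 2).
Proof.
move=> e0 a0 b0 c0.
have -> : (b `^ (4 / 3)) `^ (- (1 / 2)) = b `^ (- (2 / 3)).
  by rewrite -powRrM; congr (_ `^ _); field.
have k3 : 0 <= 3 * det_const by move: det_const_ge1; lra.
rewrite -kernel_constE -[leRHS]mulrA ler_wpM2l// [leRHS]mulrCA ler_wpM2l ?powR_ge0//.
exact: powR_m32_le e0 (ltW a0) (ltW c0).
Qed.

(** Lengths a + b and b + c with common part b. Either the common part is the
    longest gap ([ker_le_common]), or the square of the covariance is controlled
    by the products of pairs of gaps ([ker_le_product]). *)
Lemma gap_overlap eps a b c : 0 < eps -> 0 < a -> 0 < b -> 0 < c ->
  let m := 2^-1 * ((a + b + c) `^ (4 / 3) + b `^ (4 / 3) - a `^ (4 / 3) - c `^ (4 / 3)) in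
  let K := moment_kernel (eps + (a + b) `^ (4 / 3)) (eps + (b + c) `^ (4 / 3)) m in
  0 <= m /\
  (K <= kernel_const * (a * b * c) `^ (- (8 / 9)) \/
   [/\ a <= b, c <= b & K <= kernel_const * (b `^ (- (2 / 3)) * (eps `^ (3 / 4) + a + c) ^- 2)]).
Proof.
move=> e0 a0 b0 c0 /=.
have cb := common_bound e0 a0 b0 c0.
have [x [_ ax x4 /(_ a0) x0]] := cube_root (ltW a0).
have [y [_ by_ y4 /(_ b0) y0]] := cube_root (ltW b0).
have [z [_ cz z4 /(_ c0) z0]] := cube_root (ltW c0).
have [u [u0 au u4 _]] := cube_root (ltW (addr_gt0 a0 b0)).
have [v [v0 bv v4 _]] := cube_root (ltW (addr_gt0 b0 c0)).
have [S [S0 aS S4 _]] := cube_root (ltW (addr_gt0 (addr_gt0 a0 b0) c0)).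
have eu : u ^+ 3 = x ^+ 3 + y ^+ 3 by rewrite -au ax by_.
have ev : v ^+ 3 = y ^+ 3 + z ^+ 3 by rewrite -bv by_ cz.
have eS : S ^+ 3 = x ^+ 3 + y ^+ 3 + z ^+ 3 by rewrite -aS ax by_ cz.
have eS' : S ^+ 3 = u ^+ 3 + z ^+ 3 by rewrite eu.
have [] := second_difference (ltW x0) (ltW y0) (ltW z0) u0 v0 S0 eu ev eS.
have p0 := superadd4 (ltW x0) (ltW y0) u0 eu.
have p1 := adjacent_upper (ltW x0) (ltW y0) u0 eu.
have q0 := superadd4 (ltW y0) (ltW z0) v0 ev.
have q1 := adjacent_upper (ltW y0) (ltW z0) v0 ev.
have s1 := adjacent_upper u0 (ltW z0) S0 eS'.
rewrite x4 y4 z4 u4 v4 S4; rewrite x4 y4 z4 in cb.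
have X2 : 0 < x ^+ 2 by rewrite exprn_gt0.
have Y2 : 0 < y ^+ 2 by rewrite exprn_gt0.
have Z2 : 0 < z ^+ 2 by rewrite exprn_gt0.
have XY : 0 < x ^+ 2 * y ^+ 2 by exact: mulr_gt0.
have YZ : 0 < y ^+ 2 * z ^+ 2 by exact: mulr_gt0.
have XZ : 0 < x ^+ 2 * z ^+ 2 by exact: mulr_gt0.
have [p pe] : exists p, p = 2^-1 * (u ^+ 4 - x ^+ 4 - y ^+ 4) by eexists.
have [q qe] : exists q, q = 2^-1 * (v ^+ 4 - y ^+ 4 - z ^+ 4) by eexists.
have [ o oe] : exists o, o = 2^-1 * (S ^+ 4 + y ^+ 4 - u ^+ 4 - v ^+ 4) by eexists.
rewrite -oe => o0 o1 o2.
have pp : 0 <= p by move: p0; clear -pe; move: pe => ->; lra.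
have qq : 0 <= q by move: q0; clear -qe; move: qe => ->; lra.
have pl : p <= 3 / 8 * (x ^+ 2 * y ^+ 2) by move: p1; clear -pe; move: pe => ->; lra.
have ql : q <= 3 / 8 * (y ^+ 2 * z ^+ 2) by move: q1; clear -qe; move: qe => ->; lra.
have qo : q + o <= 3 / 8 * (u ^+ 2 * z ^+ 2) by move: s1; clear -qe oe; move: qe oe => -> ->; lra.
have -> : 2^-1 * (S ^+ 4 + y ^+ 4 - x ^+ 4 - z ^+ 4) = y ^+ 4 + p + q + o.
  by rewrite pe qe oe; field.
have ue : u ^+ 4 = x ^+ 4 + y ^+ 4 + 2 * p by rewrite pe; field.
have ve : v ^+ 4 = y ^+ 4 + z ^+ 4 + 2 * q by rewrite qe; field.
have m2 : (q + o) ^+ 2 <= 9 / 64 * ((x ^+ 4 + y ^+ 4 + 2 * p) * z ^+ 4).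
  rewrite -ue (_ : 9 / 64 * _ = (3 / 8 * (u ^+ 2 * z ^+ 2)) ^+ 2); last by field.
  by apply: sq_le => //; rewrite addr_ge0.
have det := gram_overlap (ltW x0) (ltW y0) (ltW z0) (introT andP (conj pp pl)) qq o0 o1 o2 m2.
have pX : p ^+ 2 <= x ^+ 4 * y ^+ 4.
  rewrite (_ : _ * _ = (x ^+ 2 * y ^+ 2) ^+ 2); last by ring.
  by apply: sq_le => //; move: pl XY; clear; lra.
have qX : q ^+ 2 <= y ^+ 4 * z ^+ 4.
  rewrite (_ : _ * _ = (y ^+ 2 * z ^+ 2) ^+ 2); last by ring.
  by apply: sq_le => //; move: ql YZ; clear; lra.
have oX : o ^+ 2 <= z ^+ 4 * x ^+ 4.
  rewrite (_ : _ * _ = (x ^+ 2 * z ^+ 2) ^+ 2); last by ring.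
  by apply: sq_le => //; move: o1 XZ; clear; lra.
have X4 : 0 < x ^+ 4 by rewrite exprn_gt0.
have Y4 : 0 < y ^+ 4 by rewrite exprn_gt0.
have Z4 : 0 < z ^+ 4 by rewrite exprn_gt0.
split; first by rewrite !addr_ge0// ltW.
rewrite ue ve.
case: (overlap_core e0 X4 Y4 Z4 pp qq o0 pX qX oX det) => [H|[agb H]].
- left; apply: (le_trans H).
  have -> : (x ^+ 4 * y ^+ 4 * z ^+ 4) `^ (- (2 / 3)) = (a * b * c) `^ (- (8 / 9)).
    have xyz : 0 <= x * y * z by rewrite !mulr_ge0 ?(ltW x0) ?(ltW y0) ?(ltW z0).
    rewrite ax by_ cz -!exprMn -(powR_mulrn 4 xyz) -(powR_mulrn 3 xyz) -!powRrM.
    by congr (_ `^ _); field.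
  by rewrite ler_wpM2r ?powR_ge0// /kernel_const; move: det_const_ge1; clear; lra.
- right.
  have ler4 w : 0 < w -> w ^+ 4 <= y ^+ 4 -> w <= y.
    by move=> w0; rewrite ler_pXn2r ?nnegrE ?(ltW y0) ?(ltW w0).
  split; last exact: le_trans H cb.
  + rewrite ax by_ lerXn2r ?nnegrE ?(ltW x0) ?(ltW y0)//.
    by apply: ler4 => //; move: agb Z4; clear; lra.
  + rewrite cz by_ lerXn2r ?nnegrE ?(ltW z0) ?(ltW y0)//.
    by apply: ler4 => //; move: agb X4; clear; lra.
Qed.

(** An interval of length b inside one of length a + b + c. Either it is the
    longest gap ([ker_le_common]), or [ker_le_nested] applies. *)
Lemma gap_nested eps a b c : 0 < eps -> 0 < a -> 0 < b -> 0 < c ->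
  let m := 2^-1 * ((a + b) `^ (4 / 3) + (b + c) `^ (4 / 3) - a `^ (4 / 3) - c `^ (4 / 3)) in
  let K := moment_kernel (eps + (a + b + c) `^ (4 / 3)) (eps + b `^ (4 / 3)) m in
  0 <= m /\
  (K <= kernel_const * ((a + b + c) `^ (- (5 / 3)) * (eps `^ (3 / 4) + b)^-1) \/
   [/\ a <= b, c <= b & K <= kernel_const * (b `^ (- (2 / 3)) * (eps `^ (3 / 4) + a + c) ^- 2)]).
Proof.
move=> e0 a0 b0 c0 /=.
have cb := common_bound e0 a0 b0 c0.
have mb := mul_powR_m32_le e0 b0.
have [x [_ ax x4 /(_ a0) x0]] := cube_root (ltW a0).
have [y [_ by_ y4 /(_ b0) y0]] := cube_root (ltW b0).
have [z [_ cz z4 /(_ c0) z0]] := cube_root (ltW c0).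
have [u [u0 au u4 _]] := cube_root (ltW (addr_gt0 a0 b0)).
have [v [v0 bv v4 _]] := cube_root (ltW (addr_gt0 b0 c0)).
have abc := addr_gt0 (addr_gt0 a0 b0) c0.
have [S [_ aS S4 /(_ abc) S0]] := cube_root (ltW abc).
have eu : u ^+ 3 = x ^+ 3 + y ^+ 3 by rewrite -au ax by_.
have ev : v ^+ 3 = y ^+ 3 + z ^+ 3 by rewrite -bv by_ cz.
have eS : S ^+ 3 = x ^+ 3 + y ^+ 3 + z ^+ 3 by rewrite -aS ax by_ cz.
have [] := second_difference (ltW x0) (ltW y0) (ltW z0) u0 v0 (ltW S0) eu ev eS.
have p0 := superadd4 (ltW x0) (ltW y0) u0 eu.
have p1 := adjacent_upper (ltW x0) (ltW y0) u0 eu.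
have q0 := superadd4 (ltW y0) (ltW z0) v0 ev.
have q1 := adjacent_upper (ltW y0) (ltW z0) v0 ev.
have X3 : 0 < x ^+ 3 by rewrite exprn_gt0.
have Y3 : 0 < y ^+ 3 by rewrite exprn_gt0.
have Z3 : 0 < z ^+ 3 by rewrite exprn_gt0.
have xu : x <= u by apply: ler_cube => //; move: eu Y3; clear; lra.
have zv : z <= v by apply: ler_cube => //; move: ev Y3; clear; lra.
have uS : u <= S by apply: ler_cube; rewrite ?(ltW S0)//; move: eu eS Z3; clear; lra.
have vS : v <= S by apply: ler_cube; rewrite ?(ltW S0)//; move: ev eS X3; clear; lra.
have s1 := slope_upper (ltW x0) xu; have s2 := slope_upper (ltW z0) zv.
rewrite (_ : u ^+ 3 - x ^+ 3 = y ^+ 3) in s1; last by rewrite eu; ring.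
rewrite (_ : v ^+ 3 - z ^+ 3 = y ^+ 3) in s2; last by rewrite ev; ring.
have s1' : u * y ^+ 3 <= S * y ^+ 3 by rewrite ler_wpM2r// ltW.
have s2' : v * y ^+ 3 <= S * y ^+ 3 by rewrite ler_wpM2r// ltW.
rewrite x4 y4 z4 u4 v4 S4; rewrite x4 y4 z4 in cb; rewrite y4 in mb.
have X2 : 0 < x ^+ 2 by rewrite exprn_gt0.
have Y2 : 0 < y ^+ 2 by rewrite exprn_gt0.
have Z2 : 0 < z ^+ 2 by rewrite exprn_gt0.
have XY : 0 < x ^+ 2 * y ^+ 2 by exact: mulr_gt0.
have YZ : 0 < y ^+ 2 * z ^+ 2 by exact: mulr_gt0.
have [p pe] : exists p, p = 2^-1 * (u ^+ 4 - x ^+ 4 - y ^+ 4) by eexists.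
have [q qe] : exists q, q = 2^-1 * (v ^+ 4 - y ^+ 4 - z ^+ 4) by eexists.
have [ o oe] : exists o, o = 2^-1 * (S ^+ 4 + y ^+ 4 - u ^+ 4 - v ^+ 4) by eexists.
rewrite -oe => o0 o1 _.
have pp : 0 <= p by move: p0; clear -pe; move: pe => ->; lra.
have qq : 0 <= q by move: q0; clear -qe; move: qe => ->; lra.
have pl : p <= 3 / 8 * (x ^+ 2 * y ^+ 2) by move: p1; clear -pe; move: pe => ->; lra.
have ql : q <= 3 / 8 * (y ^+ 2 * z ^+ 2) by move: q1; clear -qe; move: qe => ->; lra.
have me : 2^-1 * (u ^+ 4 + v ^+ 4 - x ^+ 4 - z ^+ 4) = y ^+ 4 + p + q.
  by rewrite pe qe; field.
have mS : y ^+ 4 + p + q <= 3 * (y ^+ 3 * S).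
  rewrite -me; have : 0 < S * y ^+ 3 by exact: mulr_gt0.
  move: s1 s2 s1' s2'; clear; lra.
rewrite me.
have Se : S ^+ 4 = x ^+ 4 + y ^+ 4 + z ^+ 4 + 2 * p + 2 * q + 2 * o by rewrite pe qe oe; field.
have det := gram_nested (ltW x0) (ltW y0) (ltW z0) (introT andP (conj pp pl)) (introT andP (conj qq ql)) o0.
have pX : p ^+ 2 <= x ^+ 4 * y ^+ 4.
  rewrite (_ : _ * _ = (x ^+ 2 * y ^+ 2) ^+ 2); last by ring.
  by apply: sq_le => //; move: pl XY; clear; lra.
have qX : q ^+ 2 <= y ^+ 4 * z ^+ 4.
  rewrite (_ : _ * _ = (y ^+ 2 * z ^+ 2) ^+ 2); last by ring.
  by apply: sq_le => //; move: ql YZ; clear; lra.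
have X4 : 0 < x ^+ 4 by rewrite exprn_gt0.
have Y4 : 0 < y ^+ 4 by rewrite exprn_gt0.
have Z4 : 0 < z ^+ 4 by rewrite exprn_gt0.
have m0 : 0 <= y ^+ 4 + p + q by rewrite !addr_ge0// ltW.
split => //.
have [agb|bag] := leP (x ^+ 4 + z ^+ 4) (y ^+ 4).
- right.
  have ler4 w : 0 < w -> w ^+ 4 <= y ^+ 4 -> w <= y.
    by move=> w0; rewrite ler_pXn2r ?nnegrE ?(ltW y0) ?(ltW w0).
  split.
  + rewrite ax by_ lerXn2r ?nnegrE ?(ltW x0) ?(ltW y0)//.
    by apply: ler4 => //; move: agb Z4; clear; lra.
  + rewrite cz by_ lerXn2r ?nnegrE ?(ltW z0) ?(ltW y0)//.
    by apply: ler4 => //; move: agb X4; clear; lra.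
  apply: le_trans cb; rewrite Se.
  exact: nested_core e0 (ltW X4) Y4 (ltW Z4) pp qq o0 pX qX agb det.
- left.
  have h1 : S ^+ 4 <= 6 * (x ^+ 4 + z ^+ 4).
    rewrite Se.
    have := sqr_ge0 (x ^+ 2 - y ^+ 2); have := sqr_ge0 (y ^+ 2 - z ^+ 2); have := sqr_ge0 (x ^+ 2 - z ^+ 2).
    have e a' b' : (a' ^+ 2 - b' ^+ 2) ^+ 2 = a' ^+ 4 + b' ^+ 4 - 2 * (a' ^+ 2 * b' ^+ 2) :> R by ring.
    rewrite !e; move: pl ql o1 bag X4 Z4; clear; lra.
  have h2 : 6 / 100 * ((eps + y ^+ 4) * (x ^+ 4 + z ^+ 4)) <=
      (eps + S ^+ 4) * (eps + y ^+ 4) - (y ^+ 4 + p + q) ^+ 2.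
    rewrite (_ : (eps + S ^+ 4) * _ = eps ^+ 2 + eps * (y ^+ 4 + S ^+ 4) + S ^+ 4 * y ^+ 4); last by ring.
    have h3 : eps * (x ^+ 4 + z ^+ 4) <= eps * (y ^+ 4 + S ^+ 4).
      by rewrite ler_wpM2l ?(ltW e0)// Se; move: Y4 pp qq o0; clear; lra.
    have h4 : 0 <= eps * (x ^+ 4 + z ^+ 4) by rewrite mulr_ge0 ?addr_ge0 ?(ltW e0) ?(ltW X4) ?(ltW Z4).
    have h5 : 0 <= y ^+ 4 * (x ^+ 4 + z ^+ 4) by rewrite mulr_ge0 ?addr_ge0 ?(ltW Y4) ?(ltW X4) ?(ltW Z4).
    rewrite -Se in det; rewrite [(eps + _) * (x ^+ 4 + _)]mulrDl [6 / 100 * _]mulrDr.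
    move: det h3 h4 h5 (sqr_ge0 eps); clear.
    lra.
  apply: le_trans (ker_le_nested _ e0 y0 S0 h1 _ h2) _; first by clear; lra.
    by rewrite m0.
  have S5 : (a + b + c) `^ (- (5 / 3)) = S `^ (- 5).
    by rewrite aS -(powR_mulrn 3 (ltW S0)) -powRrM; congr (_ `^ _); field.
  have -> : (6 / 100 / 6) `^ (- (3 / 2)) = det_const by rewrite /det_const; congr (_ `^ _); field.
  rewrite S5 -by_ mulrC [kernel_const * _]mulrC (mulrC (S `^ _)) -!mulrA.
  apply: (@le_trans _ _ (2 * (eps `^ (3 / 4) + b)^-1 * (S `^ (- 5) * (3 * det_const)))).
    by rewrite mulrA ler_wpM2r// !mulr_ge0 ?powR_ge0//; move: det_const_ge1; clear; lra.
  have E0 : 0 < (eps `^ (3 / 4) + b)^-1 by rewrite invr_gt0 addr_gt0// powR_gt0.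
  rewrite -mulrA mulrCA ler_wpM2l ?(ltW E0)// mulrCA ler_wpM2l ?powR_ge0//.
  by rewrite -kernel_constE; move: det_const_ge1; clear; lra.
Qed.
End gaps.

(** * A majorant in terms of distances *)

Section majorant.
Context {R : realType}.
Implicit Types a b c eps eta r s : R.

Definition incr_var (x : R) : R := `|x| `^ (4 / 3).

(** The covariance of B_s - B_r with B_s' - B_r'. *)
Definition incr_cov r s r' s' : R :=
  2^-1 * (incr_var (s' - r) + incr_var (r' - s) - incr_var (s' - s) - incr_var (r' - r)).

Lemma second_difference_ge0 a b c : 0 <= a -> 0 <= b -> 0 <= c ->
  (a + b) `^ (4 / 3) + (b + c) `^ (4 / 3) <= (a + b + c) `^ (4 / 3) + b `^ (4 / 3).
Proof.
move=> a0 b0 c0.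
have [x [x0 ax _ _]] := cube_root a0.
have [y [y0 by_ -> _]] := cube_root b0.
have [z [z0 cz _ _]] := cube_root c0.
have [u [u0 au -> _]] := cube_root (addr_ge0 a0 b0).
have [v [v0 bv -> _]] := cube_root (addr_ge0 b0 c0).
have [S [S0 aS -> _]] := cube_root (addr_ge0 (addr_ge0 a0 b0) c0).
have [] := @second_difference _ x y z u v S x0 y0 z0 u0 v0 S0; [by rewrite -au ax by_|by rewrite -bv by_ cz|by rewrite -aS ax by_ cz|].
by move=> /= o0 _ _; move: o0; clear; lra.
Qed.

Lemma incr_varE x : 0 <= x -> incr_var x = x `^ (4 / 3).
Proof. by move=> x0; rewrite /incr_var ger0_norm. Qed.

Lemma incr_varN x : incr_var (- x) = incr_var x.
Proof. by rewrite /incr_var normrN. Qed.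

Lemma incr_varB x y : incr_var (x - y) = incr_var (y - x).
Proof. by rewrite -incr_varN opprB. Qed.

Lemma ler_incr_var x y : 0 <= x -> x <= y -> incr_var x <= incr_var y.
Proof.
move=> x0 xy; rewrite !incr_varE ?(le_trans x0 xy)//.
by apply: ge0_ler_powR => //; rewrite ?nnegrE ?(le_trans x0 xy)//.
Qed.

(** Positive correlation of the increments, in its integrated form: the
    covariance of an increment with the path is a nondecreasing function of
    time. *)
Lemma incr_var_difference_homo r s y y' : r <= s -> y <= y' ->
  incr_var (y - r) - incr_var (y - s) <= incr_var (y' - r) - incr_var (y' - s).
Proof.
move=> rs; pose F y := incr_var (y - r) - incr_var (y - s).
have h1 x x' : x <= x' -> x' <= r -> F x <= F x'.
  move=> xx x'r; rewrite /F.
  have H := @second_difference_ge0 (x' - x) (r - x') (s - r).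
  have := H; rewrite -!incr_varE ?subr_ge0//; try lra.
  rewrite (_ : x' - x + (r - x') = r - x); last by ring.
  rewrite (_ : r - x' + (s - r) = s - x'); last by ring.
  rewrite (_ : r - x + (s - r) = s - x); last by ring.
  rewrite ![incr_var (_ - r)]incr_varB ![incr_var (_ - s)]incr_varB => /(_ xx x'r rs); lra.
have h2 x x' : r <= x -> x <= x' -> x' <= s -> F x <= F x'.
  move=> rx xx x's; rewrite /F ![incr_var (_ - s)]incr_varB.
  have := @ler_incr_var (x - r) (x' - r); have := @ler_incr_var (s - x') (s - x).
  rewrite !subr_ge0 => /(_ x's) H1 /(_ rx) H2.
  by rewrite lerB//; [apply: H2|apply: H1]; lra.
have h3 x x' : s <= x -> x <= x' -> F x <= F x'.
  move=> sx xx; rewrite /F.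
  have H := @second_difference_ge0 (x' - x) (x - s) (s - r).
  have := H; rewrite -!incr_varE ?subr_ge0//; try lra.
  rewrite (_ : x' - x + (x - s) = x' - s); last by ring.
  rewrite (_ : x - s + (s - r) = x - r); last by ring.
  rewrite (_ : x' - s + (s - r) = x' - r); last by ring.
  move=> /(_ xx sx rs); lra.
have h4 x x' : r <= x -> x <= x' -> F x <= F x'.
  move=> rx xx; have [x's|/ltW sx'] := leP x' s; first exact: h2.
  have [xs|/ltW sx] := leP x s; last exact: h3.
  by apply: (@le_trans _ _ (F s)); [exact: h2|exact: h3].
move=> yy.
have [y'r|/ltW ry'] := leP y' r; first exact: h1.
have [yr|/ltW ry] := leP y r; last exact: h4.
by apply: (@le_trans _ _ (F r)); [exact: h1|exact: h4].
Qed.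

Lemma incr_cov_ge0 r s r' s' : r <= s -> r' <= s' -> 0 <= incr_cov r s r' s'.
Proof.
by move=> rs rs'; have := incr_var_difference_homo rs rs'; rewrite /incr_cov; lra.
Qed.

(** The distances are u = |s - r|, v = |s' - r'|, rr = |r' - r|, rs = |r' - s|,
    sr = |s' - r| and ss = |s' - s|. The power -8/9 of the product of the three
    gaps is brought into a form in which s' only occurs in the last factor, r' in the last two,
    so that they can be integrated successively. *)
Definition maj_gaps (u v rr rs sr ss : R) : R :=
  u `^ (- (8 / 9)) * (rr `^ (- (8 / 9)) + rs `^ (- (8 / 9))) *
    (sr `^ (- (8 / 9)) + ss `^ (- (8 / 9)) + v `^ (- (8 / 9))).

(** Overlapping or nested intervals with a dominating common part. *)
Definition maj_common eta (u rr ss : R) : R := u `^ (- (2 / 3)) * (eta + rr + ss) ^- 2.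

(** The second interval inside the first one. *)
Definition maj_second_inside eta (u v rr : R) : R := u `^ (- (5 / 6)) * rr `^ (- (5 / 6)) * (eta + v)^-1.

(** The first interval inside the second one. *)
Definition maj_first_inside eta (u rr ss : R) : R := (eta + u)^-1 * rr `^ (- (5 / 6)) * ss `^ (- (5 / 6)).
Definition majorant eta (u v rr rs sr ss : R) : R :=
  maj_gaps u v rr rs sr ss + maj_common eta u rr ss + maj_second_inside eta u v rr + maj_first_inside eta u rr ss.

Lemma moment_kernelC (L Q m : R) : moment_kernel L Q m = moment_kernel Q L m.
Proof. by rewrite /moment_kernel mulrC [L * Q]mulrC mulrC. Qed.

Lemma first_chaos_kernelC (L Q m : R) : first_chaos_kernel L Q m = first_chaos_kernel Q L m.
Proof. by rewrite /first_chaos_kernel [_ `^ _ * _]mulrC. Qed.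

Lemma powRN_scale (C q x y : R) : 1 <= C -> 0 <= q <= 1 -> 0 < y -> y <= C * x ->
  x `^ (- q) <= C * y `^ (- q).
Proof.
move=> C1 /andP[q0 q1] y0 yx; have C0 : 0 < C by lra.
have x0 : 0 < x by rewrite -(pmulr_rgt0 _ C0); lra.
rewrite !powRN -div1r ler_pdivrMr ?powR_gt0// mulrAC ler_pdivlMr ?powR_gt0// mul1r.
apply: (@le_trans _ _ ((C * x) `^ q)).
  by apply: ge0_ler_powR => //; rewrite ?nnegrE ?mulr_ge0 ?(ltW y0) ?(ltW C0) ?(ltW x0).
rewrite powRM ?(ltW C0) ?(ltW x0)// ler_wpM2r ?powR_ge0//.
by rewrite -[leRHS](powRr1 (ltW C0)); apply: ler_powR.
Qed.

(** The larger of two adjacent gaps is comparable to their sum, which is again a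
    distance between two of the four times. *)
Lemma powRN_mul_le a b : 0 < a -> 0 < b ->
  (a * b) `^ (- (8 / 9)) <= 2 * ((a + b) `^ (- (8 / 9)) * (a `^ (- (8 / 9)) + b `^ (- (8 / 9)))).
Proof.
wlog ab : a b / a <= b.
  move=> H a0 b0; have [ab|/ltW ba] := leP a b; first exact: H.
  by rewrite mulrC [a + b]addrC [a `^ _ + _]addrC; apply: H.
move=> a0 b0; rewrite powRM ?(ltW a0) ?(ltW b0)// mulrC mulrA.
have h : b `^ (- (8 / 9)) <= 2 * (a + b) `^ (- (8 / 9)).
  by apply: powRN_scale; [lra|apply/andP; split; lra|exact: addr_gt0|lra].
apply: (le_trans (ler_wpM2r (powR_ge0 _ _) h)).
by rewrite ler_wpM2l ?mulr_ge0 ?powR_ge0// lerDl powR_ge0.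
Qed.

Lemma maj_ge0 eta (u v rr rs sr ss : R) : 0 < eta -> 0 <= u -> 0 <= v ->
  [/\ 0 <= maj_gaps u v rr rs sr ss, 0 <= maj_common eta u rr ss, 0 <= maj_second_inside eta u v rr &
      0 <= maj_first_inside eta u rr ss].
Proof.
move=> e0 u0 v0; split.
- by rewrite !mulr_ge0 ?addr_ge0 ?powR_ge0.
- by rewrite mulr_ge0 ?powR_ge0// invr_ge0 sqr_ge0.
- by rewrite !mulr_ge0 ?powR_ge0// invr_ge0 addr_ge0// ltW.
- by rewrite !mulr_ge0 ?powR_ge0// invr_ge0 addr_ge0// ltW.
Qed.

Lemma majorant_ge0 eta (u v rr rs sr ss : R) : 0 < eta -> 0 <= u -> 0 <= v ->
  0 <= majorant eta u v rr rs sr ss.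
Proof.
by move=> e0 u0 v0; have [h1 h2 h3 h4] := maj_ge0 rr rs sr ss e0 u0 v0; rewrite !addr_ge0.
Qed.

Lemma maj_le eta (u v rr rs sr ss : R) : 0 < eta -> 0 <= u -> 0 <= v ->
  let M := majorant eta u v rr rs sr ss in
  [/\ maj_gaps u v rr rs sr ss <= M, maj_common eta u rr ss <= M, maj_second_inside eta u v rr <= M &
      maj_first_inside eta u rr ss <= M].
Proof.
move=> e0 u0 v0; have [] := maj_ge0 rr rs sr ss e0 u0 v0; rewrite /majorant.
by move: (maj_gaps _ _ _ _ _ _) (maj_common _ _ _ _) (maj_second_inside _ _ _ _) (maj_first_inside _ _ _ _); clear => *; split; lra.
Qed.

Let q8 (a : R) := a `^ (- (8 / 9)).

Let q8_ge0 a : 0 <= q8 a. Proof. exact: powR_ge0. Qed.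

Let q8M a b c : 0 < a -> 0 < b -> 0 < c ->
  (a * b * c) `^ (- (8 / 9)) = q8 a * q8 b * q8 c.
Proof. by move=> a0 b0 c0; rewrite !powRM ?mulr_ge0 ?(ltW a0) ?(ltW b0) ?(ltW c0). Qed.

Let maj_gaps_le2 a b c d u v rr rs sr ss : 0 <= c -> a * b <= 2 * (d * (a + b)) ->
  d * (a + b) * c <= maj_gaps u v rr rs sr ss ->
  a * b * c <= 2 * maj_gaps u v rr rs sr ss.
Proof.
move=> c0 h h'; apply: (le_trans (ler_wpM2r c0 h)).
by rewrite -mulrA ler_pM2l.
Qed.

Lemma product_disjoint a b c : 0 < a -> 0 < b -> 0 < c ->
  (a * b * c) `^ (- (8 / 9)) <= maj_gaps a c (a + b) b (a + b + c) (b + c) /\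
  (a * b * c) `^ (- (8 / 9)) <= 2 * maj_gaps c a (a + b) (a + b + c) b (b + c).
Proof.
move=> a0 b0 c0; rewrite q8M//; split.
  rewrite /maj_gaps -!/(q8 _); apply: ler_pM; rewrite ?mulr_ge0//.
    by rewrite ler_wpM2l// lerDr.
  by rewrite lerDr addr_ge0.
have := powRN_mul_le a0 b0; rewrite powRM ?(ltW a0) ?(ltW b0)// -!/(q8 _) => h.
apply: maj_gaps_le2 h _ => //.
rewrite /maj_gaps -!/(q8 _) (mulrC (q8 c)) [leLHS]mulrAC; apply: ler_pM; rewrite ?mulr_ge0 ?addr_ge0//.
  by rewrite ler_wpM2r// lerDl.
by rewrite addrAC [leLHS]addrC lerDl.
Qed.

Lemma product_overlap a b c : 0 < a -> 0 < b -> 0 < c ->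
  (a * b * c) `^ (- (8 / 9)) <= 2 * maj_gaps (a + b) (b + c) a b (a + b + c) c /\
  (a * b * c) `^ (- (8 / 9)) <= 2 * maj_gaps (b + c) (a + b) a (a + b + c) b c.
Proof.
move=> a0 b0 c0; rewrite q8M//; split.
  have := powRN_mul_le a0 b0; rewrite powRM ?(ltW a0) ?(ltW b0)// -!/(q8 _) => h.
  apply: maj_gaps_le2 h _ => //.
  rewrite /maj_gaps -!/(q8 _); rewrite ler_wpM2l ?mulr_ge0 ?addr_ge0//.
  by rewrite addrAC lerDr addr_ge0.
have := powRN_mul_le b0 c0; rewrite powRM ?(ltW c0) ?(ltW b0)// -!/(q8 _) => h.
rewrite -mulrA mulrC; apply: maj_gaps_le2 h _ => //.
rewrite /maj_gaps -!/(q8 _) [leLHS]mulrAC; apply: ler_pM; rewrite ?mulr_ge0 ?addr_ge0//.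
  by rewrite ler_wpM2l// lerDl.
by rewrite lerDl.
Qed.

Lemma common_part eta a b c u : 0 < b -> 0 < u -> u <= 3 * b ->
  b `^ (- (2 / 3)) * (eta + a + c) ^- 2 <= 3 * maj_common eta u a c.
Proof.
move=> b0 u0 ub; rewrite /maj_common mulrA ler_wpM2r ?invr_ge0 ?sqr_ge0//.
by apply: powRN_scale => //; [lra|apply/andP; split; lra].
Qed.

Let five6 (u x y : R) : 0 < x -> x <= u -> 0 < y -> y <= u ->
  u `^ (- (5 / 3)) <= x `^ (- (5 / 6)) * y `^ (- (5 / 6)).
Proof.
move=> x0 xu y0 yu; have u0 := lt_le_trans x0 xu.
have -> : - (5 / 3) = - (5 / 6) + - (5 / 6) :> R by field.
rewrite powRD ?(gt_eqF u0) ?implybT//.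
by apply: ler_pM; rewrite ?powR_ge0//; apply: le_powRN.
Qed.

Lemma nested_part eta a b c : 0 < eta -> 0 < a -> 0 < b -> 0 < c ->
  (a + b + c) `^ (- (5 / 3)) * (eta + b)^-1 <= maj_second_inside eta (a + b + c) b a /\
  (a + b + c) `^ (- (5 / 3)) * (eta + b)^-1 <= maj_first_inside eta b a c.
Proof.
move=> e0 a0 b0 c0.
have E0 : 0 <= (eta + b)^-1 by rewrite invr_ge0; lra.
split.
  by rewrite /maj_second_inside ler_wpM2r//; apply: five6; lra.
by rewrite /maj_first_inside -mulrA [leRHS]mulrC ler_wpM2r//; apply: five6; lra.
Qed.

Let distE (x d : R) : 0 < d -> (x = d \/ x = - d) -> `|x| = d.
Proof. by move=> d0 [->|->]; rewrite ?normrN gtr0_norm. Qed.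

Lemma kernel_bound_gaps (C D K K1 X M : R) : 0 <= K1 -> 0 <= C ->
  K - K1 <= C * X \/ K <= C * X -> X <= D * M -> K <= K1 + D * C * M.
Proof.
move=> k0 c0 h1 h2; have h3 : C * X <= D * C * M.
  by rewrite [D * C]mulrC -mulrA ler_wpM2l.
by case: h1 => h1; lra.
Qed.

(** The six relative positions of two intervals are the three of the gap lemmas,
    up to the exchange of the two intervals. Coincidences of endpoints have to be
    excluded, since the negative powers of the majorant vanish at 0. *)
Lemma kernel_bound eps r s r' s' : 0 < eps -> r < s -> r' < s' ->
  r' != r -> r' != s -> s' != r -> s' != s ->
  moment_kernel (eps + incr_var (s - r)) (eps + incr_var (s' - r')) (incr_cov r s r' s') <=
  first_chaos_kernel (eps + incr_var (s - r)) (eps + incr_var (s' - r')) (incr_cov r s r' s') +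
  3 * kernel_const * majorant (eps `^ (3 / 4)) `|s - r| `|s' - r'| `|r' - r| `|r' - s| `|s' - r| `|s' - s|.
Proof.
move=> e0 rs rs' nrr nrs nsr nss.
have et0 : 0 < eps `^ (3 / 4) by exact: powR_gt0.
have [] := maj_le `|r' - r| `|r' - s| `|s' - r| `|s' - s| et0 (normr_ge0 (s - r)) (normr_ge0 (s' - r')).
have [] := maj_ge0 `|r' - r| `|r' - s| `|s' - r| `|s' - s| et0 (normr_ge0 (s - r)) (normr_ge0 (s' - r')).
set M := majorant _ _ _ _ _ _ _; move: M => M.
move=> m1 m2 m3 m4 M1 M2 M3 M4.
have k1 : 0 <= first_chaos_kernel (eps + incr_var (s - r)) (eps + incr_var (s' - r')) (incr_cov r s r' s').
  apply: mulr_ge0; last by rewrite mulr_ge0 ?powR_ge0.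
  by apply: incr_cov_ge0; exact: ltW.
have suf X := @kernel_bound_gaps kernel_const 3 (moment_kernel (eps + incr_var (s - r)) (eps + incr_var (s' - r')) (incr_cov r s r' s')) _ X M k1 (ltW (@kernel_const_gt0 R)).
have lt_of (x y : R) : x <= y -> x != y -> x < y by move=> xy nxy; rewrite lt_neqAle nxy.
move: m1 m2 m3 m4 M1 M2 M3 M4 suf; clear k1; rewrite /incr_cov /incr_var.
have [sr'|r's] := ltP s r'.
  (* r < s < r' < s' *)
  have [a ea] : exists a, a = s - r by eexists.
  have [b eb] : exists b, b = r' - s by eexists.
  have [c ec] : exists c, c = s' - r' by eexists.
  have a0 : 0 < a by lra.
  have b0 : 0 < b by lra.
  have c0 : 0 < c by lra.
  rewrite (@distE (s - r) (a))//; last by left; lra.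
  rewrite (@distE (r' - s) (b))//; last by left; lra.
  rewrite (@distE (s' - r') (c))//; last by left; lra.
  rewrite (@distE (r' - r) (a + b)) ?addr_gt0//; last by left; lra.
  rewrite (@distE (s' - s) (b + c)) ?addr_gt0//; last by left; lra.
  rewrite (@distE (s' - r) (a + b + c)) ?addr_gt0//; last by left; lra.
  move=> m1 _ _ _ M1 _ _ _ suf.
  have [_ h] := gap_disjoint e0 a0 b0 c0.
  have [h' _] := product_disjoint a0 b0 c0.
  move: suf; rewrite (_ : 2^-1 * _ = 2^-1 * ((a + b + c) `^ (4 / 3) + b `^ (4 / 3) - (a + b) `^ (4 / 3) - (b + c) `^ (4 / 3))); last by ring.
  by apply; [left; exact: h|lra].
have {r's}r's := lt_of _ _ r's nrs.
have [s'r|rs'_] := ltP s' r.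
  (* r' < s' < r < s *)
  have [a ea] : exists a, a = s' - r' by eexists.
  have [b eb] : exists b, b = r - s' by eexists.
  have [c ec] : exists c, c = s - r by eexists.
  have a0 : 0 < a by lra.
  have b0 : 0 < b by lra.
  have c0 : 0 < c by lra.
  rewrite (@distE (s - r) (c))//; last by left; lra.
  rewrite (@distE (r' - s) (a + b + c)) ?addr_gt0//; last by right; lra.
  rewrite (@distE (s' - r') (a))//; last by left; lra.
  rewrite (@distE (r' - r) (a + b)) ?addr_gt0//; last by right; lra.
  rewrite (@distE (s' - s) (b + c)) ?addr_gt0//; last by right; lra.
  rewrite (@distE (s' - r) (b))//; last by right; lra.
  move=> m1 _ _ _ M1 _ _ _ suf.
  have [_ h] := gap_disjoint e0 a0 b0 c0.
  have [_ h'] := product_disjoint a0 b0 c0.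
  move: suf; rewrite (_ : 2^-1 * _ = 2^-1 * ((a + b + c) `^ (4 / 3) + b `^ (4 / 3) - (a + b) `^ (4 / 3) - (b + c) `^ (4 / 3))); last by ring.
  by rewrite moment_kernelC first_chaos_kernelC; apply; [left; exact: h|lra].
have {rs'_}rs'_ : r < s' by apply: lt_of; rewrite // eq_sym.
have [rr'|r'r] := ltP r r'.
  have [ss'|s's] := ltP s s'.
  (* r < r' < s < s' *)
    have [a ea] : exists a, a = r' - r by eexists.
    have [b eb] : exists b, b = s - r' by eexists.
    have [c ec] : exists c, c = s' - s by eexists.
    have a0 : 0 < a by lra.
    have b0 : 0 < b by lra.
    have c0 : 0 < c by lra.
    rewrite (@distE (s - r) (a + b)) ?addr_gt0//; last by left; lra.
    rewrite (@distE (r' - s) (b))//; last by right; lra.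
    rewrite (@distE (s' - r') (b + c)) ?addr_gt0//; last by left; lra.
    rewrite (@distE (r' - r) (a))//; last by left; lra.
    rewrite (@distE (s' - s) (c))//; last by left; lra.
    rewrite (@distE (s' - r) (a + b + c)) ?addr_gt0//; last by left; lra.
    move=> m1 m2 _ _ M1 M2 _ _ suf.
    have [_ h] := gap_overlap e0 a0 b0 c0.
    have [h' _] := product_overlap a0 b0 c0.
    move: suf; rewrite (_ : 2^-1 * _ = 2^-1 * ((a + b + c) `^ (4 / 3) + b `^ (4 / 3) - a `^ (4 / 3) - c `^ (4 / 3))); last by ring.
    case: h => [h|[ab cb h]]; apply; [by right; exact: h|lra|by right; exact: h|].
    have ub : a + b <= 3 * b by lra.
    by have := @common_part (eps `^ (3 / 4)) a b c (a + b) b0 (addr_gt0 a0 b0) ub; lra.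
  have {s's}s's := lt_of _ _ s's nss.
  (* r < r' < s' < s *)
  have [a ea] : exists a, a = r' - r by eexists.
  have [b eb] : exists b, b = s' - r' by eexists.
  have [c ec] : exists c, c = s - s' by eexists.
  have a0 : 0 < a by lra.
  have b0 : 0 < b by lra.
  have c0 : 0 < c by lra.
  rewrite (@distE (s - r) (a + b + c)) ?addr_gt0//; last by left; lra.
  rewrite (@distE (r' - s) (b + c)) ?addr_gt0//; last by right; lra.
  rewrite (@distE (s' - r') (b))//; last by left; lra.
  rewrite (@distE (r' - r) (a))//; last by left; lra.
  rewrite (@distE (s' - s) (c))//; last by right; lra.
  rewrite (@distE (s' - r) (a + b)) ?addr_gt0//; last by left; lra.
  move=> _ m2 m3 _ _ M2 M3 _ suf.
  have [_ h] := gap_nested e0 a0 b0 c0.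
  have [h' _] := nested_part et0 a0 b0 c0.
  move: suf; rewrite (_ : 2^-1 * _ = 2^-1 * ((a + b) `^ (4 / 3) + (b + c) `^ (4 / 3) - a `^ (4 / 3) - c `^ (4 / 3))); last by ring.
  case: h => [h|[ab cb h]]; apply; [by right; exact: h|lra|by right; exact: h|].
  have ub : a + b + c <= 3 * b by lra.
  by have := @common_part (eps `^ (3 / 4)) a b c (a + b + c) b0 (addr_gt0 (addr_gt0 a0 b0) c0) ub; lra.
have {r'r}r'r := lt_of _ _ r'r nrr.
have [ss'|s's] := ltP s s'.
  (* r' < r < s < s' *)
  have [a ea] : exists a, a = r - r' by eexists.
  have [b eb] : exists b, b = s - r by eexists.
  have [c ec] : exists c, c = s' - s by eexists.
  have a0 : 0 < a by lra.
  have b0 : 0 < b by lra.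
  have c0 : 0 < c by lra.
  rewrite (@distE (s - r) (b))//; last by left; lra.
  rewrite (@distE (r' - s) (a + b)) ?addr_gt0//; last by right; lra.
  rewrite (@distE (s' - r') (a + b + c)) ?addr_gt0//; last by left; lra.
  rewrite (@distE (r' - r) (a))//; last by right; lra.
  rewrite (@distE (s' - s) (c))//; last by left; lra.
  rewrite (@distE (s' - r) (b + c)) ?addr_gt0//; last by left; lra.
  move=> _ m2 _ m4 _ M2 _ M4 suf.
  have [_ h] := gap_nested e0 a0 b0 c0.
  have [_ h'] := nested_part et0 a0 b0 c0.
  move: suf; rewrite (_ : 2^-1 * _ = 2^-1 * ((a + b) `^ (4 / 3) + (b + c) `^ (4 / 3) - a `^ (4 / 3) - c `^ (4 / 3))); last by ring.
  rewrite moment_kernelC first_chaos_kernelC.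
  case: h => [h|[ab cb h]]; apply; [by right; exact: h|lra|by right; exact: h|].
  have ub : b <= 3 * b by lra.
  by have := @common_part (eps `^ (3 / 4)) a b c b b0 b0 ub; lra.
have {s's}s's := lt_of _ _ s's nss.
(* r' < r < s' < s *)
have [a ea] : exists a, a = r - r' by eexists.
have [b eb] : exists b, b = s' - r by eexists.
have [c ec] : exists c, c = s - s' by eexists.
have a0 : 0 < a by lra.
have b0 : 0 < b by lra.
have c0 : 0 < c by lra.
rewrite (@distE (s - r) (b + c)) ?addr_gt0//; last by left; lra.
rewrite (@distE (r' - s) (a + b + c)) ?addr_gt0//; last by right; lra.
rewrite (@distE (s' - r') (a + b)) ?addr_gt0//; last by left; lra.
rewrite (@distE (r' - r) (a))//; last by right; lra.
rewrite (@distE (s' - s) (c))//; last by right; lra.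
rewrite (@distE (s' - r) (b))//; last by left; lra.
move=> m1 m2 _ _ M1 M2 _ _ suf.
have [_ h] := gap_overlap e0 a0 b0 c0.
have [_ h'] := product_overlap a0 b0 c0.
move: suf; rewrite (_ : 2^-1 * _ = 2^-1 * ((a + b + c) `^ (4 / 3) + b `^ (4 / 3) - a `^ (4 / 3) - c `^ (4 / 3))); last by ring.
rewrite moment_kernelC first_chaos_kernelC.
case: h => [h|[ab cb h]]; apply; [by right; exact: h|lra|by right; exact: h|].
have ub : b + c <= 3 * b by lra.
by have := @common_part (eps `^ (3 / 4)) a b c (b + c) b0 (addr_gt0 b0 c0) ub; lra.
Qed.
End majorant.

(** * Integration of the majorant *)

Section integral_bounds.
Context {R : realType}.
Notation mu := (@lebesgue_measure R).
Local Open Scope ereal_scope.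

(** The integral of a nonnegative function is a supremum over simple functions
    below it, hence monotone; this spares the measurability of partial
    integrals. *)
Lemma ge0_le_integral_nonmeasurable d (T : measurableType d) (m : {measure set T -> \bar R})
    (D D' : set T) (f g : T -> \bar R) : D `<=` D' ->
  (forall x, D x -> 0 <= f x) -> (forall x, D' x -> 0 <= g x) ->
  (forall x, D x -> f x <= g x) ->
  \int[m]_(x in D) f x <= \int[m]_(x in D') g x.
Proof.
move=> DD f0 g0 fg; rewrite integral_mkcond [leRHS]integral_mkcond.
have F0 x : 0 <= (f \_ D) x by exact: erestrict_ge0.
have G0 x : 0 <= (g \_ D') x by exact: erestrict_ge0.
rewrite !ge0_integralTE//; apply: le_ereal_sup => _ [h hf <-] /=.
exists h => //= x; apply: (le_trans (hf x)); rewrite !patchE.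
case: ifPn => [/set_mem Dx|_]; last exact: G0.
by rewrite mem_set; [exact: fg|exact: DD].
Qed.

Lemma le_of_eq_ereal (x y : \bar R) : x = y -> x <= y. Proof. by move->. Qed.

Lemma measurable_simplex2 (t : R) : measurable (simplex2 t : set (plane R)).
Proof.
have mset (f g : plane R -> R) : measurable_fun [set: plane R] f ->
   measurable_fun [set: plane R] g -> measurable [set p | f p < g p]%R.
  move=> mf mg; have := measurable_fun_ltr mf mg => /(_ measurableT [set true]).
  rewrite setTI (_ : _ @^-1` _ = [set p | f p < g p]%R); first exact.
  by apply/seteqP; split => p /=.
have m1 : measurable_fun [set: plane R] fst by exact: measurable_fst.
have m2 : measurable_fun [set: plane R] snd by exact: measurable_snd.
rewrite (_ : simplex2 t = [set p | 0%R < p.1]%R `&` ([set p | p.1 < p.2]%R `&` [set p | p.2 < t]%R)) //.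
by apply: measurableI; [|apply: measurableI]; apply: mset.
Qed.

Lemma simplex2_subset (t : R) p : simplex2 t p -> (0 < p.1 < t)%R /\ (0 < p.2 < t)%R.
Proof. by move=> -[a [b c]]; split; apply/andP; split; lra. Qed.

Lemma integral_simplex2_le (t : R) (f : R * R -> \bar R) :
  measurable_fun [set: plane R] f -> (forall p, 0 <= f p) ->
  \int[(mu \x mu)%E]_(p in simplex2 t) f p <=
  \int[mu]_(x in `]0%R, t[) \int[mu]_(y in `]0%R, t[) f (x, y).
Proof.
move=> mf f0; pose I := `]0%R, t[%classic : set (measurableTypeR R).
have mI : measurable I by exact: measurable_itv.
have mII : measurable (I `*` I) by exact: measurableX.
apply: (@le_trans _ _ (\int[(mu \x mu)%E]_(p in I `*` I) f p)).
  apply: ge0_le_integral_nonmeasurable => //= p /simplex2_subset[h1 h2].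
  by split; rewrite /I/= in_itv.
rewrite integral_mkcond fubini_tonelli1; last 2 first.
- exact/(measurable_restrictT _ _).1/measurable_funTS.
- exact: erestrict_ge0.
rewrite [leRHS]integral_mkcond; apply: ge0_le_integral_nonmeasurable => //.
- by move=> x _; apply: integral_ge0 => y _; exact: erestrict_ge0.
- by move=> x _; apply: erestrict_ge0 => y _; apply: integral_ge0.
move=> x _; rewrite patchE /fubini_F; case: ifPn => [xI|xI].
  rewrite [leRHS]integral_mkcond; apply: le_of_eq_ereal; apply: eq_integral => y _; rewrite !patchE.
  by rewrite in_setX xI.
by rewrite integral0_eq// => y _; rewrite patchE in_setX (negbTE xI).
Qed.

Lemma is_derive_translate (E x : R) : is_derive x (1%R:R) (fun x => E + x)%R 1%R.
Proof.
have := @is_deriveD _ _ _ (cst E) id x 1%R _ _ (is_derive_cst E x 1%R) (is_derive_id x 1%R).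
by rewrite add0r.
Qed.

Lemma ge0_integral_log (t eta : R) : (0 < t)%R -> (0 < eta)%R ->
  \int[mu]_(x in `]0%R, t[) ((eta + x)^-1)%:E = (ln (1 + t / eta))%:E.
Proof.
move=> t0 e0; pose F (x : R) := (ln (eta + x))%R.
have dF (x : R) : (0 <= x)%R -> is_derive x (1%R:R) F ((eta + x)^-1)%R.
  move=> x0; have ex : (0 < eta + x)%R by lra.
  have H := is_derive1_ln ex.
  have dE : is_derive x (1%R:R) (fun x => eta + x)%R 1%R.
    exact: is_derive_translate.
  have := @is_derive1_comp _ (@ln R) (fun x => eta + x)%R x _ _ H dE.
  by rewrite mulr1.
have cF (x : R) : (0 <= x)%R -> {for x, continuous F}.
  move=> x0; have H := dF _ x0.
  by apply: differentiable_continuous; apply/derivable1_diffP; exact: ex_derive.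
have -> : (ln (1 + t / eta) = F t - F 0)%R.
  rewrite /F addr0 -ln_div ?posrE//; last by lra.
  by rewrite mulrDl mulfV// gt_eqF.
apply: (@ge0_FTC_oo _ (fun x => (eta + x)^-1)%R F) => //.
- by move=> x /andP[x0 _]; rewrite invr_ge0; lra.
- move=> x /andP[x0 _]; apply: continuousV; first by rewrite gt_eqF//; lra.
  by apply: continuousD => //; exact: cst_continuous.
- by move=> x /andP[x0 _]; apply: dF; exact: ltW.
- by apply: cvg_at_right_filter; exact: cF.
- by apply: cvg_at_left_filter; apply: cF; exact: ltW.
Qed.

Lemma ge0_integral_inv2 (t E : R) : (0 < t)%R -> (0 < E)%R ->
  \int[mu]_(x in `]0%R, t[) ((E + x) ^- 2)%:E <= (E^-1)%:E.
Proof.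
move=> t0 e0; pose F (x : R) := (- (E + x)^-1)%R.
have dF (x : R) : (0 <= x)%R -> is_derive x (1%R:R) F ((E + x) ^- 2)%R.
  move=> x0; have ex : (E + x != 0)%R by rewrite gt_eqF//; lra.
  have dE : is_derive x (1%R:R) (fun x => E + x)%R 1%R.
    exact: is_derive_translate.
  have H := is_deriveN (is_deriveV ex dE).
  by rewrite /GRing.scale/= mulr1 opprK in H.
have cF (x : R) : (0 <= x)%R -> {for x, continuous F}.
  move=> x0; have H := dF _ x0.
  by apply: differentiable_continuous; apply/derivable1_diffP; exact: ex_derive.
apply: (@le_trans _ _ (F t - F 0)%:E); last first.
  by rewrite lee_fin /F addr0 opprK gerDr oppr_le0 invr_ge0; lra.
apply: le_of_eq_ereal; apply: (@ge0_FTC_oo _ (fun x => (E + x) ^- 2)%R F) => //.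
- by move=> x /andP[x0 _]; rewrite invr_ge0 sqr_ge0.
- move=> x /andP[x0 _]; apply: continuousV; first by rewrite gt_eqF// exprn_gt0//; lra.
  apply: (@continuous_comp _ _ _ (fun y => E + y)%R (fun y => y ^+ 2)%R); last exact: exprn_continuous.
  by apply: continuousD => //; exact: cst_continuous.
- by move=> x /andP[x0 _]; apply: dF; exact: ltW.
- by apply: cvg_at_right_filter; exact: cF.
- by apply: cvg_at_left_filter; apply: cF; exact: ltW.
Qed.

Lemma integral_dist_le (t y C : R) (h : R -> R) : (0 < y < t)%R ->
  measurable_fun [set: R] h -> (forall x, 0 <= h x)%R ->
  \int[mu]_(x in `]0%R, t[) (h x)%:E <= C%:E ->
  \int[mu]_(x in `]0%R, t[) (h `|x - y|)%:E <= (2 * C)%:E.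
Proof.
move=> yt mh h0 hC; apply: (le_trans (ge0_integral_dist_le yt mh h0)).
by rewrite EFinM lee_pmul2l.
Qed.

Lemma measurable_fun_powR d (T : measurableType d) (q : R) (f : T -> R) :
  measurable_fun [set: T] f -> measurable_fun [set: T] (fun x => f x `^ q)%R.
Proof. by move=> mf; exact: (measurableT_comp (f := fun y : R => y `^ q)%R). Qed.

Lemma ge0_measurable_funV d (T : measurableType d) (f : T -> R) :
  measurable_fun [set: T] f -> (forall x, 0 <= f x)%R -> measurable_fun [set: T] (fun x => (f x)^-1)%R.
Proof.
move=> mf f0; rewrite (_ : (fun x => _) = (fun x => f x `^ (-1)))%R.
  exact: measurable_fun_powR.
by apply/funext => x; rewrite powRN powRr1.
Qed.

(** These bounds are stable under sums, multiples and distances to a point, so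
    that a sum of products of distances is integrated in one variable by
    assembling them. *)
Definition int_bound (t : R) (f : R -> R) (C : R) : Prop :=
  [/\ measurable_fun [set: R] f, (forall x, 0 <= f x)%R &
      \int[mu]_(x in `]0%R, t[) (f x)%:E <= C%:E].

Lemma int_boundD t f g C D : int_bound t f C -> int_bound t g D ->
  int_bound t (fun x => f x + g x)%R (C + D).
Proof.
move=> [mf f0 fC] [mg g0 gD]; split; first exact: measurable_funD.
  by move=> x; rewrite addr_ge0.
under eq_integral do rewrite EFinD.
rewrite ge0_integralD//; first by rewrite EFinD leeD.
- by move=> x _; rewrite lee_fin.
- by apply/measurable_EFinP; exact: measurable_funTS.
- by move=> x _; rewrite lee_fin.
- by apply/measurable_EFinP; exact: measurable_funTS.
Qed.

Lemma int_boundZ t k f C : (0 <= k)%R -> int_bound t f C ->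
  int_bound t (fun x => k * f x)%R (k * C).
Proof.
move=> k0 [mf f0 fC]; split; first exact: measurable_funM.
  by move=> x; rewrite mulr_ge0.
under eq_integral do rewrite EFinM.
rewrite ge0_integralZl_EFin//; first by rewrite EFinM lee_wpmul2l// lee_fin.
- by move=> x _; rewrite lee_fin.
- by apply/measurable_EFinP; exact: measurable_funTS.
Qed.

Lemma int_bound_dist t y f C : (0 < y < t)%R -> int_bound t f C ->
  int_bound t (fun x => f `|x - y|)%R (2 * C).
Proof.
move=> yt [mf f0 fC]; split => //; last exact: integral_dist_le.
apply: measurableT_comp => //; apply: measurableT_comp => //; exact: measurable_funB.
Qed.

Lemma int_bound_powRN (t q : R) : (0 < t)%R -> (0 < q < 1)%R ->
  int_bound t (fun x => x `^ (- q))%R (t `^ (1 - q) / (1 - q))%R.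
Proof.
move=> t0 q01; split; [exact: measurable_powR|by move=> x; exact: powR_ge0|].
by rewrite ge0_integral_powRN.
Qed.

Lemma int_bound_log (t eta : R) : (0 < t)%R -> (0 < eta)%R ->
  int_bound t (fun x => (eta + `|x|)^-1)%R (ln (1 + t / eta)).
Proof.
move=> t0 e0.
have p0 (x : R) : (0 < eta + `|x|)%R by rewrite ltr_pwDl.
split.
- suff c (x : R) : {for x, continuous (fun x : R => (eta + `|x|)^-1)%R} by exact: continuous_measurable_fun.
  apply: continuousV; first by rewrite gt_eqF.
  by apply: continuousD; [exact: cst_continuous|exact: norm_continuous].
- by move=> x; rewrite invr_ge0 ltW.
rewrite -ge0_integral_log// le_eqVlt; apply/orP; left; apply/eqP; apply: eq_integral => x.
by rewrite inE/= in_itv/= => /andP[x0 _]; rewrite gtr0_norm.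
Qed.

Lemma int_bound_inv2 (t E : R) : (0 < t)%R -> (0 < E)%R ->
  int_bound t (fun x => (E + `|x|) ^- 2)%R E^-1.
Proof.
move=> t0 e0.
have p0 (x : R) : (0 < E + `|x|)%R by rewrite ltr_pwDl.
split.
- suff c (x : R) : {for x, continuous (fun x : R => (E + `|x|) ^- 2)%R} by exact: continuous_measurable_fun.
  apply: continuousV; first by rewrite gt_eqF// exprn_gt0.
  apply: (@continuous_comp _ _ _ (fun y => E + `|y|)%R (fun y => y ^+ 2)%R); last exact: exprn_continuous.
  by apply: continuousD; [exact: cst_continuous|exact: norm_continuous].
- by move=> x; rewrite invr_ge0 sqr_ge0.
apply: le_trans (ge0_integral_inv2 t0 e0); apply: le_of_eq_ereal; apply: eq_integral => x.
by rewrite inE/= in_itv/= => /andP[x0 _]; rewrite gtr0_norm.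
Qed.

Section majorant_integral.
Variables (t eta : R).
Hypotheses (t0 : (0 < t)%R) (e0 : (0 < eta)%R).
Let Lg := ln (1 + t / eta).
Let c8 : R := (t `^ (1 - 8 / 9) / (1 - 8 / 9))%R.
Let c5 : R := (t `^ (1 - 5 / 6) / (1 - 5 / 6))%R.
Let c2 : R := (t `^ (1 - 2 / 3) / (1 - 2 / 3))%R.

Let b8 : int_bound t (fun x => x `^ (- (8 / 9)))%R c8.
Proof. by apply: int_bound_powRN => //; apply/andP; split; lra. Qed.
Let b5 : int_bound t (fun x => x `^ (- (5 / 6)))%R c5.
Proof. by apply: int_bound_powRN => //; apply/andP; split; lra. Qed.
Let b2 : int_bound t (fun x => x `^ (- (2 / 3)))%R c2.
Proof. by apply: int_bound_powRN => //; apply/andP; split; lra. Qed.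

Let Lg0 : (0 <= Lg)%R.
Proof. by apply: ln_ge0; rewrite lerDl divr_ge0// ltW. Qed.

Let bL : int_bound t (fun x => (eta + `|x|)^-1)%R Lg.
Proof. exact: int_bound_log. Qed.

Let bLd y : (0 < y < t)%R -> int_bound t (fun x => (eta + `|x - y|)^-1)%R (2 * Lg).
Proof.
move=> yt; have := int_bound_dist yt bL.
by under eq_fun do rewrite normr_id.
Qed.

Let c8_ge0 : (0 <= c8)%R. Proof. by rewrite divr_ge0 ?powR_ge0//; lra. Qed.
Let c5_ge0 : (0 <= c5)%R. Proof. by rewrite divr_ge0 ?powR_ge0//; lra. Qed.

(* the majorant once s' is integrated *)
Let psi (u rr rs : R) : R :=
  (u `^ (- (8 / 9)) * ((2 * c8 + 2 * c8 + 2 * c8) * (rr `^ (- (8 / 9)) + rs `^ (- (8 / 9))))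
  + u `^ (- (2 / 3)) * (2 * (eta + rr)^-1)
  + u `^ (- (5 / 6)) * (2 * Lg * rr `^ (- (5 / 6)))
  + (eta + u)^-1 * (2 * c5 * rr `^ (- (5 / 6))))%R.

Let psi_ge0 (u rr rs : R) : (0 <= u)%R -> (0 <= rr)%R -> (0 <= psi u rr rs)%R.
Proof.
move=> u0 rr0; have h := powR_ge0.
have h1 : (0 <= (eta + u)^-1)%R by rewrite invr_ge0 addr_ge0// ltW.
have h2 : (0 <= (eta + rr)^-1)%R by rewrite invr_ge0 addr_ge0// ltW.
rewrite /psi; by repeat first [exact: powR_ge0|done|apply: addr_ge0|apply: mulr_ge0].
Qed.

Let majorant_s' (r s r' : R) : (0 < r < t)%R -> (0 < s < t)%R -> (0 < r' < t)%R ->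
  \int[mu]_(s' in `]0%R, t[)
    (majorant eta `|s - r| `|s' - r'| `|r' - r| `|r' - s| `|s' - r| `|s' - s|)%R%:E <=
  (psi `|s - r| `|r' - r| `|r' - s|)%R%:E.
Proof.
move=> rt st r't; suff [_ _] : int_bound t (fun s' : R =>
    majorant eta `|s - r| `|s' - r'| `|r' - r| `|r' - s| `|s' - r| `|s' - s|)%R (psi `|s - r| `|r' - r| `|r' - s|)%R by [].
have -> : psi `|s - r|%R `|r' - r|%R `|r' - s|%R =
    (`|s - r| `^ (- (8 / 9)) * (`|r' - r| `^ (- (8 / 9)) + `|r' - s| `^ (- (8 / 9))) * (2 * c8 + 2 * c8 + 2 * c8)
  + `|s - r| `^ (- (2 / 3)) * (2 * (eta + `|r' - r|)^-1)
  + `|s - r| `^ (- (5 / 6)) * `|r' - r| `^ (- (5 / 6)) * (2 * Lg)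
  + (eta + `|s - r|)^-1 * `|r' - r| `^ (- (5 / 6)) * (2 * c5))%R.
  by rewrite /psi; ring.
rewrite /majorant; apply: int_boundD; [apply: int_boundD; [apply: int_boundD|]|].
- apply: int_boundZ; first by rewrite mulr_ge0 ?addr_ge0 ?powR_ge0.
  by apply: int_boundD; [apply: int_boundD|]; apply: (int_bound_dist _ b8).
- apply: int_boundZ; first by rewrite powR_ge0.
  have := int_bound_dist st (@int_bound_inv2 t (eta + `|r' - r|)%R t0 (ltr_wpDr (normr_ge0 _) e0)).
  by under eq_fun do rewrite normr_id.
- by apply: int_boundZ; [rewrite mulr_ge0 ?powR_ge0|exact: bLd].
- apply: int_boundZ; first by rewrite mulr_ge0 ?powR_ge0// invr_ge0 addr_ge0// ltW.
  exact: (int_bound_dist _ b5).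
Qed.

(* the majorant once s' and r' are integrated *)
Let phi (u : R) : R :=
  ((2 * c8 + 2 * c8 + 2 * c8) * (2 * c8 + 2 * c8) * u `^ (- (8 / 9))
  + 2 * (2 * Lg) * u `^ (- (2 / 3))
  + (2 * Lg) * (2 * c5) * u `^ (- (5 / 6))
  + (2 * c5) * (2 * c5) * (eta + `|u|)^-1)%R.

Let psi_r' (r s : R) : (0 < r < t)%R -> (0 < s < t)%R ->
  \int[mu]_(r' in `]0%R, t[) (psi `|s - r| `|r' - r| `|r' - s|)%R%:E <= (phi `|s - r|)%R%:E.
Proof.
move=> rt st; suff [_ _] : int_bound t (fun r' : R =>
    psi `|s - r| `|r' - r| `|r' - s|)%R (phi `|s - r|)%R by [].
have -> : phi `|s - r|%R =
  (`|s - r| `^ (- (8 / 9)) * ((2 * c8 + 2 * c8 + 2 * c8) * (2 * c8 + 2 * c8))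
  + `|s - r| `^ (- (2 / 3)) * (2 * (2 * Lg))
  + `|s - r| `^ (- (5 / 6)) * ((2 * Lg) * (2 * c5))
  + (eta + `|s - r|)^-1 * ((2 * c5) * (2 * c5)))%R.
  by rewrite /phi normr_id; ring.
apply: int_boundD; [apply: int_boundD; [apply: int_boundD|]|].
- apply: int_boundZ; first by rewrite powR_ge0.
  apply: int_boundZ; first by rewrite !addr_ge0// mulr_ge0.
  by apply: int_boundD; apply: (int_bound_dist _ b8).
- apply: int_boundZ; first by rewrite powR_ge0.
  by apply: int_boundZ => //; exact: bLd.
- apply: int_boundZ; first by rewrite powR_ge0.
  by apply: int_boundZ; [rewrite mulr_ge0|exact: (int_bound_dist _ b5)].
- apply: int_boundZ; first by rewrite invr_ge0 addr_ge0// ltW.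
  by apply: int_boundZ; [rewrite mulr_ge0|exact: (int_bound_dist _ b5)].
Qed.

Let phi_s : int_bound t phi
  ((2 * c8 + 2 * c8 + 2 * c8) * (2 * c8 + 2 * c8) * c8
  + 2 * (2 * Lg) * c2 + (2 * Lg) * (2 * c5) * c5 + (2 * c5) * (2 * c5) * Lg)%R.
Proof.
apply: int_boundD; [apply: int_boundD; [apply: int_boundD|]|]; apply: int_boundZ => //;
  by repeat first [done|apply: addr_ge0|apply: mulr_ge0].
Qed.

Lemma measurable_majorant (r s : R) : measurable_fun [set: plane R]
  (fun q => majorant eta `|s - r| `|q.2 - q.1| `|q.1 - r| `|q.1 - s| `|q.2 - r| `|q.2 - s|)%R.
Proof.
have m1 : measurable_fun [set: plane R] fst by exact: measurable_fst.
have m2 : measurable_fun [set: plane R] snd by exact: measurable_snd.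
have mc (c : R) : measurable_fun [set: plane R] (cst c) by [].
have mn (f g : plane R -> R) : measurable_fun [set: plane R] f ->
    measurable_fun [set: plane R] g ->
    measurable_fun [set: plane R] (fun q => `|f q - g q|)%R.
  by move=> mf mg; apply: measurableT_comp => //; exact: measurable_funB.
have d1 := mn _ _ m2 m1.
have d2 := mn _ _ m1 (mc r).
have d3 := mn _ _ m1 (mc s).
have d4 := mn _ _ m2 (mc r).
have d5 := mn _ _ m2 (mc s).
have mp q f := @measurable_fun_powR _ (plane R) q f.
have mv f := @ge0_measurable_funV _ (plane R) f.
apply: measurable_funD; [apply: measurable_funD; [apply: measurable_funD|]|].
- apply: measurable_funM; [apply: measurable_funM; [exact: mc|]|].
    by apply: measurable_funD; exact: mp.
  by apply: measurable_funD; [apply: measurable_funD|]; exact: mp.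
- apply: measurable_funM; first exact: mc.
  apply: mv; last by move=> q; exact: sqr_ge0.
  apply: measurable_funX; apply: measurable_funD; [apply: measurable_funD|] => //; exact: mc.
- apply: measurable_funM; [apply: measurable_funM; [exact: mc|exact: mp]|].
  apply: mv; last by move=> q; rewrite addr_ge0// ltW.
  by apply: measurable_funD => //; exact: mc.
- by apply: measurable_funM; [apply: measurable_funM; [exact: mc|exact: mp]|exact: mp].
Qed.

Lemma integral_majorant_inner (r s : R) : (0 < r < t)%R -> (0 < s < t)%R ->
  \int[(mu \x mu)%E]_(q in simplex2 t)
    (majorant eta `|s - r| `|q.2 - q.1| `|q.1 - r| `|q.1 - s| `|q.2 - r| `|q.2 - s|)%R%:E <=
  (phi `|s - r|)%R%:E.
Proof.
move=> rt st.
apply: (le_trans (integral_simplex2_le _ _ _)).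
- by apply/measurable_EFinP; exact: measurable_majorant.
- by move=> p; rewrite lee_fin; exact: majorant_ge0.
apply: le_trans (psi_r' rt st).
apply: ge0_le_integral_nonmeasurable => //=.
- by move=> x _; apply: integral_ge0 => y _; rewrite lee_fin; exact: majorant_ge0.
- by move=> x _; rewrite lee_fin; exact: psi_ge0.
- by move=> x; rewrite in_itv/= => xt; exact: majorant_s'.
Qed.

Lemma integral_majorant_outer : exists f : R -> R, [/\ measurable_fun [set: R] f, forall u, (0 <= f u)%R,
  forall r s : R, (0 < r < t)%R -> (0 < s < t)%R ->
  \int[(mu \x mu)%E]_(q in simplex2 t)
    (majorant eta `|s - r| `|q.2 - q.1| `|q.1 - r| `|q.1 - s| `|q.2 - r| `|q.2 - s|)%R%:E <=
  (f (s - r))%R%:E &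
  \int[(mu \x mu)%E]_(p in simplex2 t) (f (p.2 - p.1))%R%:E <= (t * 
  (2 * ((2 * c8 + 2 * c8 + 2 * c8) * (2 * c8 + 2 * c8) * c8
  + 2 * (2 * Lg) * c2 + (2 * Lg) * (2 * c5) * c5 + (2 * c5) * (2 * c5) * Lg)))%R%:E].
Proof.
have [mphi phi0 phiC] := phi_s.
exists (fun x => phi `|x|); split => //.
- exact: measurableT_comp.
- exact: integral_majorant_inner.
apply: (le_trans (integral_simplex2_le _ _ _)).
- apply/measurable_EFinP; apply: measurableT_comp => //; apply: measurableT_comp => //.
  exact: measurable_funB.
- by move=> p; rewrite lee_fin.
move: phi_s; set C := (X in int_bound _ _ X) => phi_s'.
apply: (@le_trans _ _ (\int[mu]_(x in `]0%R, t[) (cst (2 * C)%:E x))).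
  apply: ge0_le_integral_nonmeasurable => //=.
  - by move=> x _; apply: integral_ge0 => y _; rewrite lee_fin.
  - move=> x _; rewrite lee_fin mulr_ge0// -lee_fin; apply: le_trans phiC.
    by apply: integral_ge0 => y _; rewrite lee_fin.
  - move=> x; rewrite in_itv/= => xt.
    by have [_ _] := int_bound_dist xt phi_s'.
rewrite integral_cst// [X in _ * X](_ : _ = t%:E).
  by rewrite -EFinM lee_fin mulrC.
by apply: (etrans (lebesgue_measure_itv _)); rewrite /= lte_fin t0 oppr0 adde0.
Qed.
End majorant_integral.

(** The remainder of the second moment is only of logarithmic size, against
    the square of a logarithm for its main part. *)
Lemma integral_majorant (t : R) : (0 < t)%R -> exists C : R, (0 <= C)%R /\ forall eta : R, (0 < eta)%R ->
  exists f : R -> R, [/\ measurable_fun [set: R] f, forall u, (0 <= f u)%R,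
  forall r s : R, (0 < r < t)%R -> (0 < s < t)%R ->
  \int[(mu \x mu)%E]_(q in simplex2 t)
    (majorant eta `|s - r| `|q.2 - q.1| `|q.1 - r| `|q.1 - s| `|q.2 - r| `|q.2 - s|)%R%:E <=
  (f (s - r))%R%:E &
  \int[(mu \x mu)%E]_(p in simplex2 t) (f (p.2 - p.1))%R%:E <= (C * (1 + ln (1 + t / eta)))%R%:E].
Proof.
move=> t0.
pose c8 : R := (t `^ (1 - 8 / 9) / (1 - 8 / 9))%R.
pose c5 : R := (t `^ (1 - 5 / 6) / (1 - 5 / 6))%R.
pose c2 : R := (t `^ (1 - 2 / 3) / (1 - 2 / 3))%R.
have h8 : (0 <= c8)%R by rewrite divr_ge0 ?powR_ge0//; lra.
have h5 : (0 <= c5)%R by rewrite divr_ge0 ?powR_ge0//; lra.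
have h2 : (0 <= c2)%R by rewrite divr_ge0 ?powR_ge0//; lra.
pose A := ((2 * c8 + 2 * c8 + 2 * c8) * (2 * c8 + 2 * c8) * c8)%R.
pose B := (2 * 2 * c2 + 2 * (2 * c5) * c5 + (2 * c5) * (2 * c5))%R.
have A0 : (0 <= A)%R by rewrite /A; repeat first [done|apply: addr_ge0|apply: mulr_ge0].
have B0 : (0 <= B)%R by rewrite /B; repeat first [done|apply: addr_ge0|apply: mulr_ge0].
exists (t * (2 * (A + B)))%R; split; first by rewrite mulr_ge0 ?(ltW t0)// mulr_ge0// addr_ge0.
move=> eta e0; have [f [f1 f2 f3 f4]] := integral_majorant_outer t0 e0.
exists f; split => //; apply: (le_trans f4); rewrite lee_fin -[leRHS]mulrA ler_wpM2l ?(ltW t0)//.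
rewrite -[leRHS]mulrA ler_pM2l//.
have Lg0 : (0 <= ln (1 + t / eta))%R by apply: ln_ge0; rewrite lerDl divr_ge0// ltW.
rewrite -!/(c8) -!/(c5) -!/(c2) -/A; move: (ln _) Lg0 => L L0.
rewrite (_ : (_ + _ + _ + _ = A + B * L)%R); last by rewrite /B; ring.
move: (B) B0 => b b0.
have AL := mulr_ge0 A0 L0; move: (A) A0 AL b0 L0 => a; clear; lra.
Qed.
End integral_bounds.

(** * Increments of a monotone function over the simplex *)

Section increments_over_simplex.
Context {R : realType}.
Notation mu := (@lebesgue_measure R).
Local Open Scope ereal_scope.
Variables (t : R) (G w : R -> R).
Hypotheses (t0 : (0 < t)%R) (mG : measurable_fun [set: R] G) (mw : measurable_fun [set: R] w).
Hypotheses (G_homo : {homo G : x y / (x <= y)%R}) (G0 : G 0 = 0%R) (w0 : forall u, (0 <= w u)%R).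

Let F (p : R * R) : \bar R := (w (p.2 - p.1) * (G p.2 - G p.1))%:E.

Let F_ge0 p : simplex2 t p -> 0 <= F p.
Proof. by move=> [_ [h _]]; rewrite lee_fin mulr_ge0// subr_ge0 G_homo// ltW. Qed.

Let mF : measurable_fun [set: plane R] F.
Proof.
apply/measurable_EFinP; apply: measurable_funM.
  by apply: measurableT_comp => //; exact: measurable_funB.
by apply: measurable_funB; exact: measurableT_comp.
Qed.

Let J (u : R) : \bar R := \int[mu]_(r in `]0%R, (t - u)%R[) (G (r + u) - G r)%:E.

Let J_ge0 u : (0 <= u)%R -> 0 <= J u.
Proof.
by move=> u0; apply: integral_ge0 => r _; rewrite lee_fin subr_ge0 G_homo// lerDl.
Qed.

Let measurable_shiftG u : measurable_fun [set: R] (fun r => G (r + u))%R.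
Proof. by apply: measurableT_comp => //; exact: measurable_funD. Qed.

(** The change of variables u = s - r. *)
Lemma integral_simplex2_sliding :
  \int[(mu \x mu)%E]_(p in simplex2 t) F p = \int[mu]_(u in `]0%R, t[) ((w u)%:E * J u).
Proof.
have FD0 p : 0 <= (F \_ (simplex2 t)) p by apply: erestrict_ge0; exact: F_ge0.
have mFD : measurable_fun [set: plane R] (F \_ (simplex2 t)).
  by apply/(measurable_restrictT _ _).1; [exact: measurable_simplex2|exact: measurable_funTS].
rewrite integral_mkcond fubini_tonelli1//.
transitivity (\int[mu]_x \int[mu]_u (F \_ (simplex2 t)) (x, (u + x)%R)).
  apply: eq_integral => x _; rewrite /fubini_F.
  rewrite (@ge0_integral_shift _ x (fun y => (F \_ (simplex2 t)) (x, y)))//.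
  exact: measurableT_comp.
rewrite (@fubini_tonelli _ _ _ _ _ _ _ (fun p : plane R => (F \_ (simplex2 t)) (p.1, (p.2 + p.1)%R)))//; last first.
  apply: measurableT_comp => //; apply: measurable_fun_pair => //.
  exact: measurable_funD.
rewrite [RHS]integral_mkcond; apply: eq_integral => u _; rewrite patchE.
have E r : simplex2 t (r, u + r)%R <-> (0 < u < t /\ 0 < r < t - u)%R.
  rewrite /simplex2/=; split=> [[a [b c]]|[/andP[a b] /andP[c d]]].
    by split; apply/andP; split; lra.
  by repeat split; lra.
case: ifPn => [|uI]; last first.
  apply: integral0_eq => r _; rewrite patchE ifF//; apply/negP => /set_mem /E[h _].
  by move/negP: uI; apply; rewrite inE/= in_itv.
rewrite inE/= in_itv/= => ut.
rewrite /J -ge0_integralZl//; last 3 first.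
- apply/measurable_EFinP; apply: measurable_funTS.
  by apply: measurable_funB => //; exact: measurable_shiftG.
- by move=> r _; rewrite lee_fin subr_ge0 G_homo// lerDl ltW//; case/andP: ut.
- by rewrite lee_fin.
rewrite [RHS]integral_mkcond; apply: eq_integral => r _; rewrite !patchE.
rewrite (_ : ((r, u + r)%R \in simplex2 t) = (r \in `]0%R, (t - u)%R[%classic)).
  by case: ifP => // _; rewrite /F/= addrK [(u + r)%R]addrC -EFinM.
by apply/idP/idP; rewrite !inE/= in_itv/= => h; [case/E: h|apply/E].
Qed.

Let I (a b : R) : \bar R := \int[mu]_(x in `]a, b[) (G x)%:E.

Let G_ge0 x : (0 <= x)%R -> (0 <= G x)%R. Proof. by rewrite -{2}G0; exact: G_homo. Qed.

Let mGE (D : set R) : measurable_fun D (fun x => (G x)%:E).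
Proof. by apply/measurable_EFinP; exact: measurable_funTS. Qed.

Let I_le (a b : R) : (0 <= a)%R -> (a <= b)%R ->
  ((b - a) * G a)%:E <= I a b /\ I a b <= ((b - a) * G b)%:E.
Proof.
move=> a0 ab; have len c : (0 <= c)%R -> \int[mu]_(x in `]a, b[) (cst c%:E x) = ((b - a) * c)%:E.
  move=> c0; rewrite integral_cst// [X in _ * X](_ : _ = (b - a)%:E); first by rewrite -EFinM mulrC.
  apply: (etrans (lebesgue_measure_itv _)); rewrite /= lte_fin; case: ltP => // ba.
  by rewrite (@le_anti _ _ a b) ?ab// subrr.
have Ga := G_ge0 a0; have Gb := G_ge0 (le_trans a0 ab).
split; [rewrite -(len _ Ga)|rewrite -(len _ Gb)]; apply: ge0_le_integral_nonmeasurable => //= x; rewrite ?in_itv/=.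
- by move=> /andP[ax _]; rewrite lee_fin G_ge0// (le_trans a0)// ltW.
- by move=> /andP[ax _]; rewrite lee_fin G_homo// ltW.
- by move=> /andP[ax _]; rewrite lee_fin G_ge0// (le_trans a0)// ltW.
- by move=> /andP[_ xb]; rewrite lee_fin G_homo// ltW.
Qed.

Let I_cat (a b c : R) : (0 <= a)%R -> (a < b)%R -> (b < c)%R -> I a c = I a b + I b c.
Proof.
move=> a0 ab bc; rewrite /I [in X in _ + X]integral_itv_obnd_cbnd; last exact: mGE.
rewrite -ge0_integral_setU//.
- congr integral; apply/seteqP; split => x /=; rewrite !in_itv/=.
    by move=> /andP[ax xc]; have [xb|bx] := ltP x b; [left; rewrite ax|right; rewrite xc].
  by move=> [/andP[ax xb]|/andP[bx xc]]; apply/andP; split; lra.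
- exact: mGE.
- move=> x /= [|]; rewrite in_itv/= => /andP[ax _]; rewrite lee_fin G_ge0//; lra.
- apply/disj_set2P; apply/seteqP; split => x //= []; rewrite !in_itv/= => /andP[_ xb] /andP[bx _].
  by move: (lt_le_trans xb bx); rewrite ltxx.
Qed.

(** The integral of the increments telescopes: only the two ends of [0, t]
    remain. *)
Let J_telescope u : (0 < u < t)%R -> J u + I 0 u = I (t - u) t.
Proof.
move=> /andP[u0 ut].
have tu : (0 < t - u)%R by lra.
have Ifin : I 0 (t - u) \is a fin_num.
  have [h1 h2] := I_le (lexx 0%R) (ltW tu).
  rewrite ge0_fin_numE; first exact: (le_lt_trans h2 (ltry _)).
  by apply: le_trans h1; rewrite G0 mulr0.
have JI : J u + I 0 (t - u) = I u t.
  rewrite /J /I -ge0_integralD//.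
  - under eq_integral do rewrite -EFinD subrK.
    pose g := (fun x => (G x)%:E) \_ `]u, t[%classic.
    rewrite [RHS]integral_mkcond -(@ge0_integral_shift _ u g); last 2 first.
    + by apply/(measurable_restrictT _ _).1 => //; exact: mGE.
    + by apply: erestrict_ge0 => x /=; rewrite in_itv/= => /andP[ux _]; rewrite lee_fin G_ge0//; lra.
    rewrite [LHS]integral_mkcond; apply: eq_integral => x _; rewrite /g !patchE.
    rewrite (_ : (x + u \in `]u, t[%classic)%R = (x \in `]0%R, (t - u)%R[%classic))//.
    by apply/idP/idP; rewrite !inE/= !in_itv/= => /andP[h1 h2]; apply/andP; split; lra.
  - by move=> r _; rewrite lee_fin subr_ge0 G_homo// lerDl ltW.
  - apply/measurable_EFinP; apply: measurable_funTS.
    by apply: measurable_funB => //; exact: measurable_shiftG.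
  - by move=> r /=; rewrite in_itv/= => /andP[r0 _]; rewrite lee_fin G_ge0// ltW.
  - exact: mGE.
have tot : I 0 u + I u t = I 0 (t - u) + I (t - u) t.
  by rewrite -!I_cat//; lra.
rewrite -JI addeA in tot.
have : I 0 (t - u) + (J u + I 0 u) = I 0 (t - u) + I (t - u) t.
  by rewrite -tot addeC [J u + _]addeC.
by move=> /(congr1 (fun x => x - I 0 (t - u))); rewrite ![I 0 (t - u) + _]addeC !addeK.
Qed.

Let I_ge0 u : (0 <= u)%R -> 0 <= I 0 u.
Proof.
move=> u0; apply: integral_ge0 => x /=; rewrite in_itv/= => /andP[x0 _].
by rewrite lee_fin G_ge0// ltW.
Qed.

Let I_end u : (0 < u)%R -> (u < t)%R ->
  (u * G (t - u))%:E <= I (t - u) t /\ I (t - u) t <= (u * G t)%:E.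
Proof.
move=> u0 ut; have tu0 : (0 <= t - u)%R by rewrite subr_ge0 ltW.
have tut : (t - u <= t)%R by rewrite gerBl ltW.
by have := I_le tu0 tut; rewrite subKr.
Qed.

Let J_le u : (0 < u < t)%R -> J u <= (u * G t)%:E.
Proof.
move=> /andP[u0 ut]; apply: (@le_trans _ _ (J u + I 0 u)).
  by rewrite leeDl// I_ge0// ltW.
rewrite J_telescope ?u0//; by have [] := I_end u0 ut.
Qed.

Let J_lower u : (0 < u < t)%R -> (u * Num.max (G (t - u) - G u) 0)%:E <= J u.
Proof.
move=> /andP[u0 ut]; have [h|h] := leP (G (t - u) - G u)%R 0%R.
  by rewrite mulr0 J_ge0// ltW.
rewrite mulrBr EFinB leeBlDr//.
apply: (@le_trans _ _ (J u + I 0 u)).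
  rewrite J_telescope ?u0//; by have [] := I_end u0 ut.
have [_] := @I_le 0 u (lexx _) (ltW u0); rewrite subr0 => h'.
by rewrite leeD2l.
Qed.

Lemma integral_increments_le :
  \int[(mu \x mu)%E]_(p in simplex2 t) (w (p.2 - p.1) * (G p.2 - G p.1))%:E <=
  (G t)%:E * \int[mu]_(u in `]0%R, t[) (u * w u)%:E.
Proof.
rewrite integral_simplex2_sliding -ge0_integralZl_EFin//; last 3 first.
- by move=> u /=; rewrite in_itv/= => /andP[u0 _]; rewrite lee_fin mulr_ge0// ltW.
- by apply/measurable_EFinP/measurable_funTS/measurable_funM.
- by apply: G_ge0; exact: ltW.
apply: ge0_le_integral_nonmeasurable => //= u; rewrite in_itv/= => /andP[u0 ut].
- by rewrite mule_ge0 ?lee_fin// J_ge0// ltW.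
- by rewrite -EFinM lee_fin !mulr_ge0// ?G_ge0// ltW.
rewrite -EFinM (_ : (G t * (u * w u) = w u * (u * G t))%R); last by ring.
by rewrite EFinM lee_wpmul2l ?lee_fin// J_le// u0.
Qed.

Lemma integral_increments_ge :
  \int[mu]_(u in `]0%R, t[) (w u * (u * Num.max (G (t - u) - G u) 0))%:E <=
  \int[(mu \x mu)%E]_(p in simplex2 t) (w (p.2 - p.1) * (G p.2 - G p.1))%:E.
Proof.
rewrite integral_simplex2_sliding.
apply: ge0_le_integral_nonmeasurable => //= u; rewrite in_itv/= => /andP[u0 ut].
- by rewrite lee_fin !mulr_ge0 ?(ltW u0)// le_max lexx orbT.
- by rewrite mule_ge0 ?lee_fin// J_ge0// ltW.
by rewrite EFinM lee_wpmul2l ?lee_fin// J_lower// u0.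
Qed.
End increments_over_simplex.

(** * The weight of the first chaos *)

Section smoothing_weight.
Context {R : realType}.
Notation mu := (@lebesgue_measure R).

Definition weight (eps u : R) : R := (eps + incr_var u) `^ (- (3 / 2)).

Lemma weight_ge0 eps u : 0 <= weight eps u.
Proof. exact: powR_ge0. Qed.

Lemma measurable_incr_var : measurable_fun [set: R] (@incr_var R).
Proof. by apply: measurable_fun_powR; exact: normr_measurable. Qed.

Lemma measurable_weight eps : measurable_fun [set: R] (weight eps).
Proof.
by apply: measurable_fun_powR; apply: measurable_funD => //; exact: measurable_incr_var.
Qed.

Lemma powR_subadditive (p x y : R) : p <= 1 -> 0 < x -> 0 < y ->
  (x + y) `^ p <= x `^ p + y `^ p.
Proof.
move=> p1 x0 y0; have xy0 : 0 < x + y by exact: addr_gt0.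
have E (z : R) : 0 < z -> z `^ p = z * z `^ (p - 1).
  move=> z0; rewrite -{2}(powRr1 (ltW z0)) -powRD ?(gt_eqF z0) ?implybT//.
  by congr (_ `^ _); ring.
have q : p - 1 = - (1 - p) by ring.
rewrite !E// mulrDl lerD// ler_wpM2l ?(ltW x0) ?(ltW y0)// q; apply: le_powRN; lra.
Qed.

Lemma powR_superadditive (p x y : R) : 1 <= p -> 0 < x -> 0 < y ->
  x `^ p + y `^ p <= (x + y) `^ p.
Proof.
move=> p1 x0 y0; have xy0 : 0 < x + y by exact: addr_gt0.
have E (z : R) : 0 < z -> z `^ p = z * z `^ (p - 1).
  move=> z0; rewrite -{2}(powRr1 (ltW z0)) -powRD ?(gt_eqF z0) ?implybT//.
  by congr (_ `^ _); ring.
rewrite !E// mulrDl lerD// ler_wpM2l ?(ltW x0) ?(ltW y0)//; apply: ge0_ler_powR; rewrite ?nnegrE; lra.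
Qed.

(** The powers 3/4 and 3/2 are respectively subadditive and superadditive, which
    compares the weight with rational functions, of cutoff eps^(3/4). *)
Lemma weight_bounds eps u : 0 < eps -> 0 < u ->
  [/\ u * (eps `^ (3 / 4) + u) ^- 2 <= u * weight eps u,
      u * weight eps u <= u * ((eps `^ (3 / 4)) ^+ 2 + u ^+ 2)^-1 &
      u ^+ 2 * weight eps u <= 1].
Proof.
move=> e0 u0; rewrite /weight incr_varE ?(ltW u0)//; set y := u `^ (4 / 3).
have y0 : 0 < y by exact: powR_gt0.
have ey0 : 0 < eps + y by exact: addr_gt0.
have yu : y `^ (3 / 4) = u.
  by rewrite /y -powRrM (_ : 4 / 3 * (3 / 4) = 1) ?powRr1 ?(ltW u0)//; field.
have e1 : 0 < eps `^ (3 / 4) by exact: powR_gt0.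
have sq (z : R) : z `^ (3 / 2) = (z `^ (3 / 4)) ^+ 2.
  by rewrite -(powR_mulrn 2 (powR_ge0 _ _)) -powRrM; congr (_ `^ _); field.
have p0 : 0 < (eps + y) `^ (3 / 2) by exact: powR_gt0.
have hs : (eps + y) `^ (3 / 4) <= eps `^ (3 / 4) + u.
  by rewrite -yu; apply: powR_subadditive => //; lra.
have hS : (eps `^ (3 / 4)) ^+ 2 + u ^+ 2 <= (eps + y) `^ (3 / 2).
  by rewrite -[in u ^+ 2]yu -!sq; apply: powR_superadditive => //; lra.
rewrite powRN; split.
- rewrite ler_wpM2l ?(ltW u0)// lef_pV2 ?posrE// ?exprn_gt0 ?addr_gt0// sq.
  by apply: lerXn2r => //; rewrite nnegrE ?powR_ge0// addr_ge0// ltW.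
- by rewrite ler_wpM2l ?(ltW u0)// lef_pV2 ?posrE// addr_gt0// exprn_gt0.
- rewrite ler_pdivrMr// mul1r; apply: le_trans hS.
  by rewrite lerDr sqr_ge0.
Qed.

Local Open Scope ereal_scope.

Lemma integral_lower_weight (t eta : R) : (0 < t)%R -> (0 < eta)%R ->
  \int[mu]_(u in `]0%R, t[) (u * (eta + u) ^- 2)%:E = (ln ((eta + t) / eta) + eta / (eta + t) - 1)%:E.
Proof.
move=> t0 e0; pose F (x : R) := (ln (eta + x) + eta * (eta + x)^-1)%R.
have dF (x : R) : (0 <= x)%R -> is_derive x (1%R:R) F (x * (eta + x) ^- 2)%R.
  move=> x0; have ex0 : (0 < eta + x)%R by lra.
  have ex : (eta + x != 0)%R by rewrite gt_eqF.
  have dE : is_derive x (1%R:R) (fun x => eta + x)%R 1%R by exact: is_derive_translate.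
  have H1 := @is_derive1_comp _ (@ln R) (fun x => eta + x)%R x _ _ (is_derive1_ln ex0) dE.
  have H2 := @is_deriveZ _ _ _ _ eta x (1%R:R) _ (is_deriveV ex dE).
  have := is_deriveD H1 H2; rewrite /GRing.scale/=.
  rewrite (_ : _ + _ = x * (eta + x) ^- 2)%R//.
  by field.
have cF (x : R) : (0 <= x)%R -> {for x, continuous F}.
  move=> x0; have H := dF _ x0.
  by apply: differentiable_continuous; apply/derivable1_diffP; exact: ex_derive.
have -> : (ln ((eta + t) / eta) + eta / (eta + t) - 1 = F t - F 0)%R.
  rewrite /F addr0 ln_div ?posrE//; last by lra.
  by rewrite mulfV ?gt_eqF//; ring.
apply: (@ge0_FTC_oo _ (fun x => x * (eta + x) ^- 2)%R F) => //.
- by move=> x /andP[x0 _]; rewrite mulr_ge0 ?(ltW x0)// invr_ge0 sqr_ge0.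
- move=> x /andP[x0 _]; apply: continuousM; first exact: cvg_id.
  apply: continuousV; first by rewrite gt_eqF// exprn_gt0//; lra.
  apply: (@continuous_comp _ _ _ (fun y => eta + y)%R (fun y => y ^+ 2)%R); last exact: exprn_continuous.
  by apply: continuousD => //; exact: cst_continuous.
- by move=> x /andP[x0 _]; apply: dF; exact: ltW.
- by apply: cvg_at_right_filter; exact: cF.
- by apply: cvg_at_left_filter; apply: cF; exact: ltW.
Qed.

Lemma integral_upper_weight (t eta : R) : (0 < t)%R -> (0 < eta)%R ->
  \int[mu]_(u in `]0%R, t[) (u * (eta ^+ 2 + u ^+ 2)^-1)%:E = (2^-1 * ln ((eta ^+ 2 + t ^+ 2) / eta ^+ 2))%:E.
Proof.
move=> t0 e0; pose F (x : R) := (2^-1 * ln (eta ^+ 2 + x ^+ 2))%R.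
have p0 (x : R) : (0 < eta ^+ 2 + x ^+ 2)%R by rewrite ltr_pwDl ?exprn_gt0// sqr_ge0.
have dF (x : R) : is_derive x (1%R:R) F (x * (eta ^+ 2 + x ^+ 2)^-1)%R.
  have dE : is_derive x (1%R:R) (fun x : R => eta ^+ 2 + x ^+ 2)%R (2 * x)%R.
    have := is_deriveD (is_derive_cst (eta ^+ 2)%R x (1%R:R)) (is_deriveX 2 (is_derive_id x (1%R:R))).
    rewrite /GRing.scale/= (_ : 0 + _ = 2 * x)%R//.
    by rewrite expr1 mulr1 add0r mulr_natl.
  have H1 := @is_derive1_comp _ (@ln R) _ x _ _ (is_derive1_ln (p0 x)) dE.
  have := @is_deriveZ _ _ _ _ (2^-1)%R x (1%R:R) _ H1; rewrite /GRing.scale/=.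
  rewrite (_ : 2^-1 * _ = x * (eta ^+ 2 + x ^+ 2)^-1)%R//.
  by field; rewrite gt_eqF.
have cF (x : R) : {for x, continuous F}.
  have H := dF x.
  by apply: differentiable_continuous; apply/derivable1_diffP; exact: ex_derive.
have -> : (2^-1 * ln ((eta ^+ 2 + t ^+ 2) / eta ^+ 2) = F t - F 0)%R.
  by rewrite /F expr0n/= addr0 ln_div ?posrE ?exprn_gt0// mulrBr.
apply: (@ge0_FTC_oo _ (fun x => x * (eta ^+ 2 + x ^+ 2)^-1)%R F) => //.
- by move=> x /andP[x0 _]; rewrite mulr_ge0 ?(ltW x0)// invr_ge0 ltW.
- move=> x /andP[x0 _]; apply: continuousM; first exact: cvg_id.
  apply: continuousV; first by rewrite gt_eqF.
  by apply: continuousD; [exact: cst_continuous|exact: exprn_continuous].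
- by apply: cvg_at_right_filter; exact: cF.
- by apply: cvg_at_left_filter; exact: cF.
Qed.

(** The integrand is of order 1 / u down to the cutoff eps^(3/4), hence the factor
    3/4 in front of the logarithm. *)
Lemma integral_weight_log (t eps : R) : (0 < t)%R -> (0 < eps <= 1)%R ->
  (ln t - 1 + 3 / 4 * ln (1 / eps))%:E <= \int[mu]_(u in `]0%R, t[) (u * weight eps u)%:E /\
  \int[mu]_(u in `]0%R, t[) (u * weight eps u)%:E <= (ln (1 + t) + 3 / 4 * ln (1 / eps))%:E.
Proof.
move=> t0 /andP[e0 e1]; pose eta := (eps `^ (3 / 4))%R.
have eta0 : (0 < eta)%R by exact: powR_gt0.
have eta1 : (eta <= 1)%R.
  rewrite /eta; apply: (@le_trans _ _ (1 `^ (3 / 4))%R); last by rewrite powR1.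
  by apply: ge0_ler_powR; rewrite ?nnegrE ?(ltW e0)//; lra.
have lneta : (- ln eta = 3 / 4 * ln (1 / eps))%R.
  by rewrite /eta ln_powR div1r lnV ?posrE// mulrN.
split.
- apply: (@le_trans _ _ (\int[mu]_(u in `]0%R, t[) (u * (eta + u) ^- 2)%:E)).
    rewrite integral_lower_weight// lee_fin -lneta ln_div ?posrE//; last by lra.
    have h1 : (ln t <= ln (eta + t))%R by rewrite ler_ln ?posrE//; lra.
    have h2 : (0 <= eta / (eta + t))%R by rewrite divr_ge0//; lra.
    by move: h1 h2; lra.
  apply: ge0_le_integral_nonmeasurable => //= u; rewrite in_itv/= => /andP[u0 ut]; rewrite ?lee_fin.
  + by rewrite mulr_ge0 ?(ltW u0)// invr_ge0 sqr_ge0.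
  + by rewrite mulr_ge0 ?(ltW u0)// weight_ge0.
  + by have [] := weight_bounds e0 u0.
- apply: (@le_trans _ _ (\int[mu]_(u in `]0%R, t[) (u * (eta ^+ 2 + u ^+ 2)^-1)%:E)).
    apply: ge0_le_integral_nonmeasurable => //= u; rewrite in_itv/= => /andP[u0 ut]; rewrite ?lee_fin.
    + by rewrite mulr_ge0 ?(ltW u0)// weight_ge0.
    + by rewrite mulr_ge0 ?(ltW u0)// invr_ge0 addr_ge0 ?sqr_ge0.
    + by have [] := weight_bounds e0 u0.
  rewrite integral_upper_weight// lee_fin -lneta ln_div ?posrE ?exprn_gt0//; last first.
    by rewrite addr_gt0// exprn_gt0.
  have h1 : (ln (eta ^+ 2 + t ^+ 2) <= ln (1 + t) *+ 2)%R.
    rewrite -lnXn; last by lra.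
    rewrite ler_ln ?posrE ?exprn_gt0 ?addr_gt0 ?exprn_gt0//.
    have : (eta ^+ 2 <= 1)%R by rewrite exprn_ile1 ?(ltW eta0).
    rewrite sqrrD; move: t0; rewrite expr1n mul1r; lra.
  have h2 : (ln (eta ^+ 2) = ln eta *+ 2)%R by rewrite lnXn.
  by rewrite h2 -[(ln eta *+ 2)%R]mulr_natl; move: h1; rewrite -[(ln (1 + t) *+ 2)%R]mulr_natl; lra.
Qed.

End smoothing_weight.

(** * The two moments as integrals *)

Section second_moment.
Context {R : realType}.
Notation mu := (@lebesgue_measure R).
Local Open Scope ereal_scope.

(** The covariance of B_s - B_r with B_y. *)
Definition incr_value_cov (r s y : R) : R := (2^-1 * (incr_var (y - r) - incr_var (y - s) + incr_var s - incr_var r))%R.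

Lemma incr_value_cov_homo r s : (r <= s)%R -> {homo incr_value_cov r s : x y / (x <= y)%R}.
Proof.
move=> rs x y xy; have := incr_var_difference_homo rs xy; rewrite /incr_value_cov.
by move: (incr_var (x - r)) (incr_var (x - s)) (incr_var (y - r)) (incr_var (y - s)) => *; lra.
Qed.

Lemma incr_value_cov0 r s : incr_value_cov r s 0 = 0%R.
Proof. by rewrite /incr_value_cov !sub0r !incr_varN; ring. Qed.

Lemma incr_value_covB r s r' s' : incr_cov r s r' s' = (incr_value_cov r s s' - incr_value_cov r s r')%R.
Proof. by rewrite /incr_value_cov /incr_cov; field. Qed.

Lemma incr_var0 : incr_var 0 = 0%R :> R.
Proof. by rewrite /incr_var normr0 powR0//; lra. Qed.

Lemma incr_value_cov_sym (r s t : R) : incr_value_cov r s t = (incr_value_cov 0 t s - incr_value_cov 0 t r)%R.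
Proof.
by rewrite /incr_value_cov !subr0 incr_var0 [incr_var (s - t)]incr_varB [incr_var (r - t)]incr_varB; field.
Qed.

Lemma incr_value_cov_end (t : R) : incr_value_cov 0 t t = incr_var t.
Proof. by rewrite /incr_value_cov subr0 subrr incr_var0; field. Qed.

Lemma measurable_incr_value_cov r s : measurable_fun [set: R] (incr_value_cov r s).
Proof.
have mv (a : R) : measurable_fun [set: R] (fun y => incr_var (y - a))%R.
  by apply: measurableT_comp; [exact: measurable_incr_var|exact: measurable_funB].
apply: measurable_funM => //; apply: measurable_funB => //; apply: measurable_funD => //.
exact: measurable_funB.
Qed.

Lemma measurable_weight_diff eps : measurable_fun [set: plane R]
  (fun p => weight eps (p.2 - p.1)).
Proof. by apply: measurableT_comp; [exact: measurable_weight|exact: measurable_funB]. Qed.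

(** The ends left by the telescoping cost O(u^2), and u^2 w(u) <= 1. *)
Lemma first_chaos_lower (t : R) : (0 < t)%R -> exists C : R, (0 <= C)%R /\ forall eps : R, (0 < eps)%R ->
  (incr_var t)%:E * \int[mu]_(u in `]0%R, t[) (u * weight eps u)%:E <=
  \int[(mu \x mu)%E]_(p in simplex2 t)
     (weight eps (p.2 - p.1) * (incr_value_cov 0 t p.2 - incr_value_cov 0 t p.1))%:E + C%:E.
Proof.
move=> t0; have [z [z0 tz zt _]] := cube_root (ltW t0).
have kz : (0 <= 7 / 3 * z)%R by rewrite mulr_ge0// divr_ge0.
pose G := incr_value_cov 0 t.
have Gu (u : R) : (0 < u < t)%R -> (G t - (G (t - u) - G u) <= 7 / 3 * z * u)%R.
  move=> /andP[u0 ut].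
  have [x [x0 ux ux4 _]] := cube_root (ltW u0).
  have tu : (0 <= t - u)%R by rewrite subr_ge0 ltW.
  have [y [y0 uy uy4 _]] := cube_root tu.
  have xz : (x <= z)%R by apply: ler_cube => //; rewrite -ux -tz ltW.
  have yz : (y <= z)%R by apply: ler_cube => //; rewrite -uy -tz gerBl ltW.
  have s1 := slope_upper y0 yz; rewrite -tz -uy subKr in s1.
  have s2 : (x ^+ 4 <= z * u)%R by rewrite ux exprS ler_wpM2r ?exprn_ge0.
  rewrite /G /incr_value_cov !subr0 subrr [(t - u - t)%R]addrAC subrr sub0r incr_varN incr_var0 [incr_var (u - t)]incr_varB.
  rewrite !incr_varE ?(ltW u0) ?(ltW t0)// ux4 uy4 zt.
  by move: s1 s2; clear; lra.
exists (7 / 3 * z * t)%R; split; first by rewrite mulr_ge0// ltW.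
move=> eps e0.
have H := @integral_increments_ge _ t G (weight eps) (measurable_incr_value_cov 0 t) (@measurable_weight _ eps)
  (incr_value_cov_homo (ltW t0)) (incr_value_cov0 0 t) (weight_ge0 eps).
apply: le_trans (leeD H (lexx _)).
have mG := measurable_incr_value_cov 0 t; have mw := @measurable_weight _ eps.
pose f u := (weight eps u * (u * Num.max (G (t - u) - G u) 0))%R.
have mf : measurable_fun [set: R] f.
  apply: measurable_funM => //; apply: measurable_funM => //; apply: measurable_maxr => //.
  by apply: measurable_funB => //; apply: measurableT_comp => //; exact: measurable_funB.
rewrite -ge0_integralZl_EFin//; last 3 first.
- by move=> u /=; rewrite in_itv/= => /andP[u0 _]; rewrite lee_fin mulr_ge0 ?weight_ge0 ?(ltW u0).
- by apply/measurable_EFinP/measurable_funTS/measurable_funM.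
- by rewrite powR_ge0.
apply: (@le_trans _ _ (\int[mu]_(u in `]0%R, t[) ((f u)%:E + (cst (7 / 3 * z)%:E u)))).
  apply: ge0_le_integral_nonmeasurable => //= u; rewrite in_itv/= => /andP[u0 ut].
  - by rewrite -EFinM lee_fin !mulr_ge0 ?powR_ge0 ?weight_ge0 ?(ltW u0).
  - by rewrite -EFinD lee_fin addr_ge0// !mulr_ge0 ?weight_ge0 ?(ltW u0)// le_max lexx orbT.
  rewrite -EFinM -EFinD lee_fin -incr_value_cov_end -/G.
  have [_ _ h] := weight_bounds e0 u0.
  have h1 : (G t <= Num.max (G (t - u) - G u) 0 + 7 / 3 * z * u)%R.
    have := Gu u; rewrite u0 ut => /(_ isT).
    have : (G (t - u) - G u <= Num.max (G (t - u) - G u) 0)%R by rewrite le_max lexx.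
    by move: (Num.max _ _) (7 / 3 * z * u)%R => *; lra.
  have uw : (0 <= u * weight eps u)%R by rewrite mulr_ge0 ?weight_ge0 ?(ltW u0).
  apply: (le_trans (ler_wpM2r uw h1)); rewrite mulrDl.
  rewrite (_ : (7 / 3 * z * u * (u * weight eps u) = 7 / 3 * z * (u ^+ 2 * weight eps u))%R); last by ring.
  by rewrite /f lerD ?ler_piMr//; apply: le_of_eq; ring.
rewrite ge0_integralD//; last 2 first.
- move=> u /=; rewrite in_itv/= => /andP[u0 _].
  by rewrite lee_fin !mulr_ge0 ?weight_ge0 ?(ltW u0)// le_max lexx orbT.
- by apply/measurable_EFinP/measurable_funTS.
rewrite leeD2l// integral_cst// [X in _ * X](_ : _ = t%:E) ?EFinM//.
by apply: (etrans (lebesgue_measure_itv _)); rewrite /= lte_fin t0 oppr0 adde0.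
Qed.

(* coincidences with an endpoint of the interval [r, s], which [kernel_bound]
   excludes *)
Let null_points (r s : R) : set (plane R) :=
  ([set r] `*` setT) `|` ([set s] `*` setT) `|` (setT `*` [set r]) `|` (setT `*` [set s]).

Let measurable_null_points r s : measurable (null_points r s).
Proof. by apply: measurableU; [apply: measurableU; [apply: measurableU|]|]; exact: measurableX. Qed.

Let null_null_points r s : (mu \x mu)%E (null_points r s) = 0.
Proof.
have e1 a : (mu \x mu)%E ([set a] `*` setT) = 0.
  rewrite product_measure1E//; apply/eqP; rewrite mule_eq0; apply/orP; left; apply/eqP.
  exact: lebesgue_measure_set1.
have e2 a : (mu \x mu)%E (setT `*` [set a]) = 0.
  rewrite product_measure1E//; apply/eqP; rewrite mule_eq0; apply/orP; right; apply/eqP.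
  exact: lebesgue_measure_set1.
have mX a : measurable ([set a] `*` setT : set (plane R)) by exact: measurableX.
have mY a : measurable (setT `*` [set a] : set (plane R)) by exact: measurableX.
have U0 (A B : set (plane R)) : measurable A -> measurable B ->
    (mu \x mu)%E A = 0 -> (mu \x mu)%E B = 0 -> measurable (A `|` B) /\ (mu \x mu)%E (A `|` B) = 0.
  by move=> mA mB A0 B0; split; [exact: measurableU|exact: etrans (measureU0 mA mB B0) A0].
have [m1 n1] := U0 _ _ (mX r) (mX s) (e1 r) (e1 s).
have [m2 n2] := U0 _ _ m1 (mY r) n1 (e2 r).
by have [] := U0 _ _ m2 (mY s) n2 (e2 s).
Qed.

Lemma integral_ker_inner (t eps : R) (p : R * R) (M l : R) : (0 < t)%R -> (0 < eps)%R -> simplex2 t p ->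
  \int[mu]_(u in `]0%R, t[) (u * weight eps u)%:E <= l%:E -> (0 <= l)%R ->
  \int[(mu \x mu)%E]_(q in simplex2 t)
    (majorant (eps `^ (3 / 4)) `|p.2 - p.1| `|q.2 - q.1| `|q.1 - p.1| `|q.1 - p.2| `|q.2 - p.1| `|q.2 - p.2|)%R%:E <= M%:E ->
  \int[(mu \x mu)%E]_(q in simplex2 t)
    (moment_kernel (eps + incr_var (p.2 - p.1)) (eps + incr_var (q.2 - q.1)) (incr_cov p.1 p.2 q.1 q.2))%:E <=
  (weight eps (p.2 - p.1) * (incr_value_cov 0 t p.2 - incr_value_cov 0 t p.1) * l + 3 * kernel_const * M)%:E.
Proof.
move: p => [r s] t0 e0 /= [/= r0 [rs st]] hl l0 hM.
have ker_ge0 q : simplex2 t q -> (0 <= moment_kernel (eps + incr_var (s - r)) (eps + incr_var (q.2 - q.1)) (incr_cov r s q.1 q.2))%R.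
  by move=> [_ [q12 _]]; rewrite mulr_ge0 ?powR_ge0// incr_cov_ge0// ltW.
have mv : measurable_fun [set: plane R] (fun q => incr_var (q.2 - q.1)).
  by apply: measurableT_comp; [exact: measurable_incr_var|exact: measurable_funB].
have mi : measurable_fun [set: plane R] (fun q => incr_cov r s q.1 q.2).
  under eq_fun do rewrite incr_value_covB.
  by apply: measurable_funB; apply: measurableT_comp => //; exact: measurable_incr_value_cov.
have mk : measurable_fun [set: plane R]
    (fun q => (moment_kernel (eps + incr_var (s - r)) (eps + incr_var (q.2 - q.1)) (incr_cov r s q.1 q.2))%:E).
  apply/measurable_EFinP; apply: measurable_funM => //; apply: measurable_fun_powR.
  apply: measurable_funB; last exact: measurable_funX.
  by apply: measurable_funM => //; exact: measurable_funD.
pose Mq (q : R * R) := majorant (eps `^ (3 / 4)) `|s - r|%R `|q.2 - q.1|%R `|q.1 - r|%R `|q.1 - s|%R `|q.2 - r|%R `|q.2 - s|%R.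
have eta0 : (0 < eps `^ (3 / 4))%R by exact: powR_gt0.
have Mq0 q : (0 <= Mq q)%R by exact: majorant_ge0.
have k0 : (0 <= 3 * @kernel_const R)%R by rewrite mulr_ge0// ltW// kernel_const_gt0.
pose K1 (q : R * R) := (weight eps (s - r) * (weight eps (q.2 - q.1) * (incr_value_cov r s q.2 - incr_value_cov r s q.1)))%R.
have K1E q : first_chaos_kernel (eps + incr_var (s - r)) (eps + incr_var (q.2 - q.1)) (incr_cov r s q.1 q.2) = K1 q.
  by rewrite /first_chaos_kernel /K1 incr_value_covB mulrC -mulrA.
have K10 q : simplex2 t q -> (0 <= weight eps (q.2 - q.1) * (incr_value_cov r s q.2 - incr_value_cov r s q.1))%R.
  by move=> [_ [q12 _]]; rewrite mulr_ge0 ?weight_ge0// subr_ge0 incr_value_cov_homo// ltW.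
have K1_ge0 q : simplex2 t q -> (0 <= K1 q)%R by move=> Dq; rewrite mulr_ge0 ?weight_ge0//; exact: K10.
have mK1 : measurable_fun [set: plane R] (fun q => weight eps (q.2 - q.1) * (incr_value_cov r s q.2 - incr_value_cov r s q.1))%R.
  apply: measurable_funM; first exact: measurable_weight_diff.
  by apply: measurable_funB; apply: measurableT_comp => //; exact: measurable_incr_value_cov.
have mMq : measurable_fun [set: plane R] Mq by exact: measurable_majorant.
rewrite (@ge0_negligible_integral _ _ _ _ _ (null_points r s))//; last 3 first.
- exact: measurable_simplex2.
- exact: measurable_funTS.
- exact: null_null_points.
apply: (@le_trans _ _ (\int[(mu \x mu)%E]_(q in simplex2 t) ((K1 q)%:E + (3 * kernel_const * Mq q)%:E))).
  apply: ge0_le_integral_nonmeasurable.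
  - by move=> q [].
  - by move=> q [/ker_ge0]; rewrite lee_fin.
  - by move=> q Dq; rewrite -EFinD lee_fin addr_ge0// ?K1_ge0// mulr_ge0.
  move=> [r' s'] [[/= r'0 [rs' s't]] N]; rewrite -EFinD lee_fin -K1E; apply: kernel_bound => //;
   apply/negP => /eqP E; apply: N; rewrite /null_points/= E; tauto.
have mD := @measurable_simplex2 R t.
rewrite ge0_integralD//; last 3 first.
- by apply/measurable_EFinP/measurable_funTS; exact: measurable_funM.
- by move=> q _; rewrite lee_fin mulr_ge0.
- by apply/measurable_EFinP/measurable_funTS; exact: measurable_funM.
rewrite EFinD; apply: leeD; last first.
  under eq_integral do rewrite EFinM.
  rewrite ge0_integralZl_EFin//; first by rewrite [leRHS]EFinM lee_wpmul2l ?lee_fin.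
  - by move=> q _; rewrite lee_fin.
  - by apply/measurable_EFinP/measurable_funTS.
under eq_integral do rewrite EFinM.
rewrite ge0_integralZl_EFin//; last 2 first.
- by apply/measurable_EFinP/measurable_funTS.
- exact: weight_ge0.
rewrite -mulrA [leRHS]EFinM lee_wpmul2l ?lee_fin ?weight_ge0// -incr_value_cov_sym.
apply: le_trans (integral_increments_le t0 (measurable_incr_value_cov r s) (@measurable_weight _ eps) (incr_value_cov_homo (ltW rs)) (incr_value_cov0 r s) (weight_ge0 eps)) _.
have ct0 : (0 <= incr_value_cov r s t)%R by rewrite -(incr_value_cov0 r s) incr_value_cov_homo// ltW.
by rewrite [leRHS]EFinM lee_wpmul2l ?lee_fin.
Qed.

(** The first-chaos part is bounded by [integral_increments_le], once in each pair
    of variables, the remainder by [integral_majorant]. *)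
Lemma second_moment_le (t : R) : (0 < t)%R -> exists C : R, (0 <= C)%R /\ forall eps l : R, (0 < eps <= 1)%R ->
  \int[mu]_(u in `]0%R, t[) (u * weight eps u)%:E <= l%:E -> (0 <= l)%R ->
  \int[(mu \x mu)%E]_(p in simplex2 t) \int[(mu \x mu)%E]_(q in simplex2 t)
    (moment_kernel (eps + incr_var (p.2 - p.1)) (eps + incr_var (q.2 - q.1)) (incr_cov p.1 p.2 q.1 q.2))%:E <=
  (incr_var t * l ^+ 2 + C * (1 + ln (1 + t / eps `^ (3 / 4))))%R%:E.
Proof.
move=> t0; have [C [C0 HC]] := integral_majorant t0.
have k0 : (0 <= 3 * @kernel_const R)%R by rewrite mulr_ge0// ltW// kernel_const_gt0.
exists (3 * kernel_const * C)%R; split; first exact: mulr_ge0.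
move=> eps l /andP[e0 e1] hl l0.
have eta0 : (0 < eps `^ (3 / 4))%R by exact: powR_gt0.
have [f [mf f0 f1 f2]] := HC _ eta0.
have mD := @measurable_simplex2 R t.
pose A (p : R * R) := (weight eps (p.2 - p.1) * (incr_value_cov 0 t p.2 - incr_value_cov 0 t p.1))%R.
have A0 p : simplex2 t p -> (0 <= A p)%R.
  by move=> [_ [p12 _]]; rewrite mulr_ge0 ?weight_ge0// subr_ge0 incr_value_cov_homo// ltW.
have mA : measurable_fun [set: plane R] A.
  apply: measurable_funM; first exact: measurable_weight_diff.
  by apply: measurable_funB; apply: measurableT_comp => //; exact: measurable_incr_value_cov.
have mfd : measurable_fun [set: plane R] (fun p => f (p.2 - p.1))%R.
  by apply: measurableT_comp => //; exact: measurable_funB.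
apply: (@le_trans _ _ (\int[(mu \x mu)%E]_(p in simplex2 t) ((l * A p)%:E + (3 * kernel_const * f (p.2 - p.1))%R%:E))).
  apply: ge0_le_integral_nonmeasurable => //.
  - move=> p [_ [p12 _]]; apply: integral_ge0 => q [_ [q12 _]].
    by rewrite lee_fin mulr_ge0 ?powR_ge0// incr_cov_ge0// ltW.
  - by move=> p Dp; rewrite -EFinD lee_fin addr_ge0// mulr_ge0// A0.
  move=> p Dp; have [p1 p2] := simplex2_subset Dp.
  by have := integral_ker_inner t0 e0 Dp hl l0 (f1 _ _ p1 p2); rewrite -EFinD /A [(l * _)%R]mulrC.
rewrite ge0_integralD//; last 4 first.
- by move=> p Dp; rewrite lee_fin mulr_ge0// A0.
- by apply/measurable_EFinP/measurable_funTS; exact: measurable_funM.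
- by move=> p _; rewrite lee_fin mulr_ge0.
- by apply/measurable_EFinP/measurable_funTS; exact: measurable_funM.
rewrite EFinD; apply: leeD; last first.
  under eq_integral do rewrite EFinM.
  rewrite ge0_integralZl_EFin//; first by rewrite -[(3 * kernel_const * C * _)%R]mulrA [leRHS]EFinM lee_wpmul2l ?lee_fin.
  - by move=> q _; rewrite lee_fin.
  - by apply/measurable_EFinP/measurable_funTS.
under eq_integral do rewrite EFinM.
rewrite ge0_integralZl_EFin//; last first.
- by apply/measurable_EFinP/measurable_funTS.
rewrite expr2 mulrCA [leRHS]EFinM lee_wpmul2l ?lee_fin//.
apply: le_trans (integral_increments_le t0 (measurable_incr_value_cov 0 t) (@measurable_weight _ eps) (incr_value_cov_homo (ltW t0)) (incr_value_cov0 0 t) (weight_ge0 eps)) _.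
by rewrite incr_value_cov_end [leRHS]EFinM lee_wpmul2l// lee_fin powR_ge0.
Qed.

End second_moment.

(** * Restricted measures and square-integrable variables *)

Section restriction.
Context d (T : measurableType d) (R : realType) (m : {measure set T -> \bar R}) (D : set T).
Hypotheses (mD : measurable D) (moo : (m D < +oo)%E).

Let restr_density (A : set T) : measurable A ->
  mfrestr mD moo A = (\int[m]_(x in A) (\1_D x)%:E)%E.
Proof. by move=> mA; rewrite integral_indic// setIC. Qed.

(** A restriction to a set of finite measure is a finite measure, with an
    indicator function as density. *)
Lemma integral_mfrestr (f : T -> R) : measurable_fun [set: T] f ->
  (\int[mfrestr mD moo]_x (f x)%:E = \int[m]_(x in D) (f x)%:E)%E.
Proof.
move=> mf; rewrite (@integral_density _ _ _ m (mfrestr mD moo) \1_D)//.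
rewrite [RHS]integral_mkcond; apply: eq_integral => x _; rewrite patchE indicE.
by case: ifPn => _; rewrite ?mulr1 ?mulr0.
Qed.

Lemma ge0_integral_mfrestr (f : T -> \bar R) : measurable_fun [set: T] f -> (forall x, 0 <= f x)%E ->
  (\int[mfrestr mD moo]_x f x = \int[m]_(x in D) f x)%E.
Proof.
move=> mf f0; rewrite (@ge0_integral_density _ _ _ m (mfrestr mD moo) \1_D)//.
rewrite [RHS]integral_mkcond; apply: eq_integral => x _; rewrite patchE indicE.
by case: ifPn => _; rewrite ?mule1 ?mule0.
Qed.

Lemma Rintegral_mfrestr (f : T -> R) : measurable_fun [set: T] f ->
  \int[mfrestr mD moo]_x f x = \int[m]_(x in D) f x.
Proof. by move=> mf; rewrite /Rintegral integral_mfrestr. Qed.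
End restriction.

Section square_integrable.
Context d (T : measurableType d) (R : realType) (P : probability T R).
Implicit Types f g h : T -> R.

Definition square_integrable f : Prop :=
  measurable_fun [set: T] f /\ P.-integrable [set: T] (EFin \o (fun w => f w ^+ 2)).

Definition inner f g : R := \int[P]_w (f w * g w).

Lemma square_integrable_mul f g : square_integrable f -> square_integrable g ->
  P.-integrable [set: T] (EFin \o (fun w => f w * g w)).
Proof.
move=> [mf f2] [mg g2].
apply: (@le_integrable _ _ _ P _ _ _ (fun w => (f w ^+ 2)%:E + (g w ^+ 2)%:E)%E) => //.
- by apply/measurable_EFinP; exact: measurable_funM.
- move=> w _; rewrite -EFinD !abse_EFin lee_fin [leRHS]ger0_norm ?addr_ge0 ?sqr_ge0//.
  rewrite normrM -[f w ^+ 2]real_normK ?num_real// -[g w ^+ 2]real_normK ?num_real//.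
  move: (normr_ge0 (f w)) (normr_ge0 (g w)); move: `|f w| `|g w| => x y.
  by have := sqr_ge0 (x - y); nra.
- exact: integrableD.
Qed.

Lemma bounded_square_integrable f M : measurable_fun [set: T] f -> (forall w, `|f w| <= M) ->
  square_integrable f.
Proof.
move=> mf fM; split => //.
apply: measurable_bounded_integrable => //.
- by rewrite ltey_eq fin_num_measure.
- exact: measurable_funX.
- exists (M ^+ 2); split => [|x Mx w _ /=]; first by rewrite num_real.
  apply: le_trans (ltW Mx); rewrite normrX; apply: lerXn2r; rewrite ?nnegrE//.
  exact: le_trans (fM w).
Qed.

Lemma square_integrable_integrable f : square_integrable f -> P.-integrable [set: T] (EFin \o f).
Proof.
move=> Lf; have L1 : square_integrable (fun=> 1) by apply: (@bounded_square_integrable _ 1) => // w; rewrite normr1.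
have := square_integrable_mul Lf L1.
by rewrite (_ : _ \o _ = EFin \o f)//; apply/funext => w /=; rewrite mulr1.
Qed.

Lemma square_integrableZ a f : square_integrable f -> square_integrable (fun w => a * f w).
Proof.
move=> [mf f2]; split; first exact: measurable_funM.
rewrite (_ : _ \o _ = (fun w => (a ^+ 2)%:E * (f w ^+ 2)%:E)%E); first exact: integrableZl.
by apply/funext => w /=; rewrite exprMn.
Qed.

Lemma square_integrableD f g : square_integrable f -> square_integrable g ->
  square_integrable (fun w => f w + g w).
Proof.
move=> Lf Lg; have fg := square_integrable_mul Lf Lg; case: Lf => mf f2; case: Lg => mg g2.
split; first exact: measurable_funD.
rewrite (_ : _ \o _ = (fun w => (f w ^+ 2)%:E + 2%:E * (f w * g w)%:E + (g w ^+ 2)%:E)%E).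
  by apply: integrableD => //; apply: integrableD => //; exact: integrableZl.
by apply/funext => w /=; rewrite -EFinM -!EFinD; congr EFin; ring.
Qed.

Lemma innerC f g : inner f g = inner g f.
Proof. by apply: eq_Rintegral => w _; rewrite mulrC. Qed.

Lemma innerZl a f g : square_integrable f -> square_integrable g ->
  inner (fun w => a * f w) g = a * inner f g.
Proof.
move=> Lf Lg; rewrite -RintegralZl//; last exact: square_integrable_mul.
by apply: eq_Rintegral => w _; rewrite mulrA.
Qed.

Lemma innerDl f g h : square_integrable f -> square_integrable g -> square_integrable h ->
  inner (fun w => f w + g w) h = inner f h + inner g h.
Proof.
move=> Lf Lg Lh; rewrite -RintegralD//; [|exact: square_integrable_mul..].
by apply: eq_Rintegral => w _; rewrite mulrDl.
Qed.

Lemma square_integrableN f : square_integrable f -> square_integrable (fun w => - f w).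
Proof. by move=> /(square_integrableZ (-1)); under eq_fun do rewrite mulN1r. Qed.

Lemma square_integrableB f g : square_integrable f -> square_integrable g ->
  square_integrable (fun w => f w - g w).
Proof. by move=> Lf Lg; apply: square_integrableD => //; exact: square_integrableN. Qed.

Lemma innerBl f g h : square_integrable f -> square_integrable g -> square_integrable h ->
  inner (fun w => f w - g w) h = inner f h - inner g h.
Proof.
move=> Lf Lg Lh; rewrite innerDl//; last exact: square_integrableN.
congr (_ + _); rewrite -mulN1r -innerZl//.
by apply: eq_Rintegral => w _; rewrite mulN1r.
Qed.

Lemma innerBr f g h : square_integrable f -> square_integrable g -> square_integrable h ->
  inner h (fun w => f w - g w) = inner h f - inner h g.
Proof. by move=> Lf Lg Lh; rewrite innerC innerBl// ![inner _ h]innerC. Qed.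

Lemma innerDr f g h : square_integrable f -> square_integrable g -> square_integrable h ->
  inner h (fun w => f w + g w) = inner h f + inner h g.
Proof. by move=> Lf Lg Lh; rewrite innerC innerDl// ![inner _ h]innerC. Qed.

Lemma innerZr a f g : square_integrable f -> square_integrable g ->
  inner g (fun w => a * f w) = a * inner g f.
Proof. by move=> Lf Lg; rewrite innerC innerZl// innerC. Qed.

Lemma inner_ge0 f : 0 <= inner f f.
Proof. by apply: Rintegral_ge0 => w _; rewrite -expr2 sqr_ge0. Qed.

Lemma inner_lin2 f g a b : square_integrable f -> square_integrable g ->
  inner (fun w => a * f w + b * g w) (fun w => a * f w + b * g w) =
  a ^+ 2 * inner f f + 2 * a * b * inner f g + b ^+ 2 * inner g g.
Proof.
move=> Lf Lg; have La := square_integrableZ a Lf; have Lb := square_integrableZ b Lg.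
rewrite innerDl//; last exact: square_integrableD.
rewrite !innerDr// !innerZl// !innerZr// (innerC g f); ring.
Qed.

Lemma cauchy_schwarz f g : square_integrable f -> square_integrable g -> 0 < inner f f ->
  inner f g ^+ 2 <= inner f f * inner g g.
Proof.
move=> Lf Lg f0.
have := inner_ge0 (fun w => inner f g * f w + (- inner f f) * g w).
rewrite inner_lin2//; move: (inner f f) (inner f g) (inner g g) f0 => x y z x0.
rewrite (_ : _ + _ = x * (x * z - y ^+ 2)); last by ring.
by rewrite pmulr_rge0// subr_ge0.
Qed.
End square_integrable.

(** * Fractional Brownian motion of index 2/3 *)

Section path.
Context {R : realType} d (T : measurableType d) (P : probability T R) (B : R -> {RV P >-> R}).
Hypothesis hB : fractional_brownian_motion (2 / 3) B.

Let exponent : 2 * (2 / 3) = 4 / 3 :> R. Proof. by field. Qed.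

Lemma fbm_expectation t : 0 <= t -> (\int[P]_w (B t w)%:E = 0)%E.
Proof. by move=> t0; have := fbm_centered hB t0; rewrite unlock. Qed.

Lemma fbm_integral_mul (s t : R) : 0 <= s -> 0 <= t ->
  (\int[P]_w (B s w * B t w)%:E = (2^-1 * (incr_var s + incr_var t - incr_var (s - t)))%:E)%E.
Proof.
move=> s0 t0; have := fbm_covariance hB s0 t0; rewrite unlock => ->.
by rewrite exponent (incr_varE s0) (incr_varE t0).
Qed.

Lemma fbm_square_integrable t : 0 <= t -> square_integrable P (B t).
Proof.
move=> t0; split; first exact: measurable_funP.
apply/integrableP; split; first by apply/measurable_EFinP/measurable_funX; exact: measurable_funP.
have := fbm_integral_mul t0 t0.
under [X in X = _ -> _]eq_integral do rewrite -expr2.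
move=> E; rewrite (eq_integral (fun w => (B t w ^+ 2)%:E)) ?E ?ltry// => w _.
by rewrite /= ger0_norm ?sqr_ge0.
Qed.

Lemma fbm_inner s t : 0 <= s -> 0 <= t ->
  inner P (B s) (B t) = 2^-1 * (incr_var s + incr_var t - incr_var (s - t)).
Proof. by move=> s0 t0; rewrite /inner /Rintegral fbm_integral_mul. Qed.

Definition increment r s : T -> R := fun w => B s w - B r w.

Lemma increment_square_integrable r s : 0 <= r -> 0 <= s -> square_integrable P (increment r s).
Proof. by move=> r0 s0; apply: square_integrableB; exact: fbm_square_integrable. Qed.

Lemma inner_increment_end r s t : 0 <= r -> 0 <= s -> 0 <= t ->
  inner P (increment r s) (B t) = incr_value_cov r s t.
Proof.
move=> r0 s0 t0; rewrite innerBl; [|exact: fbm_square_integrable..].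
rewrite !fbm_inner// /incr_value_cov [incr_var (s - t)]incr_varB [incr_var (r - t)]incr_varB; ring.
Qed.

Lemma inner_increment r s r' s' : 0 <= r -> 0 <= s -> 0 <= r' -> 0 <= s' ->
  inner P (increment r s) (increment r' s') = incr_cov r s r' s'.
Proof.
move=> r0 s0 r'0 s'0; have L := increment_square_integrable r0 s0.
rewrite innerBr//; [|exact: fbm_square_integrable..].
by rewrite !inner_increment_end// incr_value_covB.
Qed.

Lemma incr_cov_diag (r s : R) : incr_cov r s r s = incr_var (s - r).
Proof. by rewrite /incr_cov !subrr incr_var0 [incr_var (r - s)]incr_varB; field. Qed.

(** The Gaussian space of the process: laws of its elements are known from their
    variances. *)
Definition path_combination (Y : T -> R) : Prop :=
  exists n (a s : 'I_n -> R), (forall i, 0 <= s i) /\ Y = (fun w => \sum_(i < n) a i * B (s i) w).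

Lemma path_combination_value t : 0 <= t -> path_combination (B t).
Proof.
move=> t0; exists 1%N, (fun=> 1), (fun=> t); split => //.
by apply/funext => w; rewrite big_ord1 mul1r.
Qed.

Lemma path_combinationZ c Y : path_combination Y -> path_combination (fun w => c * Y w).
Proof.
move=> [n [a [s [s0 ->]]]]; exists n, (fun i => c * a i), s; split => //.
by apply/funext => w; rewrite mulr_sumr; apply: eq_bigr => i _; rewrite mulrA.
Qed.

Lemma path_combinationD Y Z : path_combination Y -> path_combination Z ->
  path_combination (fun w => Y w + Z w).
Proof.
move=> [n [a [s [s0 ->]]]] [m [b [u [u0 ->]]]].
exists (n + m)%N, (fun i : 'I_(n + m) => match fintype.split i with inl j => a j | inr j => b j end),
  (fun i : 'I_(n + m) => match fintype.split i with inl j => s j | inr j => u j end); split.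
  by move=> i; case: (fintype.split i).
apply/funext => w; rewrite big_split_ord/=; congr (_ + _); apply: eq_bigr => i _.
  by rewrite (unsplitK (inl i)).
by rewrite (unsplitK (inr i)).
Qed.

Lemma path_combination_increment r s : 0 <= r -> 0 <= s -> path_combination (increment r s).
Proof.
move=> r0 s0; rewrite (_ : increment r s = fun w => B s w + -1 * B r w).
  by apply: path_combinationD; [|apply: path_combinationZ]; exact: path_combination_value.
by apply/funext => w; rewrite mulN1r.
Qed.

Lemma path_combination_centered Y : path_combination Y ->
  square_integrable P Y /\ \int[P]_w Y w = 0.
Proof.
move=> [n [a [s [s0 ->]]]]; elim: n a s s0 => [|n IH] a s s0.
  under eq_fun do rewrite big_ord0.
  split; last by rewrite /Rintegral integral0.
  by apply: (@bounded_square_integrable _ _ _ _ _ 0) => // w; rewrite normr0.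
under eq_fun do rewrite big_ord_recr/=.
have [L I0] := IH (fun i => a (widen_ord (leqnSn n) i)) (fun i => s (widen_ord (leqnSn n) i)) (fun i => s0 _).
have LB := square_integrableZ (a ord_max) (fbm_square_integrable (s0 ord_max)).
split; first exact: square_integrableD.
rewrite RintegralD//; [|exact: square_integrable_integrable..].
rewrite I0 add0r RintegralZl//; last exact/square_integrable_integrable/fbm_square_integrable.
by rewrite /Rintegral fbm_expectation// mulr0.
Qed.

Lemma path_combination_gaussian Y : path_combination Y ->
  [/\ measurable_fun [set: T] Y, gaussian P Y, (\int[P]_w (Y w)%:E = 0)%E &
      (\int[P]_w (Y w ^+ 2)%:E = (inner P Y Y)%:E)%E].
Proof.
move=> cY; have [L I0] := path_combination_centered cY; split.
- by case: L.
- by move: cY => [n [a [s [s0 ->]]]]; exact: (fbm_gaussian hB).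
- by rewrite integral_EFin_Rintegral ?I0//; exact: square_integrable_integrable.
- by rewrite integral_EFin_Rintegral//; case: L.
Qed.

Lemma path_combination_cos X Y a b : path_combination X -> path_combination Y ->
  \int[P]_w cos (a * X w + b * Y w) =
  expR (- ((a ^+ 2 * inner P X X + 2 * a * b * inner P X Y + b ^+ 2 * inner P Y Y) / 2)).
Proof.
move=> cX cY; have cZ := path_combinationD (path_combinationZ a cX) (path_combinationZ b cY).
have [m g e1 e2] := path_combination_gaussian cZ.
rewrite /Rintegral (gaussian_expectation_cos m g e1 e2)/=.
have [LX _] := path_combination_centered cX; have [LY _] := path_combination_centered cY.
by rewrite inner_lin2.
Qed.
End path.

(** * Expectations of kernels at increments *)

Section kernel_expectations.
Context {R : realType} d (T : measurableType d) (P : probability T R) (B : R -> {RV P >-> R}).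
Hypothesis hB : fractional_brownian_motion (2 / 3) B.
Implicit Types eps del : R.

Lemma expectation_kernel_pair eps del X Y : 0 < eps -> 0 < del ->
  path_combination B X -> path_combination B Y -> 0 < inner P X X ->
  \int[P]_w (derive1 (heat_kernel eps) (X w) * derive1 (heat_kernel del) (Y w)) =
  (2 * pi)^-1 * moment_kernel (eps + inner P X X) (del + inner P Y Y) (inner P X Y).
Proof.
move=> e0 d0 cX cY X0.
have [LX _] := path_combination_centered hB cX; have [LY _] := path_combination_centered hB cY.
rewrite (@expectation_heat_kernel_pair _ _ _ P eps del X Y (inner P X X) (inner P X Y) (inner P Y Y))//.
- by rewrite /moment_kernel mulrCA mulrA.
- exact: ltW.
- exact: inner_ge0.
- exact: cauchy_schwarz.
- by case: LX.
- by case: LY.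
- by move=> a b; exact: (path_combination_cos hB).
Qed.

Let scaled_kernel del y : 0 < del ->
  del * Num.sqrt (2 * pi * del) * derive1 (heat_kernel del) y = - (y * gauss_weight del^-1 y).
Proof.
move=> d0; have p0 : 0 < pi :> R := pi_gt0 R.
rewrite derive1_heat_kernel// heat_kernelE//.
have : Num.sqrt (2 * pi * del) != 0 by rewrite gt_eqF// sqrtr_gt0 !mulr_gt0.
move: (Num.sqrt _) (gauss_weight _ _) => q g q0; field.
by rewrite q0 gt_eqF.
Qed.

(** The derivative of a wide heat kernel is linear, up to normalisation: this is
    the limit of [expectation_kernel_pair] for infinite del. *)
Lemma expectation_kernel_linear eps X Y : 0 < eps ->
  path_combination B X -> path_combination B Y -> 0 < inner P X X ->
  \int[P]_w (- derive1 (heat_kernel eps) (X w) * Y w) =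
  (Num.sqrt (2 * pi))^-1 * (inner P X Y * (eps + inner P X X) `^ (- (3 / 2))).
Proof.
move=> e0 cX cY X0.
have [[mX X2] _] := path_combination_centered hB cX; have [LY _] := path_combination_centered hB cY.
have [mY _] := LY.
set lam := inner P X X; set mu := inner P X Y; set rho := inner P Y Y.
have p0 : 0 < pi :> R := pi_gt0 R.
have p2 : 0 < 2 * pi :> R by rewrite mulr_gt0.
have [M [M0 fM]] := heat_kernel_derive1_bounded e0.
pose del (n : nat) : R := n.+1%:R.
have d0 n : 0 < del n by rewrite /del ltr0n.
pose k n := del n * Num.sqrt (2 * pi * del n).
pose f n w := derive1 (heat_kernel eps) (X w) * (k n * derive1 (heat_kernel (del n)) (Y w)).
have mfX : measurable_fun [set: T] (fun w => derive1 (heat_kernel eps) (X w)).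
  by apply: measurableT_comp => //; exact: measurable_derive1_heat_kernel.
have gw1 (A y : R) : 0 <= A -> gauss_weight A y <= 1.
  by move=> A0; rewrite -[leRHS]expR0 ler_expR oppr_le0 divr_ge0// mulr_ge0// sqr_ge0.
have fE n w : f n w = - derive1 (heat_kernel eps) (X w) * (Y w * gauss_weight (del n)^-1 (Y w)).
  by rewrite /f scaled_kernel// mulrN mulNr.
have h0 : (del n)^-1 @[n --> \oo] --> (0 : R) by exact: cvg_harmonic.
have lhs : (\int[P]_w (f n w)%:E @[n --> \oo] --> \int[P]_w (- derive1 (heat_kernel eps) (X w) * Y w)%:E)%E.
  apply: (@dominated_cvg _ _ _ P _ _ _ _ (fun w => (M * `|Y w|)%:E)) => //.
  - move=> n; apply/measurable_EFinP; apply: measurable_funM => //; apply: measurable_funM => //.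
    by apply: measurableT_comp => //; exact: measurable_derive1_heat_kernel.
  - move=> w _; apply: cvg_EFin; first exact: nearW.
    rewrite (_ : _ \o _ = fun n => - derive1 (heat_kernel eps) (X w) * (Y w * gauss_weight (del n)^-1 (Y w))); last first.
      by apply/funext => n /=; rewrite fE.
    apply: cvgMr; rewrite -[X in _ --> X]mulr1; apply: cvgMr.
    have -> : 1 = gauss_weight 0 (Y w) by rewrite /gauss_weight mul0r mul0r oppr0 expR0.
    rewrite /gauss_weight; apply: continuous_cvg; first exact: continuous_expR.
    by apply: cvgN; apply: cvgMl; exact: cvgMl.
  - have := square_integrable_integrable LY => /integrable_norm iY.
    rewrite (_ : (fun w => _) = (fun w => M%:E * `|(Y w)%:E|)%E); first exact: integrableZl.
    by apply/funext => w; rewrite EFinM.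
  - move=> n w _; rewrite abse_EFin lee_fin fE normrM normrN; apply: ler_pM => //.
    rewrite normrM (ger0_norm (ltW (gauss_weight_gt0 _ _))) ler_piMr// gw1// invr_ge0 ltW//.
have rhs n : (\int[P]_w (f n w)%:E = ((Num.sqrt (2 * pi))^-1 *
    (mu * (eps + lam + (del n)^-1 * ((eps + lam) * rho - mu ^+ 2)) `^ (- (3 / 2))))%:E)%E.
  have [N [N0 fN]] := heat_kernel_derive1_bounded (d0 n).
  have mfY : measurable_fun [set: T] (fun w => derive1 (heat_kernel (del n)) (Y w)).
    by apply: measurableT_comp => //; exact: measurable_derive1_heat_kernel.
  have i := square_integrable_mul (bounded_square_integrable P mfX (fun w => fM (X w)))
    (bounded_square_integrable P mfY (fun w => fN (Y w))).
  have fk w : f n w = k n * (derive1 (heat_kernel eps) (X w) * derive1 (heat_kernel (del n)) (Y w)).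
    by rewrite /f mulrCA.
  under eq_integral do rewrite fk EFinM.
  rewrite integralZl// integral_EFin_Rintegral// expectation_kernel_pair// -EFinM; congr EFin.
  rewrite -/lam -/mu -/rho /moment_kernel /k.
  have rl : mu ^+ 2 <= lam * rho by exact: cauchy_schwarz.
  have rho0 : 0 <= rho by exact: inner_ge0.
  have c0 : 0 <= (eps + lam) * rho - mu ^+ 2.
    by rewrite mulrDl; have := mulr_ge0 (ltW e0) rho0; lra.
  have dn := d0 n; set Q := eps + lam + _.
  have Q0 : 0 <= Q by rewrite !addr_ge0// ?mulr_ge0 ?invr_ge0// ltW.
  have -> : (eps + lam) * (del n + rho) - mu ^+ 2 = del n * Q.
    by rewrite /Q; field; rewrite gt_eqF.
  rewrite powRM ?(ltW dn)// sqrtrM ?(ltW p2)//.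
  have s2 : Num.sqrt (2 * pi) ^+ 2 = 2 * pi :> R by rewrite sqr_sqrtr// ltW.
  have s0 : Num.sqrt (2 * pi) != 0 :> R by rewrite gt_eqF// sqrtr_gt0.
  have dE : del n * Num.sqrt (del n) * del n `^ (- (3 / 2)) = 1.
    rewrite -powR12_sqrt ?(ltW dn)// -[X in X * _ * _](powRr1 (ltW dn)) -!powRD ?(gt_eqF dn) ?implybT//.
    by rewrite (_ : 1 + 2^-1 + - (3 / 2) = 0) ?powRr0//; field.
  move: (Num.sqrt (2 * pi)) s2 s0 => q s2 q0; rewrite -s2.
  move: dE; move: (Q `^ (- (3 / 2))) => b; move: (del n `^ (- (3 / 2))) => a.
  move: (Num.sqrt (del n)) => g; move: (del n) => e E.
  transitivity (q^-1 * (mu * b) * (e * g * a)); last by rewrite E mulr1.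
  by field.
have rhsl : ((Num.sqrt (2 * pi))^-1 *
    (mu * (eps + lam + (del n)^-1 * ((eps + lam) * rho - mu ^+ 2)) `^ (- (3 / 2))))%:E @[n --> \oo] -->
  ((Num.sqrt (2 * pi))^-1 * (mu * (eps + lam) `^ (- (3 / 2))))%:E.
  apply: cvg_EFin; first exact: nearW.
  apply: cvgMr; apply: cvgMr.
  apply: (@continuous_cvg _ _ _ _ _ _ (fun x : R => x `^ (- (3 / 2)))).
    by apply: continuous_powR; rewrite addr_gt0.
  rewrite -[X in _ --> X]addr0; apply: cvgD; first exact: cvg_cst.
  by rewrite -[X in _ --> X](mul0r ((eps + lam) * rho - mu ^+ 2)); exact: cvgMl.
move: lhs; rewrite (funext rhs) => lhs.
have E := cvg_unique _ lhs rhsl.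
by rewrite /Rintegral E.
Qed.

End kernel_expectations.

(** * Moments of the smoothed derivative *)

Section smoothed_derivative.
Context {R : realType} d (T : measurableType d) (P : probability T R) (B : R -> {RV P >-> R}).
Hypothesis hB : fractional_brownian_motion (2 / 3) B.
Notation leb := (@lebesgue_measure R).
Variables (t eps : R).
Hypotheses (t0 : 0 < t) (e0 : 0 < eps).

Let D : set (plane R) := simplex2 t.

Lemma simplex2_finite : ((leb \x leb) D < +oo)%E.
Proof.
pose I := `]0%R, t[%classic : set (measurableTypeR R).
have mI : measurable I by exact: measurable_itv.
have mII : measurable (I `*` I) by exact: measurableX.
apply: (@le_lt_trans _ _ ((leb \x leb)%E (I `*` I))).
  apply: le_measure; rewrite ?inE//; first exact: measurable_simplex2.
  by move=> p /simplex2_subset[h1 h2]; split; rewrite /I/= in_itv.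
have lebI : leb I = t%:E by apply: (etrans (lebesgue_measure_itv _)); rewrite /= lte_fin t0 oppr0 adde0.
rewrite product_measure1E// [X in (X * _)%E](_ : _ = t%:E)//.
by rewrite [X in (_ * X)%E](_ : _ = t%:E)// -EFinM ltry.
Qed.

Let mD := @measurable_simplex2 R t.
(* Lebesgue measure on the simplex, as a finite measure on the plane *)
Let nu := mfrestr mD simplex2_finite.

(* extended by 0 outside the simplex, where the times may be negative and the
   path is not jointly measurable *)
Let phi (z : T * (plane R)) : R :=
  ((fun z : T * (plane R) => derive1 (heat_kernel eps) (increment B z.2.1 z.2.2 z.1)) \_ (setT `*` D)) z.

Let phiE w p : D p -> phi (w, p) = derive1 (heat_kernel eps) (increment B p.1 p.2 w).
Proof. by move=> Dp; rewrite /phi patchE mem_set. Qed.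

Let phi0 w p : ~ D p -> phi (w, p) = 0.
Proof. by move=> Dp; rewrite /phi patchE memNset// => -[]. Qed.

Let measurable_phi : measurable_fun [set: T * (plane R)] phi.
Proof.
apply/(measurable_restrictT _ _).1; first exact: measurableX.
apply: (@measurable_comp _ _ _ _ _ _ setT) => //; first exact: measurable_derive1_heat_kernel.
have mB (h : (plane R) -> R) : measurable_fun [set: plane R] h -> (forall p, D p -> 0 <= h p) ->
    measurable_fun ([set: T] `*` D) (fun z => B (h z.2) z.1).
  move=> mh h0; apply: (@measurable_comp _ _ _ _ _ _ [set p : T * measurableTypeR R | 0 <= p.2] (fun p => B p.2 p.1) _ (fun z : T * (plane R) => (z.1, h z.2))).
  - rewrite (_ : [set p | _] = setT `*` `[0, +oo[%classic); first by apply: measurableX.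
    by apply/seteqP; split => p /=; rewrite in_itv/= andbT; tauto.
  - by move=> _ [z [_ Dz] <-] /=; exact: h0.
  - exact: fbm_measurable hB.
  - apply: measurable_funTS; apply: measurable_fun_pair => //.
    by apply: measurableT_comp.
apply: measurable_funB.
- by apply: (mB snd) => // p [? [? ?]]; lra.
- by apply: (mB fst) => // p [? [? ?]]; lra.
Qed.

Let M := sval (cid (heat_kernel_derive1_bounded e0)).

Let M0 : 0 <= M. Proof. by rewrite /M; case: cid => /= ? []. Qed.

Let phiM z : `|phi z| <= M.
Proof.
rewrite /phi patchE; case: ifPn => _; last by rewrite normr0.
by rewrite /M; case: cid => /= ? [].
Qed.

Let alphaE w : alpha_hat' B t eps w = - \int[nu]_p phi (w, p).
Proof.
rewrite /alpha_hat' Rintegral_mfrestr; last exact: measurable_fun_pair2.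
by congr (- _); apply: eq_Rintegral => p /set_mem Dp; rewrite phiE.
Qed.

(** Fubini's theorem against a random factor G. *)
Let swap (G : T -> R) : measurable_fun [set: T] G -> P.-integrable [set: T] (EFin \o G) ->
  [/\ \int[P]_w (G w * alpha_hat' B t eps w) = - (\int[nu]_p \int[P]_w (G w * phi (w, p))),
      P.-integrable [set: T] (fun w => (\int[nu]_p (G w * phi (w, p)))%:E) &
      nu.-integrable [set: plane R] (fun p => (\int[P]_w (G w * phi (w, p)))%:E)].
Proof.
move=> mG iG.
have mF : measurable_fun [set: T * (plane R)] (fun z => G z.1 * phi z).
  by apply: measurable_funM => //; exact: measurableT_comp.
have ik : P.-integrable [set: T] (EFin \o (fun w => M * `|G w|)).
  rewrite (_ : _ \o _ = (fun w => M%:E * `|(G w)%:E|)%E); last by apply/funext => w /=; rewrite EFinM.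
  by apply: integrableZl => //; exact: integrable_norm iG.
have ih : nu.-integrable [set: plane R] (EFin \o (fun=> 1)).
  exact: finite_measure_integrable_cst.
have [|E i1 i2] := @Rintegral_swap _ _ _ _ _ P nu (fun z => G z.1 * phi z) _ _ mF ik ih.
  by move=> w p /=; rewrite mulr1 normrM mulrC ler_wpM2r.
split => //; rewrite -E.
have iphi w : nu.-integrable [set: plane R] (EFin \o (fun p => phi (w, p))).
  apply: measurable_bounded_integrable => //.
  - by rewrite ltey_eq fin_num_measure.
  - exact: measurable_fun_pair2.
  - by exists M; split => [|x Mx p _ /=]; [rewrite num_real|exact: le_trans (phiM _) (ltW Mx)].
transitivity (\int[P]_w (- 1 * \int[nu]_p (G w * phi (w, p)))).
  apply: eq_Rintegral => w _; rewrite alphaE mulrN mulN1r; congr (- _).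
  by rewrite RintegralZl.
by rewrite RintegralZl// mulN1r.
Qed.

Let alpha_measurable : measurable_fun [set: T] (alpha_hat' B t eps).
Proof.
have i1 : P.-integrable [set: T] (EFin \o (fun=> 1:R)) by exact: finite_measure_integrable_cst.
have [_ i _] := swap (measurable_cst (1 : R)) i1.
rewrite (_ : alpha_hat' _ _ _ = fun w => - \int[nu]_p (1 * phi (w, p))).
  by apply: measurable_funN; apply/measurable_EFinP; exact: measurable_int i.
by apply/funext => w; rewrite alphaE; congr (- _); apply: eq_Rintegral => p _; rewrite mul1r.
Qed.

Let alpha_bounded : exists K, forall w, `|alpha_hat' B t eps w| <= K.
Proof.
exists (M * fine (nu setT)) => w; rewrite alphaE normrN.
have iphi : nu.-integrable [set: plane R] (EFin \o (fun p => phi (w, p))).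
  apply: measurable_bounded_integrable => //.
  - by rewrite ltey_eq fin_num_measure.
  - exact: measurable_fun_pair2.
  - by exists M; split => [|x Mx p _ /=]; [rewrite num_real|exact: le_trans (phiM _) (ltW Mx)].
apply: (le_trans (le_normr_Rintegral _ iphi)) => //.
rewrite -Rintegral_cst//.
apply: le_Rintegral => //; first exact: integrable_norm iphi.
exact: finite_measure_integrable_cst.
Qed.

Lemma alpha_square_integrable : square_integrable P (alpha_hat' B t eps).
Proof. by have [K aK] := alpha_bounded; exact: (bounded_square_integrable P alpha_measurable aK). Qed.

Let phi_square_integrable p : square_integrable P (fun w => phi (w, p)).
Proof. by apply: bounded_square_integrable => //; exact: measurable_fun_pair1. Qed.

Let kappa p q := \int[P]_w (phi (w, p) * phi (w, q)).

Let kappa_off p q : ~ D p \/ ~ D q -> kappa p q = 0.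
Proof.
move=> H; rewrite /kappa /Rintegral (_ : (fun w => _) = cst 0%E) ?integral0//.
by apply/funext => w /=; case: H => /phi0 ->; rewrite ?mul0r ?mulr0.
Qed.

Let D_ge0 p : D p -> 0 <= p.1 /\ 0 <= p.2.
Proof. by move=> [? [? ?]]; split; lra. Qed.

Let increment_pos p : D p -> 0 < inner P (increment B p.1 p.2) (increment B p.1 p.2).
Proof.
move=> Dp; have [p1 p2] := D_ge0 Dp; rewrite (inner_increment hB)// incr_cov_diag incr_varE.
  by apply: powR_gt0; case: Dp => _ [? _]; rewrite subr_gt0.
by case: Dp => _ [? _]; rewrite subr_ge0 ltW.
Qed.

Let kappaE p q : D p -> D q -> kappa p q =
  (2 * pi)^-1 * moment_kernel (eps + incr_var (p.2 - p.1)) (eps + incr_var (q.2 - q.1)) (incr_cov p.1 p.2 q.1 q.2).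
Proof.
move=> Dp Dq; have [p1 p2] := D_ge0 Dp; have [q1 q2] := D_ge0 Dq.
rewrite -2!incr_cov_diag -!(inner_increment hB)// -(expectation_kernel_pair hB)//.
- by apply: eq_Rintegral => w _; rewrite !phiE.
- exact: path_combination_increment.
- exact: path_combination_increment.
- exact: increment_pos.
Qed.

Let kappa_ge0 p q : 0 <= kappa p q.
Proof.
have p0 : 0 < pi :> R := pi_gt0 R.
have [Dp|Dp] := pselect (D p); last by rewrite kappa_off//; left.
have [Dq|Dq] := pselect (D q); last by rewrite kappa_off//; right.
rewrite kappaE//; apply: mulr_ge0; first by rewrite invr_ge0 mulr_ge0// ltW.
apply: mulr_ge0; last exact: powR_ge0.
by case: Dp Dq => _ [? _] [_ [? _]]; apply: incr_cov_ge0; exact: ltW.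
Qed.

(** Fubini's theorem is used against alpha' itself first, then against the
    integrand at a fixed point of the simplex. *)
Lemma inner_alpha_alpha :
  ((2 * pi)%:E * (inner P (alpha_hat' B t eps) (alpha_hat' B t eps))%:E =
  \int[(leb \x leb)%E]_(p in simplex2 t) \int[(leb \x leb)%E]_(q in simplex2 t)
    (moment_kernel (eps + incr_var (p.2 - p.1)) (eps + incr_var (q.2 - q.1)) (incr_cov p.1 p.2 q.1 q.2))%:E)%E.
Proof.
have p0 : 0 < pi :> R := pi_gt0 R.
have p20 : 0 < 2 * pi :> R by rewrite mulr_gt0.
have Lalpha := alpha_square_integrable.
have [E1 _ i1] := swap Lalpha.1 (square_integrable_integrable Lalpha).
have in1 p : \int[P]_w (alpha_hat' B t eps w * phi (w, p)) = - \int[nu]_q kappa p q.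
  have Lp := phi_square_integrable p.
  have [E _ _] := swap Lp.1 (square_integrable_integrable Lp).
  by rewrite -E; apply: eq_Rintegral => w _; rewrite mulrC.
have ik p : nu.-integrable [set: plane R] (fun q => (kappa p q)%:E).
  have Lp := phi_square_integrable p.
  by have [_ _] := swap Lp.1 (square_integrable_integrable Lp).
have ikk : nu.-integrable [set: plane R] (fun p => (\int[nu]_q kappa p q)%:E).
  rewrite (_ : (fun p => _) = (fun p => (-1)%:E * (\int[P]_w (alpha_hat' B t eps w * phi (w, p)))%:E)%E).
    exact: integrableZl.
  by apply/funext => p; rewrite in1 -EFinM mulN1r opprK.
have EE : inner P (alpha_hat' B t eps) (alpha_hat' B t eps) = \int[nu]_p \int[nu]_q kappa p q.
  rewrite /inner E1 -mulN1r -RintegralZl//.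
  by apply: eq_Rintegral => p _; rewrite in1 mulN1r opprK.
rewrite EE -integral_EFin_Rintegral//.
have mk p : measurable_fun [set: plane R] (kappa p) by apply/measurable_EFinP; exact: measurable_int (ik p).
have inE' p : ((\int[nu]_q kappa p q)%:E = \int[(leb \x leb)%E]_(q in simplex2 t) (kappa p q)%:E)%E.
  by rewrite -(integral_EFin_Rintegral measurableT (ik p)) (integral_mfrestr mD simplex2_finite (mk p)).
under eq_integral do rewrite inE'.
rewrite ge0_integral_mfrestr; last 2 first.
- under eq_fun do rewrite -inE'; exact: measurable_int ikk.
- by move=> p; apply: integral_ge0 => q _; rewrite lee_fin.
rewrite -ge0_integralZl_EFin//; last 3 first.
- by move=> p _; apply: integral_ge0 => q _; rewrite lee_fin.
- by apply: measurable_funTS; under eq_fun do rewrite -inE'; exact: measurable_int ikk.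
- exact: ltW.
apply: eq_integral => p /set_mem Dp.
rewrite -ge0_integralZl_EFin//; last 3 first.
- by move=> q _; rewrite lee_fin.
- by apply/measurable_EFinP; exact: measurable_funTS.
- exact: ltW.
apply: eq_integral => q /set_mem Dq.
by rewrite -EFinM kappaE// mulrA mulfV ?gt_eqF// mul1r.
Qed.

Lemma inner_alpha_end :
  ((inner P (alpha_hat' B t eps) (B t))%:E = ((Num.sqrt (2 * pi))^-1)%:E *
  \int[(leb \x leb)%E]_(p in simplex2 t)
     (weight eps (p.2 - p.1) * (incr_value_cov 0 t p.2 - incr_value_cov 0 t p.1))%:E)%E.
Proof.
have LB := fbm_square_integrable hB (ltW t0).
have [E1 _ i1] := swap LB.1 (square_integrable_integrable LB).
pose m p := - \int[P]_w (B t w * phi (w, p)).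
have mE p : D p -> m p = (Num.sqrt (2 * pi))^-1 * (weight eps (p.2 - p.1) * (incr_value_cov 0 t p.2 - incr_value_cov 0 t p.1)).
  move=> Dp; have [p1 p2] := D_ge0 Dp.
  transitivity (\int[P]_w (- derive1 (heat_kernel eps) (increment B p.1 p.2 w) * B t w)).
    rewrite /m -mulN1r -RintegralZl//.
      by apply: eq_Rintegral => w _; rewrite phiE// mulN1r mulrC mulNr.
    exact: square_integrable_mul.
  rewrite (expectation_kernel_linear hB)//.
  - rewrite (inner_increment hB)// (inner_increment_end hB) ?(ltW t0)// incr_cov_diag -incr_value_cov_sym.
    by rewrite [X in _ * X = _]mulrC.
  - exact: path_combination_increment.
  - by apply: path_combination_value; exact: ltW.
  - exact: increment_pos.
have m0 p : 0 <= m p.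
  have [Dp|Dp] := pselect (D p).
    rewrite mE// mulr_ge0 ?invr_ge0 ?sqrtr_ge0// mulr_ge0 ?weight_ge0// subr_ge0.
    by apply: incr_value_cov_homo; [exact: ltW|case: Dp => _ [? _]; exact: ltW].
  rewrite /m /Rintegral (_ : (fun w => _) = cst 0%E) ?integral0 ?oppr0//.
  by apply/funext => w /=; rewrite phi0// mulr0.
have im : nu.-integrable [set: plane R] (EFin \o m).
  rewrite (_ : _ \o _ = (fun p => (-1)%:E * (\int[P]_w (B t w * phi (w, p)))%:E)%E).
    exact: integrableZl.
  by apply/funext => p; rewrite -EFinM mulN1r.
have mm : measurable_fun [set: plane R] m by apply/measurable_EFinP; exact: measurable_int im.
have -> : inner P (alpha_hat' B t eps) (B t) = \int[nu]_p m p.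
  rewrite innerC /inner E1 -mulN1r -RintegralZl//.
  by apply: eq_Rintegral => p _; rewrite mulN1r.
rewrite -(integral_EFin_Rintegral measurableT im) (integral_mfrestr mD simplex2_finite mm).
rewrite -ge0_integralZl_EFin; last 4 first.
- exact: mD.
- move=> p [_ [p12 _]]; rewrite lee_fin mulr_ge0 ?weight_ge0// subr_ge0.
  by apply: incr_value_cov_homo; exact: ltW.
- apply/measurable_EFinP; apply: measurable_funTS; apply: measurable_funM.
    exact: measurable_weight_diff.
  by apply: measurable_funB; apply: measurableT_comp => //; exact: measurable_incr_value_cov.
- by rewrite invr_ge0 sqrtr_ge0.
by apply: eq_integral => p /set_mem Dp; rewrite -EFinM mE.
Qed.
End smoothed_derivative.

(** * Approximation in mean square by the endpoint *)

Section mean_square.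
Context {R : realType} d (T : measurableType d) (P : probability T R) (B : R -> {RV P >-> R}).
Hypothesis hB : fractional_brownian_motion (2 / 3) B.

Let ln_eta (t eps : R) : 0 < t -> 0 < eps <= 1 ->
  ln (1 + t / eps `^ (3 / 4)) <= ln (1 + t) + 3 / 4 * ln (1 / eps).
Proof.
move=> t0 /andP[e0 e1]; set eta := eps `^ (3 / 4).
have eta0 : 0 < eta by exact: powR_gt0.
have eta1 : eta <= 1.
  apply: (@le_trans _ _ (1 `^ (3 / 4))); last by rewrite powR1.
  by apply: ge0_ler_powR; rewrite ?nnegrE// ltW.
have t1 : 0 < 1 + t by lra.
have -> : 3 / 4 * ln (1 / eps) = ln eta^-1.
  by rewrite div1r !lnV ?posrE// /eta ln_powR; ring.
rewrite -lnM ?posrE ?invr_gt0// ler_ln ?posrE.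
- by rewrite mulrDl mul1r lerD2r invf_ge1.
- by rewrite addr_gt0// divr_gt0.
- by rewrite mulr_gt0// invr_gt0.
Qed.

(** Substituting the asymptotics of the moments: the terms of order one cancel,
    as 9/16 - 2 (3/4)^2 + 9/16 = 0. *)
Let combine (A M V a b C1 C2 c0 L : R) : 0 <= V -> 0 <= a -> 0 <= C1 -> 1 <= L ->
  A <= c0 ^+ 2 * (V * (a + 3 / 4 * L) ^+ 2 + C1 * (1 + (a + 3 / 4 * L))) ->
  c0 * (V * (b + 3 / 4 * L) - C2) <= M -> 0 < c0 ->
  (L^-1) ^+ 2 * A + 2 * L^-1 * - (3 / 4 * c0) * M + (- (3 / 4 * c0)) ^+ 2 * V <=
  c0 ^+ 2 * (V * a ^+ 2 + 3 / 2 * V * a + C1 * (7 / 4 + a) + 3 / 2 * (C2 - V * b)) * L^-1.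
Proof.
move=> V0 a0 C10 L1 hA hM c00.
have L0 : L != 0 by rewrite gt_eqF//; lra.
set x := L^-1; have xL : x * L = 1 by rewrite mulVf.
have x0 : 0 <= x by rewrite invr_ge0; lra.
have x1 : x <= 1 by rewrite invf_le1//; lra.
have xx : x ^+ 2 <= x by rewrite expr2 ler_piMl.
have := ler_wpM2l (sqr_ge0 x) hA.
have := ler_wpM2l (mulr_ge0 x0 (ltW c00)) hM.
have -> : x ^+ 2 * (c0 ^+ 2 * (V * (a + 3 / 4 * L) ^+ 2 + C1 * (1 + (a + 3 / 4 * L)))) =
  c0 ^+ 2 * (V * (a ^+ 2 * x ^+ 2 + 3 / 2 * a * x * (x * L) + 9 / 16 * (x * L) ^+ 2) +
             C1 * ((1 + a) * x ^+ 2 + 3 / 4 * x * (x * L))) by field.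
have -> : x * c0 * (c0 * (V * (b + 3 / 4 * L) - C2)) = c0 ^+ 2 * (V * (b * x + 3 / 4 * (x * L)) - C2 * x).
  by field.
rewrite xL expr1n !mulr1.
have h1 : 0 <= c0 ^+ 2 * (V * a ^+ 2) * (x - x ^+ 2).
  by rewrite mulr_ge0 ?subr_ge0// mulr_ge0 ?sqr_ge0// mulr_ge0 ?sqr_ge0.
have h2 : 0 <= c0 ^+ 2 * (C1 * (1 + a)) * (x - x ^+ 2).
  by rewrite mulr_ge0 ?subr_ge0// mulr_ge0 ?sqr_ge0// mulr_ge0// addr_ge0.
move: h1 h2; clearbody x; move: (x ^+ 2) => y; clear; nra.
Qed.

Lemma mean_square_error (t : R) : 0 < t -> exists K : R, forall eps : R, 0 < eps -> 1 <= ln (1 / eps) ->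
  let Z := fun w => (ln (1 / eps))^-1 * alpha_hat' B t eps w + - (3 / 4 * (Num.sqrt (2 * pi))^-1) * B t w in
  inner P Z Z <= K * (ln (1 / eps))^-1.
Proof.
move=> t0.
have [C1 [C10 H2]] := second_moment_le t0; have [C2 [C20 H1]] := first_chaos_lower t0.
have p0 : 0 < 2 * pi :> R by rewrite mulr_gt0// pi_gt0.
set c0 : R := (Num.sqrt (2 * pi))^-1.
have c00 : 0 < c0 by rewrite invr_gt0 sqrtr_gt0.
have c02 : c0 ^+ 2 = (2 * pi)^-1 by rewrite exprVn sqr_sqrtr// ltW.
have a0 : 0 <= ln (1 + t) by rewrite ln_ge0// lerDl ltW.
have V0 : 0 <= incr_var t by exact: powR_ge0.
eexists => eps e0 L1 /=.
have e1 : 0 < eps <= 1.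
  rewrite e0 leNgt; apply/negP => e1; move: L1; rewrite leNgt => /negP; apply.
  by apply: le_lt_trans (ltr01); rewrite ln_le0// div1r invf_le1// ltW.
set L := ln (1 / eps).
have Lalpha := alpha_square_integrable hB t0 e0.
have LB := fbm_square_integrable hB (ltW t0).
rewrite inner_lin2//.
have -> : inner P (B t) (B t) = incr_var t.
  by rewrite (fbm_inner hB) ?ltW// subrr incr_var0; field.
have [lo up] := integral_weight_log t0 e1.
have l0 : 0 <= ln (1 + t) + 3 / 4 * L by rewrite addr_ge0// mulr_ge0//; move: L1; rewrite -/L; lra.
apply: (@combine _ _ _ (ln (1 + t)) (ln t - 1) C1 C2) => //.
- have := H2 _ _ e1 up l0; rewrite -(inner_alpha_alpha hB t0 e0) -EFinM lee_fin.
  rewrite mulrC -ler_pdivlMr// mulrC -c02 => /le_trans; apply.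
  rewrite ler_wpM2l ?sqr_ge0// lerD2l ler_wpM2l// lerD2l; exact: ln_eta.
- have := H1 _ e0; have := inner_alpha_end hB t0 e0; rewrite -/c0.
  set I := (\int[_]_(p in _) _)%E => E.
  have -> : I = (c0^-1 * inner P (alpha_hat' B t eps) (B t))%:E.
    by rewrite EFinM E muleA -EFinM mulVf ?mul1e// gt_eqF.
  rewrite -EFinD => /(le_trans _).
  have h : ((incr_var t)%:E * (ln t - 1 + 3 / 4 * ln (1 / eps))%:E <=
            (incr_var t)%:E * \int[lebesgue_measure]_(u in `]0%R, t[) (u * weight eps u)%:E)%E.
    by rewrite lee_wpmul2l.
  move=> /(_ _ h); rewrite -EFinM lee_fin -lerBlDr -(ler_pM2l c00) => /le_trans; apply.
  by rewrite mulrA mulfV ?mul1r// gt_eqF.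
Qed.
End mean_square.

(** * From mean square to law *)

Section law.
Context {R : realType}.

(** Compactness gives one modulus for all z in the segment, while x may leave
    it. *)
Lemma uniform_continuity_segment (g : R -> R) (K e : R) : continuous g -> 0 < e ->
  exists2 del : R, 0 < del & forall z x : R, `|z| <= K -> `|x - z| < del -> `|g x - g z| < e.
Proof.
move=> cg e0.
pose Q (del z : R) := forall x : R, `|x - z| < del -> `|g x - g z| < e.
have /compact_near_coveringP/(_ R (0 : R)^'+ Q _) H := @segment_compact R (- K) K.
have : \forall del \near (0 : R)^'+, `[- K, K] `<=` Q del.
  apply: H => z _.
  have : \forall y \near z, `|g z - g y| < e / 2.
    by move/cvgrPdist_lt : (cg z) => /(_ (e / 2)); apply; rewrite divr_gt0.
  move=> /nbhs_ballP[r /= r0 rg].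
  exists (ball z (r / 2), [set del : R | del < r / 2]) => /=.
    split; first by apply: nbhsx_ballx; rewrite divr_gt0.
    by apply: nbhs_right_lt; rewrite divr_gt0.
  move=> [z' del] /= [zz' delr] x xz'.
  have g1 : `|g z - g z'| < e / 2.
    by apply: rg; apply: le_ball zz'; rewrite ler_pdivrMr// ler_peMr// ?ltW//; lra.
  have g2 : `|g z - g x| < e / 2.
    apply: rg; rewrite -ball_normE /=; move: zz'; rewrite -ball_normE /= => zz'.
    rewrite (_ : z - x = (z - z') - (x - z')); last by ring.
    by apply: le_lt_trans (ler_normB _ _) _; lra.
  rewrite (_ : g x - g z' = (g z - g z') - (g z - g x)); last by ring.
  by apply: le_lt_trans (ler_normB _ _) _; lra.
move=> N; have : \forall del \near (0 : R)^'+, 0 < del /\ `[- K, K] `<=` Q del.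
  by near=> del; split; [near: del; exact: nbhs_right_gt|near: del].
move=> /filter_ex[del [del0 HQ]]; exists del => // z x zK; apply: HQ.
by rewrite /= in_itv/= -ler_norml.
Unshelve. all: by end_near. Qed.

(** Either z is large, or x is far from z, or uniform continuity applies; in the
    first two cases a normalised square exceeds 1. *)
Let pointwise (g : R -> R) (M K e del x z : R) : (forall y, `|g y| <= M) -> 0 <= e -> 0 < K -> 0 < del ->
  (`|z| <= K -> `|x - z| < del -> `|g x - g z| < e) ->
  `|g x - g z| <= e + 2 * M / del ^+ 2 * (x - z) ^+ 2 + 2 * M / K ^+ 2 * z ^+ 2.
Proof.
move=> gM e0 K0 d0 H.
have M0 : 0 <= 2 * M by rewrite mulr_ge0// (le_trans _ (gM 0)).
have g2 : `|g x - g z| <= 2 * M.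
  by apply: le_trans (ler_normB _ _) _; have := gM x; have := gM z; lra.
have big (k y : R) : 0 < k -> k <= `|y| -> 2 * M <= 2 * M / k ^+ 2 * y ^+ 2.
  move=> k0 ky; rewrite -mulrA ler_peMr// mulrC ler_pdivlMr ?exprn_gt0// mul1r.
  by rewrite -[y ^+ 2]real_normK ?num_real// lerXn2r ?nnegrE// ltW.
have nn (k y : R) : 0 <= 2 * M / k ^+ 2 * y ^+ 2.
  by rewrite mulr_ge0 ?sqr_ge0// divr_ge0// sqr_ge0.
have [zK|zK] := leP `|z| K; last first.
  by apply: (le_trans g2); have := big _ _ K0 (ltW zK); have := nn del (x - z); lra.
have [xz|xz] := ltP `|x - z| del; last first.
  by apply: (le_trans g2); have := big _ _ d0 xz; have := nn K z; lra.
by have := H zK xz; have := nn del (x - z); have := nn K z; lra.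
Qed.

(** By [pointwise], whose two squares are controlled as in Chebyshev's inequality:
    the one of Z by the choice of the segment, the other one by the
    hypothesis. *)
Lemma mean_square_cvg_in_law d (T : measurableType d) (P : probability T R) (I : Type)
    (X : I -> T -> R) (F : set_system I) {FF : Filter F} (Z : T -> R) (law : probability (measurableTypeR R) R) :
  square_integrable P Z -> (\forall i \near F, square_integrable P (X i)) ->
  (forall A : set R, measurable A -> P (Z @^-1` A) = law A) ->
  inner P (fun w => X i w - Z w) (fun w => X i w - Z w) @[i --> F] --> (0 : R) ->
  cvg_in_law P X F law.
Proof.
move=> LZ LX lawZ c0; split; first by apply: filterS LX => i [].
move=> g cg [N [_ gN]]; pose M := N + 1.
have gM y : `|g y| <= M by apply: gN => //; rewrite ltrDl.
have mg : measurable_fun [set: R] g by exact: continuous_measurable_fun.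
have gi (Y : T -> R) : measurable_fun [set: T] Y -> P.-integrable [set: T] (fun w => (g (Y w))%:E).
  move=> mY; apply/square_integrable_integrable/(bounded_square_integrable P) => //.
  exact: measurableT_comp.
rewrite -(integral_law LZ.1 lawZ mg (or_intror (gi _ LZ.1))).
rewrite (integral_EFin_Rintegral measurableT (gi _ LZ.1)).
apply: cvg_EFin.
  apply: filterS LX => i [mX _]; rewrite unlock.
  exact: integrable_fin_num (gi _ mX).
apply/cvgrPdist_le => e e0.
have M0 : 0 <= M by rewrite (le_trans _ (gM 0)).
(* large enough for the term in Z ^+ 2 to be at most e / 3 *)
pose K := 1 + 6 * M * inner P Z Z / e.
have q0 : 0 <= 6 * M * inner P Z Z / e.
  by rewrite divr_ge0 ?(ltW e0)// mulr_ge0 ?inner_ge0// mulr_ge0.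
have K0 : 0 < K by rewrite /K; lra.
have e3 : 0 < e / 3 by rewrite divr_gt0.
have [del d0 ug] := uniform_continuity_segment K cg e3.
have dd0 : 0 < del ^+ 2 by rewrite exprn_gt0.
have near0 : \forall i \near F, inner P (fun w => X i w - Z w) (fun w => X i w - Z w) <= e / 3 * del ^+ 2 / (2 * M + 1).
  have h : 0 < e / 3 * del ^+ 2 / (2 * M + 1) by rewrite divr_gt0 ?mulr_gt0//; lra.
  move/cvgrPdist_le : c0 => /(_ _ h); apply: filterS => i.
  by rewrite sub0r normrN; apply: le_trans; exact: ler_norm.
apply: filterS2 LX near0 => i LXi small /=.
rewrite unlock -/(Rintegral P _ _) -RintegralB//; [|exact: gi LZ.1|exact: gi LXi.1].
have LD := square_integrableB LXi LZ.
have integrable_scale (k : R) (f : T -> R) : P.-integrable [set: T] (EFin \o f) -> P.-integrable [set: T] (EFin \o (fun w => k * f w)).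
  move=> fi; rewrite (_ : _ \o _ = (fun w => k%:E * (EFin \o f) w)%E); first exact: integrableZl.
  by apply/funext => w; rewrite /= EFinM.
have integrable_add (f h : T -> R) : P.-integrable [set: T] (EFin \o f) -> P.-integrable [set: T] (EFin \o h) ->
    P.-integrable [set: T] (EFin \o (fun w => f w + h w)).
  move=> fi hi; rewrite (_ : _ \o _ = ((EFin \o f) \+ (EFin \o h))%E); first exact: integrableD.
  by apply/funext => w; rewrite /= EFinD.
have iD : P.-integrable [set: T] (EFin \o (fun w => 2 * M / del ^+ 2 * ((X i w - Z w) * (X i w - Z w)))).
  by apply: integrable_scale; exact: square_integrable_mul.
have iZ : P.-integrable [set: T] (EFin \o (fun w => 2 * M / K ^+ 2 * (Z w * Z w))).
  by apply: integrable_scale; exact: square_integrable_mul.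
have ie : P.-integrable [set: T] (EFin \o (fun=> e / 3)) by exact: finite_measure_integrable_cst.
have id : P.-integrable [set: T] (EFin \o (fun w => g (Z w) - g (X i w))).
  rewrite (_ : _ \o _ = (fun w => (g (Z w))%:E - (g (X i w))%:E)%E)//.
  by apply: integrableB => //; apply: gi; [exact: LZ.1|exact: LXi.1].
apply: (le_trans (le_normr_Rintegral _ id)) => //.
apply: (@le_trans _ _ (\int[P]_w (e / 3 + 2 * M / del ^+ 2 * ((X i w - Z w) * (X i w - Z w)) + 2 * M / K ^+ 2 * (Z w * Z w)))).
  apply: le_Rintegral => //; first exact: integrable_norm id.
    exact: (integrable_add _ _ (integrable_add _ _ ie iD) iZ).
  move=> w _; rewrite distrC -!expr2; apply: pointwise => //; first exact: ltW.
  exact: ug.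
rewrite RintegralD//; last exact: integrable_add.
have cE : \int[P]_w (e / 3) = e / 3.
  by rewrite Rintegral_cst// -[RHS]mulr1; congr (_ * _); rewrite [X in fine X](probability_setT P).
rewrite RintegralD// cE.
rewrite RintegralZl//; last exact: square_integrable_mul.
rewrite RintegralZl//; last exact: square_integrable_mul.
rewrite -/(inner P Z Z) -/(inner P (fun w => X i w - Z w) (fun w => X i w - Z w)).
have h1 : 2 * M / del ^+ 2 * inner P (fun w => X i w - Z w) (fun w => X i w - Z w) <= e / 3.
  have M1 : 0 < 2 * M + 1 by lra.
  have c : 0 <= 2 * M / del ^+ 2 by rewrite divr_ge0 ?mulr_ge0// ltW.
  apply: (le_trans (ler_wpM2l c small)).
  rewrite [leLHS](_ : _ = e / 3 * (2 * M / (2 * M + 1))); last by field; rewrite !gt_eqF.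
  by rewrite ler_piMr ?(ltW e3)// ler_pdivrMr// mul1r; lra.
have h2 : 2 * M / K ^+ 2 * inner P Z Z <= e / 3.
  have K1 : 1 <= K by rewrite /K; lra.
  rewrite mulrAC ler_pdivrMr ?exprn_gt0//.
  apply: (@le_trans _ _ (e / 3 * K)).
    rewrite (_ : e / 3 * K = e / 3 + 2 * M * inner P Z Z); first by lra.
    by rewrite /K; field; rewrite gt_eqF.
  by rewrite ler_wpM2l ?(ltW e3)// expr2 ler_peMr// ltW.
by lra.
Qed.

(** The integrand (1 - x)^(-2/3) - (1 - x)^(1/3) has an explicit primitive. *)
Lemma euler_beta_two_third : euler_beta 2 (1 / 3) = 9 / 4 :> R.
Proof.
pose F (x : R) := 3 / 4 * (1 - x) `^ (4 / 3) - 3 * (1 - x) `^ (1 / 3).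
have c1 (x : R) : {for x, continuous (fun y : R => 1 - y)}.
  by apply: continuousB; [exact: cst_continuous|exact: id].
have cp (q x : R) : x < 1 -> {for x, continuous (fun y : R => (1 - y) `^ q)}.
  move=> x1; apply: (@continuous_comp _ _ _ (fun y : R => 1 - y) (fun y => y `^ q)) => //.
  by apply: continuous_powR; rewrite subr_gt0.
have cF (x : R) : x < 1 -> {for x, continuous F}.
  by move=> x1; apply: continuousB; apply: continuousM; (exact: cst_continuous || exact: cp).
have dF (q x : R) : x < 1 -> is_derive x (1 : R) (fun y : R => (1 - y) `^ q) (- (q * (1 - x) `^ (q - 1))).
  move=> x1; have x10 : 0 < 1 - x by rewrite subr_gt0.
  have d1 : is_derive x (1 : R) (fun y : R => 1 - y) (-1).
    by rewrite -[X in is_derive _ _ _ X]add0r; apply: is_deriveB.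
  have := @is_derive1_comp _ (fun y : R => y `^ q) (fun y : R => 1 - y) x _ _ (is_derive1_powR q x10) d1.
  by rewrite mulrN1.
have lim (q : R) : 0 < q -> (1 - x) `^ q @[x --> 1^'-] --> (0 : R).
  move=> q0.
  apply: (@decreasing_cvg_at_left_comp R (fun x : R => 1 - x) (fun y : R => y `^ q) (BLeft 0) 1).
  - by rewrite bnd_simp.
  - by move=> x y _ _ /=; rewrite ltrD2l ltrN2.
  - by apply: cvg_at_left_filter; exact: c1.
  - by rewrite subrr; exact: powR_cvg0.
have F1 : F 1 = 0 by rewrite /F subrr !powR0 ?mulr0 ?subr0//; lra.
have F0 : F 0 = - (9 / 4) by rewrite /F subr0 !powR1; field.
suff E : (\int[lebesgue_measure]_(x in `]0%R, 1%R[) (x `^ (2 - 1) * (1 - x) `^ (1 / 3 - 1))%:E =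
    (F 1 - F 0)%:E)%E by rewrite /euler_beta /Rintegral E/= F0 F1 sub0r opprK.
apply: (@ge0_FTC_oo _ (fun x : R => x `^ (2 - 1) * (1 - x) `^ (1 / 3 - 1)) F 0 1 ltr01).
- by move=> x _; rewrite mulr_ge0 ?powR_ge0.
- move=> x /andP[x0 x1]; apply: continuousM; last exact: cp.
  exact: continuous_powR.
- move=> x /andP[x0 x1].
  have x10 : 0 < 1 - x by rewrite subr_gt0.
  have := is_deriveB (@is_deriveZ _ _ _ _ (3 / 4) x 1 _ (dF (4 / 3) x x1)) (@is_deriveZ _ _ _ _ 3 x 1 _ (dF (1 / 3) x x1)).
  move/is_derive_eq; apply; rewrite /GRing.scale/=.
  have -> : (1 - x) `^ (4 / 3 - 1) = (1 - x) * (1 - x) `^ (1 / 3 - 1).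
    rewrite -[X in _ = X * _](powRr1 (ltW x10)) -powRD ?(gt_eqF x10) ?implybT//.
    by congr (_ `^ _); field.
  rewrite (_ : 2 - 1 = 1 :> R) ?powRr1 ?ltW//; last by ring.
  by move: (_ `^ _) => y; field.
- by apply: cvg_at_right_filter; apply: cF; exact: ltr01.
- rewrite F1 -[X in _ --> X](subr0 0) /F; apply: cvgB.
    by rewrite -[X in _ --> X](mulr0 (3 / 4)); apply: cvgMr; apply: lim; lra.
  by rewrite -[X in _ --> X](mulr0 3); apply: cvgMr; apply: lim; lra.
Qed.
End law.

Theorem theorem1p4 (R : realType) (d : measure_display)
    (T : measurableType d) (P : probability T R) (B : R -> {RV P >-> R})
    (hB : fractional_brownian_motion (2 / 3) B) (t : R) (ht : 0 < t) :
  cvg_in_law P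
    (fun (eps : R) (w : T) => (ln (1 / eps))^-1 * alpha_hat' B t eps w)
    0^'+
    (gaussian_law 0 (t `^ (4 / 3) / (8 * pi) * euler_beta 2 (1 / 3))).
Proof.
have p0 : 0 < 2 * pi :> R by rewrite mulr_gt0// pi_gt0.
pose c : R := 3 / 4 * (Num.sqrt (2 * pi))^-1.
have cZ : path_combination B (fun w => c * B t w).
  exact/path_combinationZ/path_combination_value/ltW.
have [LZ _] := path_combination_centered hB cZ.
have LB := fbm_square_integrable hB (ltW ht).
have [mZ gZ eZ vZ] := path_combination_gaussian hB cZ.
have [_ lawZ] := gaussian_centered mZ gZ eZ vZ.
have variance : inner P (fun w => c * B t w) (fun w => c * B t w) = t `^ (4 / 3) / (8 * pi) * euler_beta 2 (1 / 3).
  rewrite innerZl// innerZr// (fbm_inner hB) ?ltW// subrr incr_var0 (incr_varE (ltW ht)) euler_beta_two_third.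
  have c2 : c * c = 9 / 16 * (2 * pi)^-1.
    by rewrite -expr2 exprMn exprVn sqr_sqrtr ?(ltW p0)//; congr (_ * _); field.
  rewrite mulrA c2; have := pi_gt0 R; move: (t `^ _) pi => y p q.
  by field; rewrite gt_eqF.
rewrite -variance.
have near1 : \forall eps \near (0 : R)^'+, 0 < eps /\ 1 <= ln (1 / eps).
  near=> eps; have e0 : 0 < eps by near: eps; exact: nbhs_right_gt.
  split => //; rewrite div1r lnV ?posrE// lerNr -[leRHS](@expRK R) ler_ln ?posrE ?expR_gt0//.
  by near: eps; apply: nbhs_right_le; exact: expR_gt0.
apply: (mean_square_cvg_in_law LZ _ lawZ).
  apply: filterS near1 => eps [e0 _]; apply: square_integrableZ.
  exact: (alpha_square_integrable hB ht e0).
have [K HK] := mean_square_error hB ht.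
have logV : (ln (1 / eps))^-1 @[eps --> (0 : R)^'+] --> (0 : R).
  apply/cvgrPdist_le => e e0; near=> eps.
  have ep0 : 0 < eps by near: eps; exact: nbhs_right_gt.
  have l1 : e^-1 <= ln (1 / eps).
    rewrite div1r lnV ?posrE// lerNr -[leRHS](@expRK R) ler_ln ?posrE ?expR_gt0//.
    by near: eps; apply: nbhs_right_le; exact: expR_gt0.
  have ei : 0 < e^-1 by rewrite invr_gt0.
  by rewrite sub0r normrN gtr0_norm ?invr_gt0 ?(lt_le_trans ei)// -[leRHS]invrK lef_pV2 ?posrE// (lt_le_trans ei).
apply: (@squeeze_cvgr _ _ _ _ (fun=> 0) (fun eps : R => K * (ln (1 / eps))^-1)).
- apply: filterS near1 => eps [e0 l1]; rewrite inner_ge0/=.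
  have := HK eps e0 l1; rewrite -/c /=.
  by under [X in inner P X X]funext do rewrite mulNr.
- exact: cvg_cst.
- by rewrite -[X in _ --> X](mulr0 K); exact: cvgMr.
Unshelve. all: by end_near. Qed.
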